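(* Let $k,D\in\mathbb{Z}_{\ge 0}$ and set $F(D)=9D+6+\left\lfloor \frac32\left\lceil \frac{2D+2}{5}\right\rceil\right\rfloor$. Let $G$ be a graph with $\operatorname{mad}(G)\le 2k$, and let $V(G)=V_1\cup V_2\cup V_3$ be a partition with $\Delta(G[V_i])\le D$ for $i=1,2,3$. Then $$\vec{\chi}(G)\le k+F(D)\le k+\left\lfloor \frac{48D}{5}\right\rfloor+8 .$$ Moreover, if the partition $(V_1,V_2,V_3)$ is given as part of the input, then a proper orientation of $G$ with maximum outdegree at most $k+F(D)$ can be found in polynomial time.
   Context: All graphs are finite and simple. $G[S]$ is the subgraph induced by $S$, and $\Delta$ denotes maximum degree (taken as $0$ for the empty graph). Parts of a partition may be empty. For an orientation $Q$ of $G$, $d^+_Q(v)$ is the outdegree of $v$ and $\Delta^+(Q)=\max_v d^+_Q(v)$. The orientation $Q$ is proper if $d^+_Q(u)\ne d^+_Q(v)$ for every edge $uv\in E(G)$. The proper orientation number is $\vec{\chi}(G)=\min\{\Delta^+(Q): Q\text{ is a proper orientation of }G\}$. The maximum average degree of a nonempty graph is $\operatorname{mad}(G)=\max\{2|E(H)|/|V(H)| : \varnothing\ne H\subseteq G\}$ (over nonempty subgraphs $H$), and $\operatorname{mad}(\varnothing)=0$. *)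

(* Defs.v *)
From HB Require Import structures.
From mathcomp Require Import all_boot all_order all_algebra.

Set Implicit Arguments.
Unset Strict Implicit.
Unset Printing Implicit Defensive.

(** * Graphs *)

Record sgraph (T : finType) := SGraph {
  edge :> rel T;
  edge_sym : symmetric edge;
  edge_irr : irreflexive edge
}.

Section Graphs.
Variable T : finType.
Implicit Types (G : sgraph T) (S W : {set T}) (Q : {set T * T}).

Definition degree G v := #|[set u | G v u]|.

Definition max_degree G := \max_v degree G v.

Definition edges G : {set {set T}} :=
  [set [set p.1; p.2] | p : T * T & G p.1 p.2].

(* A candidate subgraph is a pair (vertex set, edge set). *)
Definition is_subgraph G (H : {set T} * {set {set T}}) :=
  (H.2 \subset edges G) && (cover H.2 \subset H.1).

(* All the ratios are nonnegative, so the neutral element 0 only matters for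
   the empty graph. *)
Definition mad G : rat :=
  (\big[Order.max/0]_(H : {set T} * {set {set T}}
                        | is_subgraph G H && (H.1 != set0))
     ((2 * #|H.2|)%:R / #|H.1|%:R))%R.

(* [partition] from finset excludes empty blocks, which are allowed here. *)
Definition tripartition (V1 V2 V3 : {set T}) :=
  [&& V1 :|: V2 :|: V3 == [set: T], [disjoint V1 & V2],
      [disjoint V1 & V3] & [disjoint V2 & V3]].

(** * Proper orientations *)

(* [(u, v) \in Q] means that the edge uv is directed from u to v. *)
Definition is_orientation G Q :=
  [forall u, forall v,
     (((u, v) \in Q) ==> G u v)
     && (G u v ==> ((u, v) \in Q) (+) ((v, u) \in Q))].

Definition outdegree Q v := #|[set u | (v, u) \in Q]|.

Definition max_outdegree Q := \max_v outdegree Q v.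

Definition proper_orientation G Q :=
  is_orientation G Q
  && [forall u, forall v, G u v ==> (outdegree Q u != outdegree Q v)].

(* Direct all edges out of a vertex of maximum degree, delete it, repeat. *)
Lemma proper_orientation_exists G : exists Q, proper_orientation G Q.
Proof.
pose deg S v := #|[set u in S | G v u]|.
suff main S : exists Q : {set T * T},
    [/\ forall u v, (u, v) \in Q -> [/\ u \in S, v \in S & G u v],
        forall u v, u \in S -> v \in S -> G u v ->
          ((u, v) \in Q) (+) ((v, u) \in Q)
      & forall u v, u \in S -> v \in S -> G u v ->
          outdegree Q u != outdegree Q v].
  have [Q [Q1 Q2 Q3]] := main [set: T].
  exists Q; apply/andP; split; apply/forallP=> u; apply/forallP=> v.
    apply/andP; split; apply/implyP; first by case/Q1.
    by apply: Q2; rewrite inE.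
  by apply/implyP; apply: Q3; rewrite inE.
have [n] := ubnP #|S|; elim: n S => // n IHn S leSn.
have [->|[v0 v0S]] := set_0Vmem S.
  by exists set0; split=> [u v|u v|u v]; rewrite inE.
case: (@arg_maxnP _ v0 (fun v => v \in S) (deg S) v0S) => v vS maxv.
have {IHn} [|Q [Q1 Q2 Q3]] := IHn (S :\ v).
  by move: leSn; rewrite (cardsD1 v S) vS.
have Qv w : ((v, w) \in Q) = false.
  by apply/negP => /Q1[]; rewrite !inE eqxx.
have Qw w : ((w, v) \in Q) = false.
  by apply/negP => /Q1[]; rewrite !inE eqxx.
pose R := Q :|: [set p | [&& p.1 == v, p.2 \in S & G v p.2]].
have inR u w : ((u, w) \in R) = ((u, w) \in Q) || [&& u == v, w \in S & G v w].
  by rewrite !inE.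
have outv : outdegree R v = deg S v.
  by apply: eq_card => w; rewrite !inE /= Qv eqxx.
have outN u : u != v -> outdegree R u = outdegree Q u.
  by move=> uv; apply: eq_card => w; rewrite !inE /= (negPf uv) orbF.
have lt_out u : u \in S -> G v u -> outdegree R u < outdegree R v.
  move=> uS Gvu; have uv : u != v.
    by apply/eqP=> uv; rewrite uv edge_irr in Gvu.
  rewrite outv outN //; apply: leq_trans (maxv u uS).
  apply: proper_card; apply/properP; split.
    by apply/subsetP=> w; rewrite !inE => /Q1[_]; rewrite !inE => /andP[_ ->].
  by exists v; rewrite inE ?Qw // vS edge_sym.
exists R; split=> [u w|u w uS wS|u w uS wS].
- rewrite inR => /orP[/Q1[]|/and3P[/eqP-> -> ->]]; last by split.
  by rewrite !inE => /andP[_ ->] /andP[_ ->] ->.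
- case: (eqVneq u v) => [->|uv] Guw.
    rewrite !inR Qv Qw wS Guw eqxx /=.
    by case: eqP Guw => // ->; rewrite edge_irr.
  case: (eqVneq w v) Guw => [->|wv] Guw.
    by rewrite !inR Qv Qw uS eqxx (negPf uv) edge_sym Guw.
  by rewrite !inR (negPf uv) (negPf wv) !orbF; apply: Q2; rewrite ?inE ?uv ?wv.
- case: (eqVneq u v) => [->|uv] Guw.
    by rewrite eq_sym neq_ltn lt_out.
  case: (eqVneq w v) Guw => [->|wv] Guw.
    by rewrite neq_ltn lt_out // edge_sym.
  by rewrite !outN //; apply: Q3; rewrite ?inE ?uv ?wv.
Qed.

Lemma proper_orientation_value_exists G :
  exists m, [exists Q, proper_orientation G Q && (max_outdegree Q == m)].
Proof.
have [Q pQ] := proper_orientation_exists G.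
by exists (max_outdegree Q); apply/existsP; exists Q; rewrite pQ eqxx.
Qed.

Definition proper_orientation_number G : nat :=
  ex_minn (proper_orientation_value_exists G).

Section Induced.
Variables (G : sgraph T) (S : {set T}).

Definition induced_rel : rel {x : T | x \in S} :=
  fun x y => G (val x) (val y).

Fact induced_sym : symmetric induced_rel.
Proof. by move=> x y; apply: edge_sym. Qed.

Fact induced_irr : irreflexive induced_rel.
Proof. by move=> x; apply: edge_irr. Qed.

Definition induced : sgraph {x : T | x \in S} :=
  SGraph induced_sym induced_irr.
End Induced.

End Graphs.

Definition ceil_div m d := (m + d.-1) %/ d.

Definition F D := 9 * D + 6 + (3 * ceil_div (2 * D + 2) 5) %/ 2.

(** * Computation

   Structured programs for a random access machine with registers and an
   indirectly addressed memory, both holding natural numbers.  Every executed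
   command or test costs one unit: expressions of a fixed program have bounded
   size, and since addition and truncated subtraction are the only arithmetic
   operations, the bit length of the numbers grows at most linearly with time.
   Running time is thus polynomially related to that of Turing machines. *)

Inductive expr :=
  | Const of nat
  | Var of nat
  | Get of expr
  | Plus of expr & expr
  | Minus of expr & expr.

Inductive cmd :=
  | Skip
  | Assign of nat & expr
  | Store of expr & expr
  | Seq of cmd & cmd
  | If of expr & cmd & cmd
  | While of expr & cmd.

Record state := State { reg : nat -> nat; heap : nat -> nat }.

Definition update (f : nat -> nat) a x : nat -> nat :=
  fun b => if b == a then x else f b.

Fixpoint eval (s : state) (e : expr) : nat :=
  match e with
  | Const x => x
  | Var r => reg s r
  | Get e1 => heap s (eval s e1)
  | Plus e1 e2 => eval s e1 + eval s e2
  | Minus e1 e2 => eval s e1 - eval s e2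
  end.

(* [exec c s t s']: started in [s], the program [c] halts in [s'] after [t]
   steps. *)
Inductive exec : cmd -> state -> nat -> state -> Prop :=
  | ExecSkip s : exec Skip s 1 s
  | ExecAssign r e s :
      exec (Assign r e) s 1 (State (update (reg s) r (eval s e)) (heap s))
  | ExecStore e1 e2 s :
      exec (Store e1 e2) s 1
        (State (reg s) (update (heap s) (eval s e1) (eval s e2)))
  | ExecSeq c1 c2 s t1 s1 t2 s2 :
      exec c1 s t1 s1 -> exec c2 s1 t2 s2 -> exec (Seq c1 c2) s (t1 + t2) s2
  | ExecIfTrue e c1 c2 s t s1 :
      eval s e != 0 -> exec c1 s t s1 -> exec (If e c1 c2) s t.+1 s1
  | ExecIfFalse e c1 c2 s t s1 :
      eval s e = 0 -> exec c2 s t s1 -> exec (If e c1 c2) s t.+1 s1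
  | ExecWhileTrue e c s t1 s1 t2 s2 :
      eval s e != 0 -> exec c s t1 s1 -> exec (While e c) s1 t2 s2 ->
      exec (While e c) s (t1 + t2).+1 s2
  | ExecWhileFalse e c s : eval s e = 0 -> exec (While e c) s 1 s.

(* Words are passed in memory from address 0 on, their length in register 0. *)
Definition input_state (w : seq nat) : state :=
  State (fun r => if r == 0 then size w else 0) (nth 0 w).

Definition output (s : state) : seq nat := mkseq (heap s) (reg s 0).

Definition encode_rel n (r : rel 'I_n) : seq nat :=
  [seq nat_of_bool (r u v) | u <- enum 'I_n, v <- enum 'I_n].

Definition encode_set n (S : {set 'I_n}) : seq nat :=
  [seq nat_of_bool (v \in S) | v <- enum 'I_n].

(* All entries are at most the length of the word, so that length is a fair
   measure of the input size. *)
Definition encode_instance n (G : sgraph 'I_n) (V1 V2 V3 : {set 'I_n}) :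
    seq nat :=
  n :: encode_rel G ++ encode_set V1 ++ encode_set V2 ++ encode_set V3.

Definition encode_orientation n (Q : {set 'I_n * 'I_n}) : seq nat :=
  encode_rel (fun u v => (u, v) \in Q).

(* Main.v *)
Require Import Defs.
From mathcomp Require Import all_boot all_order all_algebra zify.

Set Implicit Arguments.
Unset Strict Implicit.
Unset Printing Implicit Defensive.

(** Write [p = D + 1]. A graph with [mad G <= 2k] has an orientation with all
    outdegrees at most [k]: if no chain of reversals leads from a vertex of
    excessive outdegree to one with room, then the vertices within reach span
    more than [k] edges per vertex ([balanced_orientation]).

    Starting from such an orientation, vertices receive their final outdegree
    level by level, for [y = k + 9p - 2] down to [y = 0]. At level [y] a stable
    set [P] of unprocessed vertices is chosen, and edges between [P] and the
    other unprocessed vertices are reversed so that the outdegree of every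
    vertex of [P] becomes [y]; then [P] counts as processed and its edges stay
    as they are. A level is a stable set and different levels give different
    outdegrees, so the final orientation is proper, with outdegrees at most
    [k + 9D + 7 <= k + F D].

    What has to be shown is that every vertex gets processed. The [ceiling] of
    a vertex is the outdegree it could still reach. A vertex is eligible for
    level [y] if its ceiling is at least [y], and if it is left out, the
    ceiling has to come down as fast as the level does. Therefore each
    left-out eligible vertex must receive an edge from [P], a guard; vertices
    of the class that leads the level must receive two, unless [P] contains a
    neighbour of their own class, and that can happen at most [D] times to the
    same vertex. For [2p] levels the classes [V3] and [V2] lead in turn, then
    [V1] leads for [p] levels, [V3] for [2p] levels and [V2] from there on; in
    the first [3p] levels only vertices of the leading class are eligible.
    With this schedule no ceiling of an unprocessed vertex exceeds the level
    once [y < k + 2p], and this state perpetuates itself ([on_track_step]).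

    A suitable [P] maximizes a weight locally, with respect to inserting a
    stable subset of one class and expelling its neighbours. Assigning the
    guards is again a matter of reversing edges within given capacities. If
    this gets stuck, there is a set [S] of vertices in [P] whose room is less
    than what is demanded from them ([guard_success]). But a class has maximum
    degree [D], so a greedy stable set of badly served vertices contains at
    least one in [p] of them, and as inserting it does not increase the weight,
    few vertices are badly served ([shortage_mixed], [shortage_lex]). The
    lengths of the phases are chosen so that the room exceeds this bound
    ([on_track_room]).

    Each of these choices can be made in polynomial time. The algorithm is
    written in a language of assignments to arrays indexed by pairs of
    vertices, which is compiled to the machine once and for all
    ([executable_correct]) and whose semantics are plain functions
    ([orient_correct]). The existence of the orientation is read off from
    the algorithm, too. *)

(** * Swaps and missing guards *)

Section Counting.
Variables (T : finType) (G : sgraph T).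
Implicit Types (A B I P Z S : {set T}) (u v w : T).

Definition nbrs v A := [set u in A | G v u].
Definition nb v A := #|nbrs v A|.
Definition stable A := forall u v, u \in A -> v \in A -> ~~ G u v.
Definition dominates I A := forall v, v \in A -> v \in I \/ exists2 u, u \in I & G u v.

Lemma nb_sum v A : nb v A = \sum_(u in A) G v u.
Proof.
rewrite /nb -sum1_card big_mkcond [RHS]big_mkcond; apply: eq_bigr => u _.
by rewrite inE; case: (u \in A); case: (G v u).
Qed.

Lemma nb0 v A u : nb v A = 0 -> u \in A -> ~~ G v u.
Proof.
move=> /eqP; rewrite cards_eq0 => /eqP e uA; apply/negP => gvu.
by have := in_set0 u; rewrite -e inE uA gvu.
Qed.

Lemma nbS v A B : A \subset B -> nb v A <= nb v B.
Proof.
by move=> AB; apply: subset_leq_card; apply/subsetP=> u; rewrite !inE => /andP[/(subsetP AB) -> ->].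
Qed.

Variables (cl : T -> 'I_3) (D : nat).

Definition own v := [set u | cl u == cl v].

Hypothesis small : forall v, nb v (own v) <= D.

(** A dominating vertex covers itself and at most [D] other vertices of its
    class. *)
Lemma dominates_card I A cc : dominates I A -> (forall v, v \in A -> cl v = cc) ->
  (forall v, v \in I -> cl v = cc) -> #|A| <= D.+1 * #|I|.
Proof.
move=> dom clA clI.
have sub : A \subset \bigcup_(u in I) (u |: nbrs u (own u)).
  apply/subsetP => v vA; apply/bigcupP.
  case: (dom v vA) => [vI|[u uI guv]]; first by exists v; rewrite ?inE ?eqxx.
  by exists u; rewrite // !inE guv andbT (clA v) // (clI u) // eqxx orbT.
apply: leq_trans (subset_leq_card sub) _.
have le_sum : #|\bigcup_(u in I) (u |: nbrs u (own u))| <= \sum_(u in I) D.+1.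
  rewrite big_mkcond [X in _ <= X]big_mkcond.
  elim/big_ind2: _ => [|A1 n1 A2 n2 h1 h2|u _]; first by rewrite cards0.
    by apply: leq_trans (leq_card_setU _ _) _; apply: leq_add.
  case: ifP => _; rewrite ?cards0 //.
  by rewrite cardsU1 -add1n; apply: leq_add (small u); case: (_ \notin _).
by rewrite (leq_trans le_sum) // sum_nat_const mulnC.
Qed.

Section NoImprovement.
Variables (Z P : {set T}) (c : 'I_3) (a b : nat).
Hypothesis PZ : P \subset Z.

Definition blocked v := [exists u in P, G v u && (cl u == cl v)].
(** A guard costs a left-out vertex one unit of its ceiling, and one unit
    per level keeps pace with the level. A vertex of the leading class [c]
    has to gain on the level: either it is blocked, and so has fewer
    unprocessed neighbours in its class afterwards, or it gets a second
    guard. *)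
Definition demand v := if (cl v == c) && ~~ blocked v then 2 else 1.
(** Suppose that the vertices of [S] have no room for further guards. For [h
    = 0] these vertices get no guard from elsewhere, for [h = 1] not both of
    the guards due in the leading class. *)
Definition candidates S cc h :=
  [set v in Z :\: P | [&& cl v == cc, ~~ blocked v & nb v (P :\: S) <= h]].
Definition class cc := [set v | cl v == cc].
Definition weight A := a * #|A :&: class c| + b * #|A :\: class c|.
Definition swap I := I :|: [set w in P | nb w I == 0].

Definition maximal I A := [/\ I \subset A, stable I & dominates I A].

(** The outcome of a failed swap. The set [I] is grown greedily, from the
    worst served candidates first; those with one firm guard are of interest
    in the leading class only, where two guards are due. *)
Definition no_gain S cc := exists I0 I,
  [/\ maximal I0 (candidates S cc 0), I0 \subset I,
      if cc == c then maximal I (candidates S cc 1) else I = I0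
    & weight (swap I) <= weight P].

Lemma weightU A B : [disjoint A & B] -> weight (A :|: B) = weight A + weight B.
Proof.
move=> dAB; rewrite /weight setIUl setDUl !cardsU.
have -> : A :&: class c :&: (B :&: class c) = set0.
  by rewrite setIACA (disjoint_setI0 dAB) set0I.
have -> : (A :\: class c) :&: (B :\: class c) = set0.
  by apply/eqP; rewrite -subset0 -(disjoint_setI0 dAB) setISS ?subsetDl.
by rewrite !cards0 !subn0; lia.
Qed.

(** The swap expels exactly the neighbours of [I]. *)
Lemma weight_swap I : [disjoint I & P] -> weight (swap I) <= weight P ->
  weight I <= weight [set w in P | 0 < nb w I].
Proof.
move=> dIP; rewrite /swap weightU; last first.
  apply: disjointWr dIP; apply/subsetP=> w; rewrite inE => /andP[] //.
have {2}-> : P = [set w in P | nb w I == 0] :|: [set w in P | 0 < nb w I].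
  by apply/setP=> w; rewrite !inE -andb_orr lt0n orbN andbT.
rewrite weightU; first by lia.
by rewrite -setI_eq0; apply/eqP/setP=> w; rewrite !inE; case: (w \in P); case: posnP.
Qed.

Lemma candidates_disjoint S cc h I : I \subset candidates S cc h -> [disjoint I & P].
Proof.
move=> /subsetP IC; rewrite -setI_eq0; apply/eqP/setP=> w; rewrite !inE.
by apply/negP => /andP[/IC]; rewrite !inE => /andP[/andP[/negP]].
Qed.

Lemma candidates_class S cc h v : v \in candidates S cc h -> cl v = cc.
Proof. by rewrite inE => /andP[_ /and3P[/eqP]]. Qed.

Lemma nb_gt0 v A : 0 < nb v A -> exists2 u, u \in A & G v u.
Proof. by move=> /card_gt0P[u]; rewrite inE => /andP[]; exists u. Qed.

Lemma neighbour_class S cc h u w : u \in candidates S cc h -> w \in P -> G w u ->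
  cl w != cc.
Proof.
rewrite inE => /andP[_ /and3P[/eqP <- nbl _]] wP gwu; apply: contra nbl => e.
by apply/exists_inP; exists w; rewrite // edge_sym gwu.
Qed.

(** The candidates have their neighbours in [P] inside [S] and outside their
    own class, so that is where the expelled weight comes from. *)
Lemma other_class S cc : cc != c -> no_gain S cc ->
  exists x, [/\ #|candidates S cc 0| <= D.+1 * x &
    b * x <= a * #|P :&: S :&: class c| + b * #|P :&: S :\: class c :\: class cc|].
Proof.
move=> ncc [I0 [I [[sub0 st0 dom0] _]]]; rewrite (negPf ncc) => -> le_w.
exists #|I0|; split.
  apply: dominates_card dom0 _ _ => v; first exact: candidates_class.
  by move/(subsetP sub0)/candidates_class.
have := weight_swap (candidates_disjoint sub0) le_w.
have -> : weight I0 = b * #|I0|.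
  rewrite /weight (_ : I0 :&: class c = set0) ?cards0 ?muln0 //.
    rewrite add0n (_ : I0 :\: class c = I0) //; apply/setDidPl.
    rewrite disjoints_subset; apply/subsetP=> v /(subsetP sub0)/candidates_class.
    by rewrite !inE => ->.
  apply/setP=> v; rewrite !inE; apply/negP=> /andP[/(subsetP sub0)/candidates_class ->].
  by rewrite (negPf ncc).
have sub : [set w in P | 0 < nb w I0] \subset P :&: S :\: class cc.
  apply/subsetP=> w; rewrite !inE => /andP[wP /nb_gt0[u uI gwu]].
  have uC := subsetP sub0 _ uI; rewrite (neighbour_class uC) // wP /=.
  apply: contraTT gwu => nwS; rewrite edge_sym; move: uC; rewrite inE leqn0.
  case/andP=> _ /and3P[_ _ /eqP e]; apply: (nb0 e).
  by rewrite inE nwS.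
move=> h; apply: leq_trans h _; rewrite /weight leq_add // leq_mul2l; apply/orP; right.
  apply: subset_leq_card; apply: setSI; apply: subset_trans sub _; exact: subsetDl.
by rewrite setDDl setUC -setDDl; apply: subset_leq_card; apply: setSD.
Qed.

(** All expelled vertices lie outside the leading class and have weight [b];
    apart from [S], there is at most one of them for each vertex of [I]
    outside [I0]. *)
Lemma same_class S : b <= a -> no_gain S c ->
  exists x y, [/\ #|candidates S c 0| <= D.+1 * x, #|candidates S c 1| <= D.+1 * (x + y) &
    a * x + (a - b) * y <= b * #|P :&: S :\: class c|].
Proof.
move=> ba [I0 [I [[sub0 st0 dom0] I0I]]]; rewrite eqxx => -[sub st dom] le_w.
have clI v : v \in I -> cl v = c by move/(subsetP sub)/candidates_class.
have cardI : #|I| = #|I0| + #|I :\: I0|.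
  by rewrite -(cardsID I0 I) (setIidPr I0I).
exists #|I0|, #|I :\: I0|; split.
- apply: dominates_card dom0 _ _ => v; first exact: candidates_class.
  by move/(subsetP sub0)/candidates_class.
- rewrite -cardI; apply: dominates_card dom _ _ => v; first exact: candidates_class.
  exact: clI.
have := weight_swap (candidates_disjoint sub) le_w.
have -> : weight I = a * #|I|.
  rewrite /weight (_ : I :\: class c = set0) ?cards0 ?muln0 ?addn0.
    by congr (_ * #|pred_of_set _|); apply/setIidPl/subsetP=> v /clI; rewrite inE => ->.
  by apply/setP=> v; rewrite !inE; apply/negP=> /andP[nc /clI e]; rewrite e eqxx in nc.
set N := [set w in P | _]; have Ncl w : w \in N -> cl w != c.
  rewrite inE => /andP[wP /nb_gt0[u uI gwu]].
  exact: (neighbour_class (subsetP sub _ uI)).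
have -> : weight N = b * #|N|.
  rewrite /weight (_ : N :&: class c = set0) ?cards0 ?muln0 ?add0n.
    congr (_ * #|pred_of_set _|); apply/setDidPl; rewrite disjoints_subset.
    by apply/subsetP=> v vN; rewrite !inE (Ncl v vN).
  apply/setP=> v; rewrite in_setI in_set0; apply/negP=> /andP[vN].
    by rewrite inE (negPf (Ncl v vN)).
have leN : #|N| <= #|P :&: S :\: class c| + #|I :\: I0|.
  rewrite -(cardsID S N); apply: leq_add.
    apply: subset_leq_card; apply/subsetP=> w; rewrite inE => /andP[wN wS].
    by rewrite !inE wS (Ncl w wN) andbT; move: wN; rewrite inE => /andP[].
  apply: (@leq_trans (\sum_(u in I) nb u (P :\: S))).
    have subU : N :\: S \subset \bigcup_(u in I) nbrs u (P :\: S).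
      apply/subsetP=> w; rewrite !inE => /andP[nwS /andP[wP /nb_gt0[u uI gwu]]].
      by apply/bigcupP; exists u; rewrite // !inE nwS wP edge_sym.
    apply: leq_trans (subset_leq_card subU) _.
    rewrite big_mkcond [X in _ <= X]big_mkcond.
    elim/big_ind2: _ => [|A1 n1 A2 n2 h1 h2|u _]; first by rewrite cards0.
      by apply: leq_trans (leq_card_setU _ _) _; apply: leq_add.
    by case: ifP => _; rewrite ?cards0.
  rewrite (bigID (mem I0)) /= big1 ?add0n => [|u /andP[_ uI0]]; last first.
    have := subsetP sub0 _ uI0; rewrite inE leqn0.
    by case/andP=> _ /and3P[_ _ /eqP].
  rewrite (eq_bigl (fun u => u \in I :\: I0)) => [|u]; last by rewrite !inE andbC.
  rewrite -sum1_card; apply: leq_sum => u; rewrite in_setD => /andP[_ uI].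
  by have := subsetP sub _ uI; rewrite inE => /andP[_ /and3P[]].
move=> h; have {}h := leq_trans h (_ : _ <= b * _).
have : a * #|I| <= b * (#|P :&: S :\: class c| + #|I :\: I0|).
  by apply: h; rewrite leq_mul2l leN orbT.
by rewrite cardI mulnBl; nia.
Qed.

(** A blocked vertex that is short of guards has all its neighbours in [P]
    inside [S], one of them in its own class, and is counted there by the
    first sum. An unblocked one is a candidate once for each missing guard. *)
Lemma demand_bound S : S \subset P ->
  \sum_(v in Z :\: P) (demand v - nb v (P :\: S)) <=
    \sum_(w in S) nb w (Z :&: own w)
    + (\sum_(cc | cc != c) #|candidates S cc 0|
      + (#|candidates S c 0| + #|candidates S c 1|)).
Proof.
move=> SP; rewrite (bigID blocked) /=; apply: leq_add.
  have -> : \sum_(w in S) nb w (Z :&: own w) =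
            \sum_(w in S) \sum_(v in Z | cl v == cl w) G w v.
    apply: eq_bigr => w _; rewrite nb_sum; apply: eq_bigl => v.
    by rewrite !inE.
  rewrite (exchange_big_dep (mem Z)) /=; last by move=> w v _ /andP[].
  rewrite [X in _ <= X](bigID (fun v => (v \in P) || ~~ blocked v)) /=.
  apply: leq_trans (leq_addl _ _).
  rewrite (eq_bigl (fun v => (v \in Z) && ~~ ((v \in P) || ~~ blocked v))) => [|v]; last first.
    by rewrite !inE negb_or negbK andbCA andbA.
  apply: leq_sum => v /andP[vZ]; rewrite negb_or negbK => /andP[vP bv].
  rewrite /demand bv andbF.
  have [e|pos] := posnP (nb v (P :\: S)); last first.
    by rewrite (_ : 1 - _ = 0) //; lia.
  rewrite e subn0; case/exists_inP: bv => w wP /andP[gvw cwv].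
  have wS : w \in S.
    by apply: contraTT gvw => nwS; apply: (nb0 e); rewrite inE nwS.
  rewrite (bigD1 w) /=; last by rewrite wS vZ eq_sym cwv.
  by rewrite (edge_sym G w) gvw.
rewrite (bigID (fun v => cl v == c)) /= addnC; apply: leq_add.
  rewrite (eq_bigr (fun v => \sum_(cc | cc != c) (v \in candidates S cc 0 : nat))); last first.
    move=> v /andP[/andP[vZ nb_v] ncv]; rewrite (bigD1 (cl v)) //= big1 ?addn0.
      rewrite /demand (negPf ncv) inE vZ eqxx nb_v leqn0 /=.
      by case: posnP => [->|]; rewrite //; lia.
    by move=> cc /andP[_ /negPf ncc]; rewrite inE eq_sym ncc andbF.
  rewrite exchange_big /=; apply: leq_sum => cc ncc.
  rewrite -sum1_card [X in _ <= X]big_mkcond [X in X <= _]big_mkcond /=; apply: leq_sum => v _.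
  by case: (_ \in candidates _ _ _); case: ifP.
rewrite (eq_bigr (fun v => (v \in candidates S c 0) + (v \in candidates S c 1))); last first.
  move=> v /andP[/andP[vZ nb_v] cv]; rewrite !inE /demand cv nb_v; move: vZ; rewrite inE => ->.
  by case: (nb v _) => [|[|k]].
rewrite big_split /=; apply: leq_add.
  rewrite -sum1_card [X in _ <= X]big_mkcond [X in X <= _]big_mkcond /=; apply: leq_sum => v _.
  by case: (_ \in candidates _ _ _); case: ifP.
rewrite -sum1_card [X in _ <= X]big_mkcond [X in X <= _]big_mkcond /=; apply: leq_sum => v _.
by case: (_ \in candidates _ _ _); case: ifP.
Qed.

End NoImprovement.

Lemma other_two (c : 'I_3) : exists c1 c2 : 'I_3,
  [/\ c1 != c, c2 != c, forall F : 'I_3 -> nat, \sum_(cc | cc != c) F cc = F c1 + F c2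
    & forall A : {set T}, #|A :\: class c| =
        #|A :\: class c :\: class c1| + #|A :\: class c :\: class c2|].
Proof.
have three (x : 'I_3) : [|| x == 0 :> nat, x == 1 :> nat | x == 2 :> nat].
  by case: x => [[|[|[|]]]].
suff [c1 [c2 [n1 n2 n12]]] : exists c1 c2, [/\ c1 != c, c2 != c & c1 != c2].
  have all3 x : [|| x == c, x == c1 | x == c2].
    move: (three x) (three c) (three c1) (three c2) n1 n2 n12.
    by rewrite -!(inj_eq val_inj) /=; lia.
  exists c1, c2; split=> // [F|A].
    rewrite (bigD1 c1) //= (bigD1 c2) /= ?n2 1?eq_sym // big1 ?addn0 // => x.
    by have := all3 x; do 3!case: eqP => //.
  rewrite -(cardsID (class c1) (A :\: class c)) addnC; congr (_ + _).
  apply: eq_card => v; have := all3 (cl v).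
  have : ~~ ((cl v == c1) && (cl v == c2)).
    by apply/negP=> /andP[/eqP->]; apply/negP.
  rewrite !inE; case: (cl v == c); case: (cl v == c1); case: (cl v == c2); case: (v \in A) => //.
case: c {three} => [[|[|[|]]]] // i.
- by exists (inord 1), (inord 2); rewrite -!(inj_eq val_inj) /= !inordK.
- by exists (inord 0), (inord 2); rewrite -!(inj_eq val_inj) /= !inordK.
by exists (inord 0), (inord 1); rewrite -!(inj_eq val_inj) /= !inordK.
Qed.

Section Bounds.
Variables (Z P S : {set T}) (c : 'I_3).
Hypotheses (PZ : P \subset Z) (SP : S \subset P).

(** The inequalities for the three classes add up to three candidates per
    vertex of [S], up to the factor [D.+1], no matter how [S] is spread over
    the classes. This is where the ratio 3 to 2 comes from. *)
Lemma shortage_mixed : (forall cc, no_gain Z P c 3 2 S cc) ->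
  \sum_(v in Z :\: P) (demand P c v - nb v (P :\: S)) <=
    \sum_(w in S) (nb w (Z :&: own w) + 3 * D.+1).
Proof.
move=> ng; apply: leq_trans (demand_bound c PZ SP) _.
rewrite big_split sum_nat_const leq_add2l /=.
have [c1 [c2 [n1 n2 -> split3]]] := other_two c.
have [x1 [le1 w1]] := other_class PZ n1 (ng c1).
have [x2 [le2 w2]] := other_class PZ n2 (ng c2).
have [x [y [le3 le4 w3]]] := same_class PZ (isT : 2 <= 3) (ng c).
rewrite (setIidPr SP) in w1 w2 w3.
have := split3 S; have := cardsID (class c) S.
move: w1 w2 w3; set s := #|S|; set s0 := #|S :&: _|; set s1 := #|S :\: _ :\: _|.
set s2 := #|S :\: _ :\: class c2|; set t := #|S :\: _| => w1 w2 w3 e1 e2.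
(* The inequalities are [2 x1 <= 3 s0 + 2 s1], [2 x2 <= 3 s0 + 2 s2] and [3
   x + y <= 2 t] with [t = s1 + s2], so the sum is at most [3 s0 + t + 2 t =
   3 s]. *)
apply: (@leq_trans (D.+1 * (x1 + x2 + (x + (x + y))))).
  rewrite !mulnDr; move: le1 le2 le3 le4; rewrite !mulnDr; lia.
by rewrite mulnCA mulnC mulnA leq_mul2r; lia.
Qed.

(** Nearly equal weights make a swap pay as soon as it increases the number
    of vertices, or keeps it and shifts vertices to the leading class. When
    [S] lies in the leading class, candidates of that class would expel
    nothing from [S] and always be worth swapping in, so there are none; any
    other class has at most [D.+1 * #|S|]. *)
Lemma shortage_lex N : #|S| <= N -> S \subset class c ->
  (forall cc, no_gain Z P c N.+2 N.+1 S cc) ->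
  \sum_(v in Z :\: P) (demand P c v - nb v (P :\: S)) <=
    \sum_(w in S) (nb w (Z :&: own w) + 2 * D.+1).
Proof.
move=> SN Sc ng; apply: leq_trans (demand_bound c PZ SP) _.
rewrite big_split sum_nat_const leq_add2l /=.
have [c1 [c2 [n1 n2 -> split3]]] := other_two c.
have [x1 [le1 w1]] := other_class PZ n1 (ng c1).
have [x2 [le2 w2]] := other_class PZ n2 (ng c2).
have [x [y [le3 le4 w3]]] := same_class PZ (leqnSn N.+1) (ng c).
rewrite (setIidPr SP) in w1 w2 w3.
have S0 : S :\: class c = set0 by apply/eqP; rewrite setD_eq0.
rewrite S0 !set0D cards0 in w1 w2 w3.
rewrite (setIidPl Sc) in w1 w2.
move: w3; rewrite subSnn mul1n muln0 leqn0 addn_eq0 muln_eq0 /= => /andP[/eqP x0 /eqP y0].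
rewrite x0 y0 addn0 muln0 !leqn0 in le3 le4; rewrite (eqP le3) (eqP le4) !addn0.
have lex (u : nat) : N.+1 * u <= N.+2 * #|S| + N.+1 * 0 -> u <= #|S|.
  move=> h; rewrite leqNgt; apply/negP => lt.
  have := leq_trans (_ : N.+1 * #|S|.+1 <= N.+1 * u) h.
  by rewrite leq_mul2l lt => /(_ isT); rewrite !mulSn mulnS; lia.
have := lex _ w1; have := lex _ w2 => h2 h1.
apply: (@leq_trans (D.+1 * (x1 + x2))); first by rewrite mulnDr leq_add.
by rewrite mulnCA mulnC mulnA leq_mul2r; lia.
Qed.

End Bounds.

End Counting.

(** * Orientations and reversals *)

Section LevelStep.
Variables (T : finType) (G : sgraph T).
Implicit Types (A R P Z S U : {set T}) (u v w : T) (o W F : rel T).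

Definition out o v := #|[set u | o v u]|.
(** Edges to processed vertices are final, so this is the largest outdegree
    that [v] can still attain. *)
Definition ceiling o R v := #|[set u | G v u && ((u \in R) || o v u)]|.
(** Sums of truth values: one direction for an edge, none for a non-edge. *)
Definition orients o := forall u v, o u v + o v u = G u v :> nat.
Definition reorients o W := forall u v, W u v + W v u = o u v + o v u.
Definition flip o F : rel T := fun u v => F v u || o u v && ~~ F u v.

Lemma out_sum o v : out o v = \sum_u o v u.
Proof. by rewrite /out -sum1_card big_mkcond; apply: eq_bigr => u _; rewrite inE; case: (o v u). Qed.

Lemma reorients_sum o W U : reorients o W ->
  \sum_(u in U) \sum_(v in U) W u v = \sum_(u in U) \sum_(v in U) o u v.
Proof.
move=> h; apply/eqP; rewrite -(eqn_pmul2l (isT : 0 < 2)) !mul2n -!addnn.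
rewrite {2}exchange_big -big_split /= [X in _ == _ + X]exchange_big -big_split /=.
apply/eqP; apply: eq_bigr => u _; rewrite -!big_split /=.
by apply: eq_bigr => v _.
Qed.

Definition closed_in W U := forall u v, u \in U -> W u v -> v \in U.

(** As [U] is closed, the outdegrees of its vertices count edges inside [U],
    so an excess in [U] forces too many of them. *)
Lemma stuck_sum W U (cap : T -> nat) v :
  closed_in W U -> (forall u, u \in U -> cap u <= out W u) -> v \in U -> cap v < out W v ->
  \sum_(u in U) cap u < \sum_(u in U) \sum_(w in U) W u w.
Proof.
move=> clU capU vU ltv.
have outE u : u \in U -> out W u = \sum_(w in U) W u w.
  move=> uU; rewrite out_sum [RHS]big_mkcond; apply: eq_bigr => w _.
  by case: ifP => // wU; case: (boolP (W u w)) => // /(clU _ _ uU); rewrite wU.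
rewrite -(eq_bigr _ outE) (bigD1 v) //= [X in _ < X](bigD1 v) //= -addSn leq_add //.
by apply: leq_sum => u /andP[]; auto.
Qed.

(** Feasibility is a matter of density alone: one orientation within the
    capacities shows that path reversal cannot get stuck in another one. *)
Lemma settled_caps (E W W1 : rel T) U (cap : T -> nat) : reorients E W1 ->
  (forall v, out W1 v <= cap v) -> reorients E W -> closed_in W U ->
  (forall v, v \in U -> cap v <= out W v) -> (forall v, v \notin U -> out W v <= cap v) ->
  forall v, out W v <= cap v.
Proof.
move=> re1 out1 re clU capU slackU v; rewrite leqNgt; apply/negP => ltv.
have vU : v \in U by apply: contraLR ltv => /slackU; rewrite -leqNgt.
have := stuck_sum clU capU vU ltv.
rewrite (reorients_sum _ re) -(reorients_sum _ re1) ltnNge => /negP; apply.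
apply: leq_sum => u _; apply: leq_trans (out1 u); rewrite out_sum big_mkcond.
by apply: leq_sum => w _; case: ifP.
Qed.

Section Flip.
Variables (o F : rel T) (P : {set T}).
Hypotheses (oG : orients o) (Fo : forall u v, F u v -> o u v)
  (FP : forall u v, F u v -> (u \notin P) && (v \in P)).

Lemma orients_edge o' u v : orients o' -> o' u v -> G u v.
Proof. by move=> h ouv; have := h u v; rewrite ouv; case: (G u v). Qed.

Lemma orients_asym o' u v : orients o' -> o' u v -> ~~ o' v u.
Proof. by move=> h ouv; have := h u v; rewrite ouv; case: (G u v); case: (o' v u). Qed.

Lemma flip_orients : orients (flip o F).
Proof.
move=> u v; rewrite -(oG u v) /flip.
case: (boolP (F v u)) => [fvu|_]; case: (boolP (F u v)) => [fuv|_].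
- by have := orients_asym oG (Fo fvu); rewrite (Fo fuv).
- by rewrite (Fo fvu) (negPf (orients_asym oG (Fo fvu))).
- by rewrite (Fo fuv) (negPf (orients_asym oG (Fo fuv))).
by rewrite !andbT.
Qed.

Lemma flip_out_in v : v \in P -> out (flip o F) v = out o v + #|[set u | F u v]|.
Proof.
move=> vP; rewrite /out -cardsUI.
rewrite [X in _ + X](_ : _ = 0) ?addn0; last first.
  apply/eqP; rewrite cards_eq0; apply/eqP/setP=> u; rewrite !inE.
  by apply/negP=> /andP[ovu /Fo]; apply/negP; apply: orients_asym oG ovu.
apply: eq_card => u; rewrite !inE /flip orbC.
by case: (boolP (F v u)) => [/FP|]; rewrite ?vP // andbT.
Qed.

Lemma flip_out_sub v u : v \notin P -> flip o F v u -> o v u.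
Proof. by move=> nvP /orP[/FP|/andP[] //]; rewrite (negPf nvP) andbF. Qed.

End Flip.

Variables (o : rel T) (R Z P : {set T}) (y : nat).
Hypotheses (oG : orients o) (PZ : P \subset Z) (ZR : Z \subset R) (stP : stable G P).
Hypothesis outy : forall w, w \in Z -> out o w <= y.
Variable dem : T -> nat.
Hypothesis demP : forall v, v \in Z :\: P -> dem v <= nb G v P.

(** The edges whose reversal turns [w] into a guard of [v]. Only waiting
    vertices of [P], those with ceiling above the level, are free to choose
    which edges to turn. *)
Definition guard_edges : rel T :=
  fun v w => [&& v \in Z :\: P, w \in P, o v w & y < ceiling o R w].
(** Guards that come for free: a vertex of [P] whose ceiling is the level
    itself has to direct all its edges outwards. *)
Definition settled v := #|[set w in P | G v w && ((ceiling o R w <= y) || o w v)]|.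
(** A vertex of [P] has room for what its outdegree lacks to level [y]. A
    left-out vertex has to give up enough edges to meet its demand. *)
Definition guard_cap v :=
  if v \in P then y - out o v else out guard_edges v - (dem v - settled v).

Lemma settled_out v : v \in Z :\: P -> nb G v P = settled v + out guard_edges v.
Proof.
move=> vZ; rewrite /nb /settled /out -cardsUI [X in _ = _ + X](_ : _ = 0) ?addn0.
  apply: eq_card => w; rewrite !inE /guard_edges vZ; case: (w \in P) => //=.
  have := oG v w; case: (G v w); rewrite leqNgt; case: (y < _); case: (o v w); case: (o w v) => //.
apply/eqP; rewrite cards_eq0; apply/eqP/setP=> w; rewrite !inE /guard_edges.
apply/negP => /andP[/and3P[_ _ /orP[le|owv]] /and4P[_ _ ovw lt]].
  by rewrite ltnNge le in lt.
by move: (orients_asym oG ovw); rewrite owv.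
Qed.

(** If the reversal is stuck, the vertices without access to spare capacity
    form a closed set [U]; counting its edges shows that the waiting
    vertices in [U] have less room than is demanded from them. *)
Lemma guard_success W U : reorients guard_edges W -> closed_in W U ->
  (forall v, v \in U -> guard_cap v <= out W v) ->
  (forall v, v \notin U -> out W v <= guard_cap v) ->
  (let S := [set w in P | (w \in U) && (y < ceiling o R w)] in
   \sum_(v in Z :\: P) (dem v - nb G v (P :\: S)) <= \sum_(w in S) (y - out o w)) ->
  forall v, out W v <= guard_cap v.
Proof.
move=> reW clU capU slackU; set S := [set w in P | _]; move=> /= short v.
rewrite leqNgt; apply/negP => ltv.
have vU : v \in U by apply: contraLR ltv => /slackU; rewrite -leqNgt.
have := stuck_sum clU capU vU ltv; rewrite (reorients_sum _ reW); apply/negP; rewrite -leqNgt.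
have SP : S \subset P by apply/subsetP=> w; rewrite inE => /andP[].
pose js v := #|[set w in S | guard_edges v w]|.
have -> : \sum_(u in U) \sum_(w in U) guard_edges u w = \sum_(u in U :&: (Z :\: P)) js u.
  rewrite (bigID (mem (Z :\: P))) /= [X in _ + X]big1 ?addn0 => [|u /andP[_ nu]]; last first.
    by apply: big1 => w _; rewrite /guard_edges (negPf nu).
  rewrite (eq_bigl (fun u => u \in U :&: (Z :\: P))) => [|u]; last by rewrite !inE.
  apply: eq_bigr => u _; rewrite /js -sum1_card big_mkcond [RHS]big_mkcond.
  apply: eq_bigr => w _; rewrite !inE /guard_edges.
  by case: (w \in U); case: (w \in P); case: (y < _); case: (o u w); rewrite ?andbF ?andbT //=; case: ifP.
(* Of its edges into [P], [u] gives up its demand. If more of them lead into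
   [S] than the capacity of [u], the demand exceeds what [P :\: S] can
   serve, by at least the difference. *)
have jsE u : u \in Z :\: P ->
    js u <= (out guard_edges u - (dem u - settled u)) + (dem u - nb G u (P :\: S)).
  move=> uZ.
  have h1 : out guard_edges u = js u + #|[set w in P :\: S | guard_edges u w]|.
    rewrite /out -(cardsID S); congr (_ + _); apply: eq_card => w; rewrite !inE.
      by rewrite andbC.
    by rewrite /guard_edges; case: (w \in P); rewrite ?andbF ?andbT.
  have h2 : nb G u (P :\: S) <= settled u + #|[set w in P :\: S | guard_edges u w]|.
    apply: leq_trans (leq_card_setU _ _); apply: subset_leq_card.
    apply/subsetP=> w; rewrite !inE /guard_edges => /andP[/andP[nwS wP] guw].
    rewrite nwS wP guw uZ /=; have := oG u w; rewrite guw leqNgt.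
    by case: (y < _); case: (o u w); case: (o w u).
  have h3 := settled_out uZ; have h4 := demP uZ.
  by move: h1 h2 h3 h4; clear; lia.
apply: (@leq_trans (\sum_(u in U :&: (Z :\: P))
  ((out guard_edges u - (dem u - settled u)) + (dem u - nb G u (P :\: S))))).
  by apply: leq_sum => u uI; apply: jsE; move: uI; rewrite in_setI => /andP[].
rewrite big_split /=.
have h : \sum_(u in U :&: (Z :\: P)) (dem u - nb G u (P :\: S)) <=
         \sum_(w in S) (y - out o w).
  apply: leq_trans short; rewrite [X in _ <= X](bigID (mem U)) /=.
  rewrite (eq_bigl (fun u => (u \in Z :\: P) && (u \in U))) ?leq_addr // => u.
  by rewrite in_setI andbC.
apply: leq_trans (leq_add (leqnn _) h) _.
rewrite [X in _ <= X](bigID (mem P)) /= addnC; apply: leq_add.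
  rewrite [X in _ <= X](bigID (mem S)) /=; apply: leq_trans (leq_addr _ _).
  rewrite [X in _ <= X](eq_bigl (mem S)) => [|w]; last first.
    by rewrite !inE; case: (w \in U); case: (w \in P); rewrite ?andbF.
  by apply: leq_sum => w wS; rewrite /guard_cap (subsetP SP _ wS).
rewrite [X in _ <= X](bigID (mem Z)) /=; apply: leq_trans (leq_addr _ _).
rewrite [X in _ <= X](eq_bigl (fun u => u \in U :&: (Z :\: P))) => [|w]; last first.
  by rewrite !inE andbA.
by apply: leq_sum => w; rewrite !inE /guard_cap => /and3P[_ /negPf-> _].
Qed.

Section Pull.
Variables (W : rel T) (idx : T -> nat).
Hypotheses (reW : reorients guard_edges W) (capW : forall v, out W v <= guard_cap v).
Hypothesis idx_inj : injective idx.
Hypothesis ceilingZ : forall w, w \in Z -> y <= ceiling o R w.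

Definition guards : rel T := fun u v => W v u && o u v.
Let o1 := flip o guards.
Definition pullable w := [set v in R :\: P | o1 v w].
(** After the guards are placed, the vertices of [P] fill up to level [y],
    taking the first available edges in the order [idx]. The choices do not
    interfere because [P] is stable. *)
Definition pulls : rel T := fun v w =>
  [&& w \in P, v \in pullable w
    & #|[set u in pullable w | idx u < idx v]| < y - out o1 w].
Let o2 := flip o1 pulls.

(** Induction on [A], removing the element of highest rank. *)
Lemma card_prefix (A : {set T}) m :
  #|[set v in A | #|[set u in A | idx u < idx v]| < m]| = minn m #|A|.
Proof.
have [n leAn] := ubnP #|A|; elim: n A leAn => // n IHn A leAn.
have [->|[v0 v0A]] := set_0Vmem A.
  rewrite cards0 minn0; apply/eqP; rewrite cards_eq0; apply/eqP/setP=> v.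
  by rewrite !inE.
case: (@arg_maxnP _ v0 (fun x => x \in A) idx v0A) => v vA max_v.
have {}max_v u : u \in A -> idx u <= idx v by move=> uA; apply: max_v.
have cA : #|A| = #|A :\ v|.+1 by rewrite (cardsD1 v) vA.
have rank_v : #|[set u in A | idx u < idx v]| = #|A :\ v|.
  apply: eq_card => u; rewrite !inE; case uA: (u \in A); rewrite ?andbF ?andbT //=.
  by rewrite ltn_neqAle (max_v u uA) andbT (inj_eq idx_inj).
have rank_u u : u \in A -> u != v ->
    #|[set x in A | idx x < idx u]| = #|[set x in A :\ v | idx x < idx u]|.
  move=> uA uv; apply: eq_card => x; rewrite !inE.
  by case: eqP => //= ->; rewrite ltnNge (max_v u uA) andbF.
have := IHn (A :\ v); rewrite -ltnS -cA => /(_ leAn) IH.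
rewrite (cardsD1 v) inE vA rank_v /=.
have -> : #|[set x in A | #|[set u in A | idx u < idx x]| < m] :\ v| =
          #|[set x in A :\ v | #|[set u in A :\ v | idx u < idx x]| < m]|.
  apply: eq_card => x; rewrite !inE; case: eqP => //= /eqP xv.
  by case xA: (x \in A) => //=; rewrite rank_u.
rewrite IH cA; lia.
Qed.

Lemma guards_edge v w : guards v w -> [/\ v \in Z :\: P, w \in P, o v w,
  y < ceiling o R w & W w v].
Proof.
move=> /andP[Wwv ovw]; have := reW v w; rewrite Wwv.
have : guard_edges w v = false.
  by apply/negP=> /and4P[_ _ owv _]; move: (orients_asym oG ovw); rewrite owv.
move=> ->; case: (boolP (guard_edges v w)) => [/and4P[]|_] //.
by case: (W v w).
Qed.

Lemma W_guards w v : w \in P -> W w v = guards v w.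
Proof.
move=> wP; rewrite /guards; case: (boolP (W w v)) => //= Wwv.
have := reW v w; rewrite Wwv; case: (boolP (guard_edges v w)) => [/and4P[_ _ ->] //|_].
by rewrite /guard_edges inE wP /=; case: (W v w).
Qed.

Lemma guardsP u v : guards u v -> (u \notin P) && (v \in P).
Proof. by case/guards_edge; rewrite inE => /andP[-> _] ->. Qed.

Lemma guards_o u v : guards u v -> o u v. Proof. by case/guards_edge. Qed.

Lemma o1G : orients o1. Proof. exact: flip_orients oG guards_o. Qed.

Lemma out1 w : w \in P -> out o1 w <= y.
Proof.
move=> wP; rewrite (flip_out_in oG guards_o guardsP wP).
have -> : #|[set u | guards u w]| = out W w.
  by apply: eq_card => u; rewrite !inE W_guards.
have := capW w; rewrite /guard_cap wP; have := outy (subsetP PZ _ wP); lia.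
Qed.

(** The reversals so far have not changed the ceiling of [w]. *)
Lemma ceiling_split w : w \in P -> ceiling o R w = out o1 w + #|pullable w|.
Proof.
move=> wP; rewrite /ceiling /out -cardsUI [X in _ = _ + X](_ : _ = 0) ?addn0; last first.
  apply/eqP; rewrite cards_eq0; apply/eqP/setP=> u; rewrite !inE.
  by apply/negP=> /and3P[ou _]; apply/negP; apply: orients_asym o1G ou.
apply: eq_card => u; rewrite [LHS]inE [RHS]in_setU [X in _ = X || _]inE [X in _ = _ || X]inE in_setD.
have wR : w \in R by apply: (subsetP ZR); apply: (subsetP PZ).
case: (boolP (u \in P)) => [uP|nuP] /=.
  rewrite orbF (negPf (stP wP uP)) /=; apply/esym/negP => /(orients_edge o1G).
  exact/negP/stP.
have tot := o1G w u; move: (oG w u) tot; rewrite /o1 /flip.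
case: (boolP (guards u w)) => [/guards_edge[]|ng].
  by rewrite inE => /andP[_ /(subsetP ZR) ->] _ ouw _ _; case: (G w u); case: (o w u); rewrite ?ouw.
have -> : guards w u = false by apply/negP=> /guardsP; rewrite wP.
rewrite !andbT /=; case: (G w u); case: (o w u); case: (o u w); case: (u \in R) => //.
Qed.

Lemma pulls_edge v w : pulls v w -> [/\ v \in R, v \notin P, w \in P & o1 v w].
Proof. by rewrite /pulls !inE => /and3P[wP /andP[/andP[-> ->] ->]]. Qed.

Lemma pullsP u v : pulls u v -> (u \notin P) && (v \in P).
Proof. by case/pulls_edge => _ -> ->. Qed.

Lemma pulls_o u v : pulls u v -> o1 u v. Proof. by case/pulls_edge. Qed.

Lemma pull_orients : orients o2. Proof. exact: flip_orients o1G pulls_o. Qed.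

Lemma pull_out w : w \in P -> out o2 w = y.
Proof.
move=> wP; rewrite (flip_out_in o1G pulls_o pullsP wP).
have -> : #|[set u | pulls u w]| = minn (y - out o1 w) #|pullable w|.
  rewrite -card_prefix; apply: eq_card => u; rewrite [LHS]inE [RHS]inE /pulls wP.
  by [].
have := ceilingZ (subsetP PZ _ wP); rewrite (ceiling_split wP); have := out1 wP; lia.
Qed.

Lemma pull_sub v u : v \notin P -> o2 v u -> o v u.
Proof.
move=> nvP h; exact: (flip_out_sub guardsP nvP (flip_out_sub pullsP nvP h)).
Qed.

Lemma pull_processed v u : v \notin R -> o2 v u = o v u.
Proof.
move=> nvR; have nvZ : v \notin Z by apply: contra nvR; apply: (subsetP ZR).
have nvP : v \notin P by apply: contra nvZ; apply: (subsetP PZ).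
have g1 a : guards v a = false.
  by apply/negP => /guards_edge[]; rewrite inE (negPf nvZ) andbF.
have g2 a : guards a v = false by apply/negP => /guardsP; rewrite (negPf nvP) andbF.
have p1 a : pulls v a = false by apply/negP => /pulls_edge[]; rewrite (negPf nvR).
have p2 a : pulls a v = false by apply/negP => /pullsP; rewrite (negPf nvP) andbF.
by rewrite /o2 /flip p1 p2 /o1 /flip g1 g2 !andbT.
Qed.

(** A vertex of [P] with ceiling [y] pulls every edge it can, so it guards
    all its left-out neighbours, as [settled] promised. *)
Lemma pull_demand v : v \in Z :\: P ->
  dem v <= #|[set w in P | G v w && ~~ o2 v w]|.
Proof.
move=> vZ; have [nvP vZ'] : v \notin P /\ v \in Z by move: vZ; rewrite inE => /andP[].
apply: (@leq_trans (settled v + #|[set w | guards v w]|)).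
  have degE : out guard_edges v = out W v + #|[set w | guards v w]|.
    rewrite /out -cardsUI [X in _ = _ + X](_ : _ = 0) ?addn0.
      apply: eq_card => w; rewrite !inE.
      have := reW v w; have -> : guard_edges w v = false.
        by rewrite /guard_edges (negPf nvP) andbF.
      case: (boolP (guard_edges v w)) => [/and4P[_ wP ovw _]|ng].
        by rewrite (_ : guards v w = W w v) /guards ?ovw ?andbT //; case: (W v w); case: (W w v).
      rewrite (_ : guards v w = false) ?orbF; first by case: (W v w); case: (W w v).
      apply/negP => /guards_edge[h1 h2 h3 h4 _]; move/negP: ng; apply.
      by rewrite /guard_edges h1 h2 h3.
    apply/eqP; rewrite cards_eq0; apply/eqP/setP=> w; rewrite !inE.
    apply/negP=> /andP[Wvw g]; have [h1 h2 h3 h4 Wwv] := guards_edge g.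
    have := reW v w; rewrite Wvw Wwv; have -> : guard_edges w v = false.
      by rewrite /guard_edges (negPf nvP) andbF.
    by case: (guard_edges v w).
  have := capW v; rewrite /guard_cap (negPf nvP).
  have := settled_out vZ; have := demP vZ; lia.
rewrite /settled -cardsUI [X in _ + X <= _](_ : _ = 0) ?addn0; last first.
  apply/eqP; rewrite cards_eq0; apply/eqP/setP=> w; rewrite !inE.
  apply/negP=> /andP[/and3P[_ _ /orP[le|owv]] /guards_edge[_ _ ovw lt _]].
    by rewrite ltnNge le in lt.
  by move: (orients_asym oG ovw); rewrite owv.
apply: subset_leq_card; apply/subsetP=> w; rewrite !inE => /orP[/and3P[wP gvw]|g].
  rewrite wP gvw /= => /orP[le|owv]; last first.
    by apply/negP => /(pull_sub nvP) /(orients_asym oG); rewrite owv.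
  have npv : pulls w v = false by apply/negP => /pullsP; rewrite wP.
  rewrite /o2 /flip npv /= negb_and negbK; case: (boolP (o1 v w)) => //= o1vw.
  rewrite /pulls wP.
  have vp : v \in pullable w by rewrite !inE nvP o1vw andbT (subsetP ZR).
  rewrite vp /=; apply: leq_trans (_ : #|pullable w| <= _).
    apply: proper_card; apply/properP; split.
      by apply/subsetP=> u; rewrite in_set => /andP[].
    by exists v; rewrite // in_set ltnn andbF.
  by move: le; rewrite (ceiling_split wP); lia.
have [h1 wP ovw lt Wwv] := guards_edge g.
rewrite wP (orients_edge oG ovw) /=; apply/negP => /(flip_out_sub pullsP nvP).
rewrite /o1 /flip g andbF orbF => /guardsP.
by rewrite wP.
Qed.

End Pull.

End LevelStep.

(** * The schedule of levels *)

Section Phases.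
Variables k D : nat.
Let p := D.+1.

(** [Y] counts the levels that remain, so that the next one is [Y - 1]. Its
    phase depends on which of [k + 7p], [k + 6p], [k + 4p] and [k + 2p + 1]
    are at most [Y]. *)
Definition restricted Y := k + 6 * p <= Y.
Definition mixed Y := (k + 4 * p <= Y) && (Y < k + 6 * p).
Definition depth Y := k + 9 * p - 1 - Y.
Definition lead Y : nat :=
  if k + 7 * p <= Y then (if odd (depth Y) then 1 else 2)
  else if k + 6 * p <= Y then 0
  else if k + 4 * p <= Y then 2 else 1.

(** The invariant of an unprocessed vertex of class [c] with ceiling [m] and
    [i] unprocessed neighbours in its own class, before level [Y - 1]. While
    its class leads a level restricted to it, the vertex loses such a
    neighbour each time, until none can be left; the alternative is a bound
    on [m + i - Y], which one level later is smaller if the class leads, and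
    larger by at most one in any case. In the unrestricted phases it does
    not grow any more, and for the leading class it shrinks to nothing. *)
Definition on_track Y (c : nat) m i : bool :=
  if k + 7 * p <= Y then
    match c with
    | 0 => true
    | 1 => (m + i + 2 <= Y + p + odd (depth Y)) || (i + half (depth Y) <= D)
    | _ => (m + i + 1 + odd (depth Y) <= Y + p) || (i + uphalf (depth Y) <= D)
    end
  else if k + 6 * p <= Y then
    let t := k + 7 * p - 1 - Y in
    match c with
    | 0 => (m < Y) || (i + t <= D)
    | 1 => m + i + 2 <= Y + p + t
    | _ => m + i + 1 <= Y + p + t
    end
  else if k + 4 * p <= Y then
    let t := k + 6 * p - 1 - Y in
    match c with
    | 0 => m < Y
    | 1 => m + i + 2 <= Y + 2 * p
    | _ => (m < Y) || (m + i + 1 + t <= Y + 2 * p)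
    end
  else if k + 2 * p < Y then
    let t := k + 4 * p - 1 - Y in
    match c with
    | 1 => (m < Y) || (m + i + 2 + t <= Y + 2 * p)
    | _ => m < Y
    end
  else m < Y.

Lemma on_track_start c m i : i <= D -> on_track (k + 9 * p - 1) c m i.
Proof.
move=> iD; rewrite /on_track /depth subnn ifT; last by rewrite /p; lia.
by case: c => [|[|c]] //=; lia.
Qed.

(** A vertex whose ceiling is below level [Y] is out of danger whatever
    happens, which leaves the eligible vertices and those that a restricted
    level does not admit. *)
Lemma on_track_step Y c m i m' i' : c < 3 -> Y < k + 9 * p - 1 ->
  on_track Y.+1 c m i -> i <= D -> m' <= m -> i' <= i ->
  (((restricted Y.+1 ==> (c == lead Y.+1)) && (Y <= m)) ->
     m' < m /\ (c = lead Y.+1 -> i' < i \/ (~~ restricted Y.+1 /\ m' + 2 <= m))) ->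
  on_track Y c m' i'.
Proof.
move=> c3 Yt ok iD mm ii step.
have p0 : 0 < p by [].
have dS : depth Y = (depth Y.+1).+1 by rewrite /depth; lia.
have pD : p = D.+1 by [].
move: ok step; rewrite /on_track /restricted /lead dS; move: dS; rewrite /depth.
(* All remaining conditions are linear in [d], its half and its parity. *)
move: (k + 9 * p - 1 - Y.+1) => d dS.
have d7 : (k + 7 * p <= Y.+1) = (d < 2 * p) by lia.
rewrite d7.
case: (leqP (k + 7 * p) Y) => h7; case: (ltnP d (2 * p)) => h7';
case: (leqP (k + 6 * p) Y) => h6; case: (leqP (k + 6 * p) Y.+1) => h6';
case: (leqP (k + 4 * p) Y) => h4; case: (leqP (k + 4 * p) Y.+1) => h4';
case: (ltnP (k + 2 * p) Y) => h2; case: (ltnP (k + 2 * p) Y.+1) => h2';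
try lia;
case: c c3 => [|[|[|c]]] // _; case: (boolP (odd d)) => od /= ok step; lia.
Qed.

(** The lengths of the phases are made for this: the outdegree is at most
    [k], so a waiting vertex has at least the room that [shortage_mixed] or
    [shortage_lex] requires. *)
Lemma on_track_room Y c m i d : c < 3 -> Y < k + 9 * p - 1 ->
  on_track Y.+1 c m i -> i <= D -> d <= k -> Y < m ->
  (restricted Y.+1 -> c = lead Y.+1) ->
  if mixed Y.+1 then (i + 3 * p <= Y - d : Prop)
  else c = lead Y.+1 /\ i + 2 * p <= Y - d.
Proof.
move=> c3 Yt ok iD dk lt.
have p0 : 0 < p by [].
have pD : p = D.+1 by [].
move: ok; rewrite /on_track /restricted /lead /mixed; move: (depth Y.+1) => e.
case: (leqP (k + 7 * p) Y.+1) => h7; case: (leqP (k + 6 * p) Y.+1) => h6;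
case: (leqP (k + 4 * p) Y.+1) => h4; case: (ltnP (k + 2 * p) Y.+1) => h2;
  rewrite /=; try lia; move=> ok cl.
by case: c c3 ok {cl} => [|[|[|c]]] // _; lia.
Qed.

Lemma on_track_low Y c m i d : on_track Y.+1 c m i -> d <= k -> d <= m -> d <= Y.
Proof.
have p0 : 0 < p by [].
rewrite /on_track; case: ifP => h7; first by lia.
case: ifP => h6; first by lia.
case: ifP => h4; first by lia.
by case: ifP => h2; lia.
Qed.

(** All alternatives would need a ceiling below 0. *)
Lemma on_track_end c m i : ~~ on_track 0 c m i.
Proof.
have p0 : 0 < p by [].
rewrite /on_track !ifF //; lia.
Qed.

End Phases.

Section Game.
Variables (T : finType) (G : sgraph T) (cl : T -> 'I_3) (k D : nat).
Implicit Types (R P Z S U : {set T}) (o W : rel T).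
Let p := D.+1.
Hypothesis small : forall v, nb G v (own cl v) <= D.

Definition rivals R v := nb G v (R :&: own cl v).

(** The position before level [Y - 1], where [R] is the set of unprocessed
    vertices. *)
Record game Y o R : Prop := Game {
  game_orients : orients G o;
  game_low : forall v, v \in R -> out o v <= k;
  game_high : forall v, v \notin R -> Y <= out o v <= k + 9 * p - 2;
  game_proper : forall u v, u \notin R -> v \notin R -> G u v -> out o u != out o v;
  game_track : forall v, v \in R -> on_track k D Y (cl v) (ceiling G o R v) (rivals R v)
}.

Lemma rivals_small R v : rivals R v <= D.
Proof. by apply: leq_trans (small v); apply: nbS; apply: subsetIr. Qed.

Lemma game_ext Y o o' R : o =2 o' -> game Y o R -> game Y o' R.
Proof.
move=> e [oG low high proper track].
have outE v : out o' v = out o v by apply: eq_card => u; rewrite !inE e.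
split=> [u v|v|v|u v|v vR]; rewrite -?e ?outE //; [exact: low|exact: high|exact: proper|].
have -> : ceiling G o' R v = ceiling G o R v by apply: eq_card => u; rewrite !inE e.
exact: track.
Qed.

Lemma game_start o : orients G o -> (forall v, out o v <= k) ->
  game (k + 9 * p - 1) o [set: T].
Proof.
move=> oG outk; split=> // [v|u v|v _]; rewrite ?inE //.
exact/on_track_start/rivals_small.
Qed.

Lemma game_over o R : game 0 o R ->
  [/\ orients G o, forall v, out o v <= k + 9 * p - 2
    & forall u v, G u v -> out o u != out o v].
Proof.
move=> [oG _ high proper track].
have R0 v : v \notin R by apply/negP => /track; apply/negP/on_track_end.
split=> // [v|u v guv]; first by case/andP: (high v (R0 v)).
exact: proper.
Qed.

Variables (Y : nat) (o : rel T) (R : {set T}).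
Hypotheses (Yt : Y < k + 9 * p - 1) (gYR : game Y.+1 o R).
Variable c : 'I_3.
Hypothesis cE : c = lead k D Y.+1 :> nat.
Let Z := [set v in R | (restricted k D Y.+1 ==> (cl v == c)) && (Y <= ceiling G o R v)].
Variable P : {set T}.
Hypotheses (PZ : P \subset Z) (stP : stable G P).
Let dem := demand G cl P c.
Let cap := guard_cap G o R Z P Y dem.

Lemma level_low w : w \in Z -> out o w <= Y.
Proof.
rewrite inE => /andP[wR _].
apply: on_track_low (game_track gYR wR) (game_low gYR wR) _.
apply: subset_leq_card; apply/subsetP=> u; rewrite !inE => owu.
by rewrite (orients_edge (game_orients gYR) owu) owu orbT.
Qed.

Section Gain.
Variables (a b : nat).
Hypothesis abE : (a, b) = if mixed k D Y.+1 then (3, 2) else (#|T|.+2, #|T|.+1).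

Lemma level_shortage S : S \subset [set w in P | Y < ceiling G o R w] ->
  (forall cc, no_gain G cl Z P c a b S cc) ->
  \sum_(v in Z :\: P) (dem v - nb G v (P :\: S)) <= \sum_(w in S) (Y - out o w).
Proof.
move=> SP' gS; have SP : S \subset P.
  by apply: subset_trans SP' _; apply/subsetP=> w; rewrite inE => /andP[].
have room w : w \in S -> if mixed k D Y.+1 then (rivals R w + 3 * p <= Y - out o w : Prop)
    else cl w = c /\ rivals R w + 2 * p <= Y - out o w.
  move=> wS; have := subsetP SP' w wS; rewrite inE => /andP[wP wait].
  have := subsetP PZ w wP; rewrite inE => /andP[wR /andP[res _]].
  have := @on_track_room k D Y (cl w) (ceiling G o R w) (rivals R w) (out o w).
  rewrite ltn_ord => /(_ isT Yt (game_track gYR wR) (rivals_small _ _) (game_low gYR wR) wait).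
  case: ifP => _ H.
    by apply: H => rr; rewrite -cE; move: res; rewrite rr => /eqP->.
  have [] := H; first by move=> rr; rewrite -cE; move: res; rewrite rr => /eqP->.
  by rewrite -cE => /val_inj.
have le_rivals w : nb G w (Z :&: own cl w) <= rivals R w.
  by apply: nbS; apply: setSI; apply/subsetP=> v; rewrite inE => /andP[].
move: room gS abE; case: ifP => _ room gS [ea eb]; subst a b.
  apply: leq_trans (shortage_mixed small PZ SP gS) _.
  apply: leq_sum => w /room; have := le_rivals w; rewrite /p; lia.
(* Outside the mixed phase only vertices of the leading class have to wait. *)
have Sc : S \subset class cl c.
  by apply/subsetP=> w /room[e _]; rewrite inE e.
apply: leq_trans (shortage_lex small PZ SP (max_card _) Sc gS) _.
by apply: leq_sum => w /room[_]; have := le_rivals w; rewrite /p; lia.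
Qed.

Lemma level_demand : (forall cc, no_gain G cl Z P c a b set0 cc) ->
  forall v, v \in Z :\: P -> dem v <= nb G v P.
Proof.
move=> gain0 v vZ; have := level_shortage (sub0set _) gain0.
rewrite big_set0 leqn0 sum_nat_eq0 => /forallP/(_ v)/implyP/(_ vZ).
by rewrite setD0 subn_eq0.
Qed.

Lemma level_caps (W : rel T) (U : {set T}) :
  (forall v, v \in Z :\: P -> dem v <= nb G v P) ->
  reorients (guard_edges G o R Z P Y) W -> closed_in W U ->
  (forall v, v \in U -> cap v <= out W v) -> (forall v, v \notin U -> out W v <= cap v) ->
  (let S := [set w in P | (w \in U) && (Y < ceiling G o R w)] in
   forall cc, no_gain G cl Z P c a b S cc) -> forall v, out W v <= cap v.
Proof.
move=> demP reW clU capU slackU gS.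
apply: (guard_success (game_orients gYR) demP reW clU capU slackU).
apply: level_shortage gS; apply/subsetP=> w; rewrite !inE.
by case/and3P=> -> _ ->.
Qed.

End Gain.

Variables (W : rel T) (idx : T -> nat).
Hypothesis idx_inj : injective idx.
Hypothesis demP : forall v, v \in Z :\: P -> dem v <= nb G v P.
Hypothesis reW : reorients (guard_edges G o R Z P Y) W.
Hypothesis capW : forall v, out W v <= cap v.

Let o1 := flip o (guards o W).
Let o2 := flip o1 (pulls o R P Y W idx).

(** The guards lower the ceiling of a left-out vertex [v]. If [v] is of the
    leading class, it is blocked and loses a rival, or it has two guards; in
    a restricted level it must be blocked, since its guards are of its
    class. *)
Lemma level_step : game Y o2 (R :\: P).
Proof.
have oG := game_orients gYR.
have ZR : Z \subset R by apply/subsetP=> v; rewrite inE => /andP[].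
have rZ w : w \in Z -> Y <= ceiling G o R w by rewrite inE => /and3P[].
have oo2 : orients G o2 := pull_orients oG idx reW.
have outP w : w \in P -> out o2 w = Y.
  exact: (pull_out oG PZ ZR stP level_low reW capW idx_inj rZ).
have sub v u : v \notin P -> o2 v u -> o v u .
  exact: (pull_sub oG reW).
have proc v u : v \notin R -> o2 v u = o v u .
  exact: (pull_processed oG PZ ZR idx reW).
have dem2 v : v \in Z :\: P -> dem v <= #|[set w in P | G v w && ~~ o2 v w]|.
  exact: (pull_demand oG PZ ZR stP demP idx reW capW).
have outsub v : v \notin P -> out o2 v <= out o v.
  by move=> nvP; apply: subset_leq_card; apply/subsetP=> u; rewrite !inE; apply: sub.
have outproc v : v \notin R -> out o2 v = out o v.
  by move=> nvR; apply: eq_card => u; rewrite !inE proc.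
have pk : 0 < p by [].
split=> //.
- by move=> v; rewrite inE => /andP[nvP vR]; apply: leq_trans (outsub v nvP) (game_low gYR vR).
- move=> v; rewrite inE negb_and negbK.
  case: (boolP (v \in P)) => [vP _|nvP /= nvR]; first by rewrite outP //; move: Yt; lia.
  by rewrite outproc //; have /andP[/ltnW-> ->] := game_high gYR nvR.
- move=> u v; rewrite !inE !negb_and !negbK.
  case: (boolP (u \in P)) => [uP _|nuP /= nuR]; case: (boolP (v \in P)) => [vP _|nvP /= nvR] guv.
  + by move: (stP uP vP); rewrite guv.
  + by rewrite outP // outproc //; have /andP[] := game_high gYR nvR; lia.
  + by rewrite outproc // outP //; have /andP[] := game_high gYR nuR; lia.
  + by rewrite !outproc //; apply: (game_proper gYR).
move=> v; rewrite inE => /andP[nvP vR].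
have rivals_le : rivals (R :\: P) v <= rivals R v.
  by apply: nbS; apply: setSI; apply: subsetDl.
(* An edge from [P] to [v] is lost for the ceiling, as [P] is processed now. *)
have ceiling_le : ceiling G o2 (R :\: P) v + #|[set w in P | G v w && ~~ o2 v w]| <= ceiling G o R v.
  rewrite /ceiling -cardsUI [X in _ + X <= _](_ : _ = 0) ?addn0; last first.
    apply/eqP; rewrite cards_eq0; apply/eqP/setP=> u; rewrite !inE.
    by case: (u \in P); case: (o2 v u); rewrite ?andbF //= ?andbF.
  apply: subset_leq_card; apply/subsetP=> u; rewrite !inE.
  case/orP=> [/andP[->] /orP[/andP[_ ->] //|/(sub _ _ nvP) ->]|/and3P[uP -> _]].
    by rewrite orbT.
  by rewrite (subsetP ZR) // (subsetP PZ).
apply: (on_track_step (ltn_ord _) Yt (game_track gYR vR)) => //.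
- exact: rivals_small.
- by apply: leq_trans ceiling_le; apply: leq_addr.
rewrite -cE => /andP[res le_Y].
have vZ : v \in Z by rewrite inE vR le_Y andbT.
have vZP : v \in Z :\: P by rewrite inE nvP.
have dv := dem2 v vZP.
have dem1 : 0 < dem v by rewrite /dem /demand; case: ifP.
split; first by lia.
move=> /val_inj clv; case: (boolP (blocked G cl P v)) => [bl|nbl].
  left; have /exists_inP[w wP /andP[gvw /eqP clw]] := bl.
  apply: proper_card; apply/properP; split.
    by apply/subsetP=> u; rewrite !inE => /andP[/andP[/andP[_ ->] ->] ->].
  exists w; first by rewrite !inE gvw clw eqxx (subsetP ZR) // (subsetP PZ).
  by rewrite !inE wP.
right; split.
  apply/negP => rr; have : 0 < nb G v P by apply: leq_trans dem1 (demP vZP).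
  case/nb_gt0 => w wP gvw; move/negP: nbl; apply; apply/exists_inP; exists w => //.
  rewrite gvw /=; have := subsetP PZ w wP; rewrite inE rr => /andP[_ /andP[/eqP-> _]].
  by rewrite clv.
have : dem v = 2 by rewrite /dem /demand clv eqxx nbl.
by lia.
Qed.

End Game.

(** * Density *)

Section Density.
Variables (T : finType) (G : sgraph T) (k : nat).
Import Order.TTheory GRing.Theory Num.Theory.
Hypothesis madG : (mad G <= (2 * k)%:R)%R.

(** The edges inside [U] form a subgraph with vertex set [U]. *)
Lemma density_bound (o W : rel T) (U : {set T}) : orients G o -> reorients o W ->
  \sum_(u in U) \sum_(v in U) W u v <= k * #|U|.
Proof.
move=> oG reW.
have WG u v : W u v + W v u = G u v by rewrite reW.
have [->|U0] := eqVneq U set0; first by rewrite big_set0.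
pose A := [set e : T * T | [&& e.1 \in U, e.2 \in U & W e.1 e.2]].
pose H := (U, [set [set e.1; e.2] | e in A]).
have WinG u v : W u v -> G u v.
  by move=> wuv; have := WG u v; rewrite wuv; case: (G u v).
have subH : is_subgraph G H.
  apply/andP; split.
    apply/subsetP=> e /imsetP[[u v]]; rewrite inE /= => /and3P[_ _ wuv] ->.
    by apply/imsetP; exists (u, v); rewrite ?inE //= WinG.
  apply/subsetP=> x /bigcupP[e /imsetP[[u v]]]; rewrite inE /= => /and3P[uU vU _] ->.
  by rewrite !inE => /orP[]/eqP->.
have cardH : #|H.2| = #|A|.
  apply: card_in_imset => -[u v] [u' v']; rewrite !inE /=.
  case/and3P=> _ _ wuv /and3P[_ _ wuv'] e.
  have irr x : W x x = false by have := WG x x; rewrite edge_irr; case: (W x x).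
  have uv : u != v by apply: contraTneq wuv => ->; rewrite irr.
  have uv' : u' != v' by apply: contraTneq wuv' => ->; rewrite irr.
  have : u \in [set u'; v'] by rewrite -e !inE eqxx.
  have : v \in [set u'; v'] by rewrite -e !inE eqxx orbT.
  rewrite !inE => /orP[]/eqP ev /orP[]/eqP eu; subst u v => //; first by rewrite eqxx in uv.
    by have := WG u' v'; rewrite wuv wuv'; case: (G u' v').
  by rewrite eqxx in uv.
have cardA : #|A| = \sum_(u in U) \sum_(v in U) W u v.
  rewrite pair_big -sum1_card big_mkcond [RHS]big_mkcond; apply: eq_bigr => -[u v] _.
  rewrite inE /=; by case: (u \in U); case: (v \in U); case: (W u v).
have le_mad : ((2 * #|H.2|)%:R / #|H.1|%:R <= mad G)%R.
  by apply: (bigmax_sup H) => //; rewrite subH.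
have := le_trans le_mad madG.
rewrite ler_pdivrMr ?ltr0n ?card_gt0 // -natrM ler_nat cardH cardA /=.
by rewrite -mulnA leq_pmul2l.
Qed.

Lemma balanced_orientation (o W : rel T) (U : {set T}) : orients G o -> reorients o W ->
  closed_in W U -> (forall v, v \in U -> k <= out W v) ->
  (forall v, v \notin U -> out W v <= k) -> forall v, out W v <= k.
Proof.
move=> oG reW clU capU slackU v; rewrite leqNgt; apply/negP => ltv.
have vU : v \in U by apply: contraLR ltv => /slackU; rewrite -leqNgt.
have := stuck_sum (cap := fun=> k) clU capU vU ltv.
by rewrite sum_nat_const mulnC ltnNge (density_bound _ oG reW).
Qed.

End Density.

(** * Array programs and their compilation *)

(** Vertex sets are arrays read on the diagonal, numbers are constant
    arrays. The sum over all vertices is the only loop in a term, which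
    keeps evaluation polynomial. *)
Inductive term :=
  | Lit of nat
  | At of nat & nat & nat
  | Lt of nat & nat
  | Add of term & term
  | Diff of term & term
  | Cond of term & term & term
  | Sum of nat & term.

(** [Let a t] computes the whole of array [a], with variables 0 and 1 of [t]
    for row and column. [Repeat p] runs [p] for [n + 2] rounds: nested
    repetitions exceed every bound that is needed below, for small [n] as
    well. *)
Inductive prog :=
  | Let of nat & term
  | Then of prog & prog
  | Repeat of prog.

Section Semantics.
Variable n : nat.

Definition store := nat -> 'I_n -> 'I_n -> nat.

Definition bind (env : nat -> 'I_n) x i := fun y => if y == x then i else env y.

Fixpoint value (m : store) (env : nat -> 'I_n) (t : term) : nat :=
  match t with
  | Lit k => k
  | At a x y => m a (env x) (env y)
  | Lt x y => env x < env y
  | Add t u => value m env t + value m env u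
  | Diff t u => value m env t - value m env u
  | Cond c t u => if 0 < value m env c then value m env t else value m env u
  | Sum x t => \sum_(i < n) value m (bind env x i) t
  end.

Definition assign (m : store) a (f : 'I_n -> 'I_n -> nat) : store :=
  fun b => if b == a then f else m b.

(** Apart from row and column all variables are meant to be bound by sums;
    [z] is a default value. *)
Definition cells (z i j : 'I_n) : nat -> 'I_n :=
  fun x => match x with 0 => i | 1 => j | _ => z end.

Fixpoint run (z : 'I_n) (p : prog) (m : store) : store :=
  match p with
  | Let a t => assign m a (fun i j => value m (cells z i j) t)
  | Then p q => run z q (run z p m)
  | Repeat p => iter n.+2 (run z p) m
  end.
End Semantics.

(** The machine does not multiply, so a vertex variable [x] is accompanied
    by a register for the offset [n * x] of its row. The remainder modulo 3
    separates values, offsets and temporaries. *)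
Definition reg_n := 1.
Definition reg_sq := 2.
Definition reg_val x := 3 * x + 3.
Definition reg_row x := 3 * x + 4.
Definition reg_tmp d := 3 * d + 5.

Definition times a e := iter a (Plus e) (Const 0).
Definition place x y := Plus (Var (reg_row x)) (Var (reg_val y)).
Definition addr a x y :=
  Plus (Const 1) (Plus (times a (Var reg_sq)) (place x y)).

(** Array 0 stays where the input places the adjacency matrix. The blocks 1
    to 3 may be overlapped by the encoded classes; once these have been
    copied to higher blocks, block 1 is free. *)
Definition spare := 1.
Definition block a := if a is 0 then 0 else a + 3.

(** The registers of [x] are saved in temporaries, so that a sum may reuse a
    variable that is in use outside. *)
Definition For x d body :=
  Seq (Assign (reg_tmp d) (Var (reg_val x)))
 (Seq (Assign (reg_tmp d.+1) (Var (reg_row x)))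
 (Seq (Assign (reg_val x) (Const 0))
 (Seq (Assign (reg_row x) (Const 0))
 (Seq (While (Minus (Var reg_n) (Var (reg_val x)))
        (Seq body
        (Seq (Assign (reg_val x) (Plus (Var (reg_val x)) (Const 1)))
             (Assign (reg_row x) (Plus (Var (reg_row x)) (Var reg_n))))))
 (Seq (Assign (reg_val x) (Var (reg_tmp d)))
      (Assign (reg_row x) (Var (reg_tmp d.+1)))))))).

Fixpoint compile_term (t : term) d : cmd :=
  match t with
  | Lit k => Assign (reg_tmp d) (Const k)
  | At a x y => Assign (reg_tmp d) (Get (addr (block a) x y))
  | Lt x y => Assign (reg_tmp d)
      (Minus (Const 1) (Minus (Const 1)
        (Minus (Var (reg_val y)) (Var (reg_val x)))))
  | Add t u => Seq (compile_term t d) (Seq (compile_term u d.+1)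
      (Assign (reg_tmp d) (Plus (Var (reg_tmp d)) (Var (reg_tmp d.+1)))))
  | Diff t u => Seq (compile_term t d) (Seq (compile_term u d.+1)
      (Assign (reg_tmp d) (Minus (Var (reg_tmp d)) (Var (reg_tmp d.+1)))))
  | Cond c t u => Seq (compile_term c d) (If (Var (reg_tmp d)) (compile_term t d) (compile_term u d))
  | Sum x t => Seq (Assign (reg_tmp d) (Const 0))
      (For x d.+1 (Seq (compile_term t d.+3)
        (Assign (reg_tmp d) (Plus (Var (reg_tmp d)) (Var (reg_tmp d.+3))))))
  end.

(** New values are collected in the spare block, because [t] may read the
    array that is being assigned. *)
Fixpoint compile (p : prog) d : cmd :=
  match p with
  | Let a t =>
      Seq (For 0 d (For 1 d.+2
             (Seq (compile_term t d.+4) (Store (addr spare 0 1) (Var (reg_tmp d.+4))))))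
          (For 0 d (For 1 d.+2 (Store (addr (block a) 0 1) (Get (addr spare 0 1)))))
  | Then p q => Seq (compile p d) (compile q d)
  | Repeat p =>
      Seq (Assign (reg_tmp d) (Plus (Var reg_n) (Const 2)))
          (While (Var (reg_tmp d))
            (Seq (compile p d.+1)
                 (Assign (reg_tmp d) (Minus (Var (reg_tmp d)) (Const 1)))))
  end.

Section Correct.
Variable n : nat.
Implicit Types (m : store n) (s : state).

Definition cell a (i j : nat) := 1 + (a * (n * n) + (n * i + j)).

Definition unchanged (X : pred nat) s s' :=
  forall r, ~~ X r -> reg s' r = reg s r.

(** A weakest precondition with a time budget. *)
Definition halts c s B (K : state -> Prop) :=
  exists t s', [/\ exec c s t s', t <= B & K s'].

Lemma halts_weak c s B B' (K K' : state -> Prop) :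
  B <= B' -> (forall s', K s' -> K' s') -> halts c s B K -> halts c s B' K'.
Proof.
move=> leB KK' [t [s' [e let_ k]]]; exists t, s'; split=> //; last exact: KK'.
exact: leq_trans leB.
Qed.

Lemma halts_assign r e s B (K : state -> Prop) :
  0 < B -> K (State (update (reg s) r (eval s e)) (heap s)) ->
  halts (Assign r e) s B K.
Proof. by move=> B0 k; exists 1; eexists; split; [constructor|..]. Qed.

Lemma halts_store e1 e2 s B (K : state -> Prop) :
  0 < B -> K (State (reg s) (update (heap s) (eval s e1) (eval s e2))) ->
  halts (Store e1 e2) s B K.
Proof. by move=> B0 k; exists 1; eexists; split; [constructor|..]. Qed.

Lemma halts_seq c1 c2 s B1 B2 (K : state -> Prop) :
  halts c1 s B1 (fun s1 => halts c2 s1 B2 K) ->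
  halts (Seq c1 c2) s (B1 + B2) K.
Proof.
move=> [t1 [s1 [e1 l1 [t2 [s2 [e2 l2 k]]]]]].
by exists (t1 + t2), s2; split=> //; [exact: ExecSeq e1 e2|exact: leq_add].
Qed.

Lemma halts_if e c1 c2 s B (K : state -> Prop) :
  halts (if 0 < eval s e then c1 else c2) s B K ->
  halts (If e c1 c2) s B.+1 K.
Proof.
move=> [t [s' [ex l k]]]; exists t.+1, s'; split=> //.
case: ifP ex => [/lt0n_neq0|/negbT]; first exact: ExecIfTrue.
by rewrite lt0n negbK => /eqP; exact: ExecIfFalse.
Qed.

Lemma halts_while e c B (I : nat -> state -> Prop) k s :
  (forall k s, I k s -> eval s e = k) ->
  (forall k s, I k.+1 s -> halts c s B (I k)) ->
  I k s -> halts (While e c) s (k * B.+1 + 1) (I 0).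
Proof.
move=> Ie Ic; elim: k s => [|k IHk] s Is.
  by exists 1, s; split=> //; apply: ExecWhileFalse; rewrite (Ie 0).
have [t1 [s1 [e1 l1 /IHk[t2 [s2 [e2 l2 k2]]]]]] := Ic _ _ Is.
exists (t1 + t2).+1, s2; split=> //; last by rewrite mulSn; lia.
by apply: ExecWhileTrue e1 e2; rewrite (Ie k.+1).
Qed.

Definition loop_regs x d := [pred r | r \in [:: reg_val x; reg_row x; reg_tmp d; reg_tmp d.+1]].

Definition at_var x k s := reg s (reg_val x) = k /\ reg s (reg_row x) = n * k.

(** The loop itself changes the registers of [x] and two temporaries, so the
    invariant must not depend on them. *)
Lemma halts_for x d body B (I : nat -> state -> Prop) s (K : state -> Prop) :
  reg s reg_n = n ->
  (forall k s s', unchanged (loop_regs x d) s s' -> heap s' =1 heap s -> I k s -> I k s') ->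
  I 0 s ->
  (forall k s', k < n -> reg s' reg_n = n -> at_var x k s' -> I k s' ->
     halts body s' B (fun s'' => [/\ I k.+1 s'', reg s'' reg_n = n,
       at_var x k s'', reg s'' (reg_tmp d) = reg s' (reg_tmp d)
      & reg s'' (reg_tmp d.+1) = reg s' (reg_tmp d.+1)])) ->
  (forall s', I n s' -> reg s' reg_n = n -> reg s' (reg_val x) = reg s (reg_val x) ->
     reg s' (reg_row x) = reg s (reg_row x) -> K s') ->
  halts (For x d body) s (n * (B + 3) + 7) K.
Proof.
move=> sn stab I0 step post.
have [n1 n2 n3] : [/\ reg_val x != reg_row x, reg_tmp d != reg_tmp d.+1
   & reg_val x != reg_tmp d].
  by rewrite /reg_val /reg_row /reg_tmp; split; lia.
have [n4 n5 n6] : [/\ reg_val x != reg_tmp d.+1, reg_row x != reg_tmp d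
   & reg_row x != reg_tmp d.+1].
  by rewrite /reg_val /reg_row /reg_tmp; split; lia.
have [m1 m2 m3 m4] : [/\ reg_n != reg_val x, reg_n != reg_row x,
   reg_n != reg_tmp d & reg_n != reg_tmp d.+1].
  by rewrite /reg_val /reg_row /reg_tmp /reg_n; split; lia.
pose J k s' := exists j, [/\ I j s', k + j = n, reg s' reg_n = n, at_var x j s'
   & reg s' (reg_tmp d) = reg s (reg_val x) /\ reg s' (reg_tmp d.+1) = reg s (reg_row x)].
apply: (@halts_weak _ _ (1 + (1 + (1 + (1 + ((n * (B + 2).+1 + 1) + (1 + 1))))))
   _ K) => //; first by rewrite addn2 addn3; lia.
do 4![apply: halts_seq; apply: halts_assign => //=].
apply: halts_seq.
apply: (halts_weak (leqnn _)); last first.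
  apply: (@halts_while _ _ _ J n).
  - by move=> k s1 [j [_ jk /= -> [-> _] _]]; lia.
  - move=> k s1 [j [Ij jk s1n vj [t1 t2]]].
    rewrite -[2]/(1 + 1); apply: halts_seq.
    apply: (halts_weak (leqnn _)); last by apply: (step j) => //; lia.
    move=> s2 [Ij' s2n [v1 v2] t1' t2'].
    apply: halts_seq; do 2!apply: halts_assign => //=.
    exists j.+1; split; first 1 last.
    + by lia.
    + by rewrite /update /= (negPf m1) (negPf m2).
    + split; rewrite /= /update /= ?eqxx ?(negPf n1) ?(eq_sym (reg_row x)) ?(negPf n1).
        by rewrite v1 addn1.
      by rewrite (negPf m1) v2 s2n mulnS addnC.
    + split; rewrite /update /=.
        by rewrite !(eq_sym (reg_tmp d)) (negPf n3) (negPf n5) t1' t1.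
      by rewrite !(eq_sym (reg_tmp d.+1)) (negPf n4) (negPf n6) t2' t2.
    apply: stab Ij'; last by [].
    move=> r /=; rewrite !inE !negb_or => /and4P[a1 a2 a3 a4].
    by rewrite /update ?(negPf a1) ?(negPf a2).
  - exists 0; split.
    + apply: stab I0 => //; move=> r /=; rewrite !inE !negb_or => /and4P[a1 a2 a3 a4].
      by rewrite /update (negPf a1) (negPf a2) (negPf a3) (negPf a4).
    + by rewrite addn0.
    + by rewrite /update /= (negPf m1) (negPf m2) (negPf m3) (negPf m4).
    + by rewrite /at_var /update /= eqxx (negPf n1) ?eqxx muln0.
    + split; rewrite /update /=.
        rewrite !(eq_sym (reg_tmp d)) (negPf n3) (negPf n5) (eq_sym _ (reg_tmp d)).
        by rewrite (negPf n2) eqxx.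
      rewrite !(eq_sym (reg_tmp d.+1)) (negPf n4) (negPf n6) eqxx.
      by rewrite (negPf n5).
move=> s1 [j [Ij /= jn s1n vj [t1 t2]]].
apply: halts_seq; do 2!apply: halts_assign => //=.
rewrite add0n in jn; rewrite {}jn in Ij.
apply: post => /=.
- apply: stab Ij => //.
  move=> r /=; rewrite !inE !negb_or => /and4P[a1 a2 a3 a4].
    by rewrite /update ?(negPf a1) ?(negPf a2).
- by rewrite /update (negPf m1) (negPf m2).
- by rewrite /update (negPf n1) eqxx.
by rewrite /update eqxx (eq_sym (reg_tmp d.+1)) (negPf n4).
Qed.

Definition fits m (env : nat -> 'I_n) s :=
  [/\ reg s reg_n = n, reg s reg_sq = n * n, forall x, at_var x (env x) s
    & forall a (i j : 'I_n), heap s (cell (block a) i j) = m a i j].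

Lemma eval_addr a x y i j s :
  reg s reg_sq = n * n -> at_var x i s -> at_var y j s ->
  eval s (addr a x y) = cell a i j.
Proof.
move=> sq [_ xi] [yj _]; rewrite /= xi yj; congr (_ + (_ + _)).
by elim: a => //= a ->; rewrite sq mulSn.
Qed.

Lemma cell_small i j : i < n -> j < n -> n * i + j < n * n.
Proof.
move=> ltin ltjn; apply: leq_trans (_ : n * i.+1 <= _); last by rewrite leq_mul2l ltin orbT.
by rewrite mulnS addnC ltn_add2r.
Qed.

Lemma cell_inj a b i j k l : i < n -> j < n -> k < n -> l < n ->
  (cell a i j == cell b k l) = [&& a == b, i == k & j == l].
Proof.
move=> lti ltj ltk ltl; apply/eqP/and3P => [|[/eqP-> /eqP-> /eqP->] //].
move=> /addnI/= e.
have nn0 : 0 < n * n by case: (n) lti.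
have /eqP ab : a == b.
  by have := congr1 (divn^~ (n * n)) e; rewrite !divnMDl // !divn_small ?cell_small // !addn0 => ->.
move: e; rewrite ab => /addnI e; rewrite eqxx.
have n0 : 0 < n by case: (n) lti.
have /eqP ik : i == k.
  have := congr1 (divn^~ n) e; rewrite ![n * _]mulnC !divnMDl //.
  by rewrite !divn_small // !addn0 => ->.
by move: e; rewrite ik => /addnI ->; rewrite !eqxx.
Qed.

End Correct.

(** Time bounds are only tracked up to polynomials in [n]. *)
Definition poly (f : nat -> nat) := exists a b, forall n, f n <= a * n.+2 ^ b.

Lemma poly_const c : poly (fun=> c).
Proof. by exists c, 0 => n; rewrite expn0 muln1. Qed.

Lemma poly_id : poly id.
Proof. by exists 1, 1 => n; rewrite expn1 mul1n; lia. Qed.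

Lemma poly_add f g : poly f -> poly g -> poly (fun n => f n + g n).
Proof.
move=> [a [b fP]] [c [d gP]]; exists (a + c), (b + d) => n.
rewrite mulnDl; apply: leq_add.
  by apply: leq_trans (fP n) _; rewrite leq_mul2l leq_pexp2l ?leq_addr ?orbT.
by apply: leq_trans (gP n) _; rewrite leq_mul2l leq_pexp2l ?leq_addl ?orbT.
Qed.

Lemma poly_mul f g : poly f -> poly g -> poly (fun n => f n * g n).
Proof.
move=> [a [b fP]] [c [d gP]]; exists (a * c), (b + d) => n.
by rewrite expnD mulnACA leq_mul.
Qed.

Lemma val_tmp y e : reg_val y != reg_tmp e.
Proof. by rewrite /reg_val /reg_tmp; lia. Qed.

Lemma row_tmp y e : reg_row y != reg_tmp e.
Proof. by rewrite /reg_row /reg_tmp; lia. Qed.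

Lemma n_tmp e : reg_n != reg_tmp e.
Proof. by rewrite /reg_n /reg_tmp; lia. Qed.

Lemma sq_tmp e : reg_sq != reg_tmp e.
Proof. by rewrite /reg_sq /reg_tmp; lia. Qed.

Ltac poly_bound := repeat first [assumption | apply: poly_const | apply: poly_id
  | apply: poly_add | apply: poly_mul].

Lemma compile_term_correct t d : exists2 B, poly B &
  forall n (m : store n) env s, fits m env s ->
  halts (compile_term t d) s (B n) (fun s' => [/\ reg s' (reg_tmp d) = value m env t,
     heap s' =1 heap s &
     forall r, (forall e, d <= e -> r != reg_tmp e) -> reg s' r = reg s r]).
Proof.
have lower d' d'' r : d' <= d'' -> (forall e, d' <= e -> r != reg_tmp e) ->
    forall e, d'' <= e -> r != reg_tmp e.
  by move=> le_d H e le_e; apply: H; apply: leq_trans le_e.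
have keep n m env d' s s' : @fits n m env s -> heap s' =1 heap s ->
    (forall r, (forall e, d' <= e -> r != reg_tmp e) -> reg s' r = reg s r) ->
    fits m env s'.
  move=> [f1 f2 f3 f4] hs rs; split.
  - by rewrite rs // => e _; rewrite /reg_n /reg_tmp; lia.
  - by rewrite rs // => e _; rewrite /reg_sq /reg_tmp; lia.
  - move=> x; have [v1 v2] := f3 x.
    split; rewrite rs // => e _; rewrite ?/reg_val ?/reg_row /reg_tmp; lia.
  - by move=> a i j; rewrite hs.
have tmp1 s d' v : forall r, (forall e, d' <= e -> r != reg_tmp e) ->
     reg (State (update (reg s) (reg_tmp d') v) (heap s)) r = reg s r.
  by move=> r /(_ _ (leqnn _)) rd; rewrite /= /update (negPf rd).
elim: t d => [k|a x y|x y|t IHt u IHu|t IHt u IHu|c IHc t IHt u IHu|x t IHt] d.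
- exists (fun=> 1) => [|n m env s _]; first exact: poly_const.
  by apply: halts_assign => //; split=> //; [rewrite /= /update eqxx|exact: tmp1].
- exists (fun=> 1) => [|n m env s [_ f2 f3 f4]]; first exact: poly_const.
  apply: halts_assign => //; split=> //; last exact: tmp1.
  have := @eval_addr n (block a) x y _ _ s f2 (f3 x) (f3 y).
  by rewrite /= /update eqxx => ->; rewrite f4.
- exists (fun=> 1) => [|n m env s [_ f2 f3 f4]]; first exact: poly_const.
  apply: halts_assign => //; split=> //; last exact: tmp1.
  rewrite /= /update eqxx; have [-> _] := f3 x; have [-> _] := f3 y.
  by lia.
- have [B1 pB1 h1] := IHt d; have [B2 pB2 h2] := IHu d.+1.
  exists (fun n => B1 n + (B2 n + 1)) => [|n m env s f].
    by poly_bound.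
  apply: halts_seq; apply: (halts_weak (leqnn _)) (h1 _ _ _ _ f).
  move=> s1 [v1 hs1 rs1]; have f' := keep _ _ _ _ _ _ f hs1 rs1.
  apply: halts_seq; apply: (halts_weak (leqnn _)) (h2 _ _ _ _ f').
  move=> s2 [v2 hs2 rs2]; apply: halts_assign => //; split=> [||r rd].
  + rewrite /= /update eqxx v2 rs2 ?v1 // => e; rewrite /reg_tmp; lia.
  + by move=> z /=; rewrite hs2 hs1.
  + by rewrite tmp1 // rs2 ?rs1 //; apply: lower rd.
- have [B1 pB1 h1] := IHt d; have [B2 pB2 h2] := IHu d.+1.
  exists (fun n => B1 n + (B2 n + 1)) => [|n m env s f].
    by poly_bound.
  apply: halts_seq; apply: (halts_weak (leqnn _)) (h1 _ _ _ _ f).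
  move=> s1 [v1 hs1 rs1]; have f' := keep _ _ _ _ _ _ f hs1 rs1.
  apply: halts_seq; apply: (halts_weak (leqnn _)) (h2 _ _ _ _ f').
  move=> s2 [v2 hs2 rs2]; apply: halts_assign => //; split=> [||r rd].
  + rewrite /= /update eqxx v2 rs2 ?v1 // => e; rewrite /reg_tmp; lia.
  + by move=> z /=; rewrite hs2 hs1.
  + by rewrite tmp1 // rs2 ?rs1 //; apply: lower rd.
- have [B1 pB1 h1] := IHc d; have [B2 pB2 h2] := IHt d.
  have [B3 pB3 h3] := IHu d.
  exists (fun n => B1 n + (B2 n + B3 n + 1)) => [|n m env s f].
    by poly_bound.
  apply: halts_seq; apply: (halts_weak (leqnn _)) (h1 _ _ _ _ f).
  move=> s1 [v1 hs1 rs1]; have f' := keep _ _ _ _ _ _ f hs1 rs1.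
  rewrite addn1; apply: halts_if; rewrite /= v1.
  case: ifP => _.
    apply: (halts_weak _ _ (h2 _ _ _ _ f')); first by rewrite leq_addr.
    move=> s2 [v2 hs2 rs2]; split=> // [z|r rd]; first by rewrite hs2 hs1.
    by rewrite rs2 // rs1.
  apply: (halts_weak _ _ (h3 _ _ _ _ f')); first by rewrite leq_addl.
  move=> s2 [v2 hs2 rs2]; split=> // [z|r rd]; first by rewrite hs2 hs1.
  by rewrite rs2 // rs1.
have [B pB h] := IHt d.+3.
exists (fun n => 1 + (n * ((B n + 1) + 3) + 7)) => [|n m env s f].
  by poly_bound.
pose val k := \sum_(i < n | i < k) value m (bind env x i) t.
pose I k s' := [/\ reg s' (reg_tmp d) = val k, heap s' =1 heap s
  & forall r, ~~ loop_regs x d.+1 r -> (forall e, d <= e -> r != reg_tmp e) ->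
    reg s' r = reg s r].
apply: halts_seq; apply: halts_assign => //.
have [f1 f2 f3 f4] := f.
apply: (@halts_for n _ _ _ _ I).
- by rewrite tmp1 // => e _; rewrite /reg_n /reg_tmp; lia.
- move=> k s1 s2 us hs [i1 i2 i3]; split.
  + by rewrite us //= !inE /reg_val /reg_row /reg_tmp; lia.
  + by move=> z; rewrite hs i2.
  + by move=> r nr rd; rewrite us // i3.
- split=> //.
    by rewrite /= /update eqxx /val big_pred0.
  by move=> r nr rd; rewrite tmp1.
- move=> k s1 ltk s1n v1 [i1 i2 i3].
  have f' : fits m (bind env x (Ordinal ltk)) s1.
    split=> //.
    + by rewrite i3 // ?inE => [|e _]; rewrite /reg_sq ?/loop_regs /= ?inE /reg_tmp ?/reg_row ?/reg_val; lia.
    + move=> y; rewrite /bind; case: eqP => [->|/eqP yx]; first exact: v1.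
      have [w1 w2] := f3 y.
      by split; rewrite i3 //= ?inE ?negb_or ?val_tmp ?row_tmp ?andbT;
        try (by move=> e _; rewrite ?val_tmp ?row_tmp); rewrite /reg_row /reg_val; lia.
    + by move=> a i j; rewrite i2.
  apply: halts_seq; apply: (halts_weak (leqnn _)) (h _ _ _ _ f').
  move=> s2 [v2 hs2 rs2]; apply: halts_assign => //.
  have up r : r != reg_tmp d -> (forall e, d.+3 <= e -> r != reg_tmp e) ->
      reg (State (update (reg s2) (reg_tmp d) (eval s2
          (Plus (Var (reg_tmp d)) (Var (reg_tmp d.+3))))) (heap s2)) r = reg s1 r.
    by move=> rd re; rewrite /= /update (negPf rd) rs2.
  split.
  + split.
    * rewrite /= /update eqxx v2 rs2 ?i1; last by move=> e; rewrite /reg_tmp; lia.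
      rewrite /val [RHS](bigD1 (Ordinal ltk)) /=; last exact: ltnSn.
      rewrite addnC; congr (_ + _); apply: eq_bigl => i.
      by rewrite ltnS ltn_neqAle andbC.
    * by move=> z; rewrite hs2 i2.
    * move=> r nr rd; rewrite up ?i3 //; first exact: rd.
      by apply: lower rd; lia.
  + by rewrite up ?n_tmp // => e _; apply: n_tmp.
  + have [w1 w2] := v1.
    split; rewrite up ?val_tmp ?row_tmp // => e _; [exact: val_tmp|exact: row_tmp].
  + by rewrite up // => [|e]; rewrite /reg_tmp; lia.
  + by rewrite up // => [|e]; rewrite /reg_tmp; lia.
- move=> s1 [i1 i2 i3] s1n vx rx; split=> //.
    by rewrite i1 /val; apply: eq_bigl => i; rewrite ltn_ord.
  move=> r rd.
  case: (boolP (loop_regs x d.+1 r)) => [|nr]; last exact: i3.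
  rewrite /= !inE => /or4P[]/eqP E; subst r.
  + by rewrite vx tmp1.
  + by rewrite rx tmp1.
  + by have := rd d.+1; rewrite eqxx leqnSn => /(_ isT).
  + by have := rd d.+2; rewrite eqxx ltnW // => /(_ isT).
Qed.

Section Grid.
Variable n : nat.

(** The common shape of assigning an array, copying a class and writing the
    output. *)
Lemma halts_grid d body B (dst f : nat -> nat -> nat) s (K : state -> Prop) :
  reg s reg_n = n ->
  (forall i j k l, i < n -> j < n -> k < n -> l < n ->
     dst i j = dst k l -> i = k /\ j = l) ->
  (forall i j s1, i < n -> j < n ->
     (forall r, r \notin [:: reg_val 0; reg_row 0; reg_val 1; reg_row 1] ->
        (forall e, d <= e -> r != reg_tmp e) -> reg s1 r = reg s r) ->
     (forall z, (forall k l, k < n -> l < n -> z != dst k l) -> heap s1 z = heap s z) ->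
     at_var n 0 i s1 -> at_var n 1 j s1 ->
     halts body s1 B (fun s2 => heap s2 =1 update (heap s1) (dst i j) (f i j) /\
        forall r, (forall e, d.+4 <= e -> r != reg_tmp e) -> reg s2 r = reg s1 r)) ->
  (forall s2,
     (forall z, (forall k l, k < n -> l < n -> z != dst k l) -> heap s2 z = heap s z) ->
     (forall i j, i < n -> j < n -> heap s2 (dst i j) = f i j) ->
     (forall r, (forall e, d <= e -> r != reg_tmp e) -> reg s2 r = reg s r) -> K s2) ->
  halts (For 0 d (For 1 d.+2 body)) s (n * ((n * (B + 3) + 7) + 3) + 7) K.
Proof.
move=> sn inj step post.
pose out z := forall k l, k < n -> l < n -> z != dst k l.
pose tmpfree e0 r := forall e, e0 <= e -> r != reg_tmp e.
pose I i s1 := [/\ forall z, out z -> heap s1 z = heap s z,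
  forall k l, k < i -> k < n -> l < n -> heap s1 (dst k l) = f k l
  & forall r, ~~ loop_regs 0 d r -> tmpfree d r -> reg s1 r = reg s r].
have tf k r : tmpfree d r -> tmpfree (d + k) r.
  by move=> rd e le_e; apply: rd; apply: leq_trans le_e; rewrite leq_addr.
apply: (@halts_for n _ _ _ _ I) => //.
- move=> i s1 s2 us hs [i1 i2 i3]; split=> [z oz|k l ki kn ln|r nr rd].
  + by rewrite hs i1.
  + by rewrite hs i2.
  + by rewrite us // i3.
- move=> i s1 ltin s1n v1 [i1 i2 i3].
  pose J j s2 := [/\ forall z, out z -> heap s2 z = heap s z,
    forall k l, (k < i) || ((k == i) && (l < j)) -> k < n -> l < n -> heap s2 (dst k l) = f k l
    & forall r, ~~ loop_regs 1 d.+2 r -> tmpfree d.+2 r -> reg s2 r = reg s1 r].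
  apply: (@halts_for n _ _ _ _ J) => //.
  + move=> j s2 s3 us hs [j1 j2 j3]; split=> [z oz|k l ki kn ln|r nr rd].
    * by rewrite hs j1.
    * by rewrite hs j2.
    * by rewrite us // j3.
  + by split=> // k l; rewrite andbF orbF; apply: i2.
  + move=> j s2 ltjn s2n v2 [j1 j2 j3].
    have v2' : at_var n 0 i s2.
      have [w1 w2] := v1; split; rewrite j3 //= ?inE ?negb_or ?val_tmp ?row_tmp //.
        by move=> e _; apply: val_tmp.
      by move=> e _; apply: row_tmp.
    have base r : r \notin [:: reg_val 0; reg_row 0; reg_val 1; reg_row 1] ->
        tmpfree d r -> reg s2 r = reg s r.
      rewrite !inE !negb_or => /and4P[r0 r1 r2 r3] rd.
      have [d0 d1] : r != reg_tmp d /\ r != reg_tmp d.+1 by split; apply: rd.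
      have [d2 d3] : r != reg_tmp d.+2 /\ r != reg_tmp d.+3.
        by split; apply: rd; rewrite ?leqW.
      rewrite j3 ?i3 //= ?inE ?negb_or ?r0 ?r1 ?r2 ?r3 ?d0 ?d1 ?d2 ?d3 //.
      by rewrite -addn2; apply: tf.
    have b1 := step _ _ _ ltin ltjn base j1 v2' v2.
    apply: (halts_weak (leqnn _)) b1 => s3 [h3 r3]; split.
    * split.
      - move=> z oz; rewrite h3 /update -j1 //; case: eqP => // zE.
        by have := oz i j ltin ltjn; rewrite zE eqxx.
      - move=> k l klj kn ln; rewrite h3 /update; case: eqP => [|ne].
          by case/(inj _ _ _ _ kn ln ltin ltjn) => -> ->.
        apply: j2 => //; apply: contra_notT ne; rewrite negb_or negb_and.
        case/andP=> ki; case/orP: klj => [|/andP[/eqP -> lj]]; first by rewrite (negPf ki).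
        by rewrite eqxx /= -leqNgt => jl; congr dst; apply/eqP; rewrite eqn_leq jl -ltnS lj.
      - move=> r nr rd; rewrite r3 ?j3 // => e le_e; apply: rd.
        by rewrite (leq_trans _ le_e) // -[d.+4]addn2 leq_addr.
    * by rewrite r3 // => e _; apply: n_tmp.
    * by have [w1 w2] := v2; split; rewrite r3 // => e _; [apply: val_tmp|apply: row_tmp].
    * by rewrite r3 // => e; rewrite /reg_tmp; lia.
    * by rewrite r3 // => e; rewrite /reg_tmp; lia.
  + move=> s2 [j1 j2 j3] s2n vv vr.
    have same r : tmpfree d.+2 r -> reg s2 r = reg s1 r.
      move=> rd; case: (boolP (loop_regs 1 d.+2 r)) => [|nr]; last exact: j3.
      rewrite /= !inE => /or4P[]/eqP E; subst r => //.
        by have := rd d.+2 (leqnn _); rewrite eqxx.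
      by have := rd d.+3 (leqnSn _); rewrite eqxx.
    split=> //.
    * split=> // [k l ki kn ln|r nr rd].
        by apply: j2 => //; rewrite ln andbT orbC -leq_eqVlt -ltnS.
      by rewrite same ?i3 // -addn2; apply: tf.
    * by have [w1 w2] := v1; split; rewrite same // => e _; [apply: val_tmp|apply: row_tmp].
    * by rewrite same // => e; rewrite /reg_tmp; lia.
    * by rewrite same // => e; rewrite /reg_tmp; lia.
- move=> s2 [i1 i2 i3] s2n vv vr; apply: post => // [i j ltin ltjn|r rd].
    exact: i2.
  case: (boolP (loop_regs 0 d r)) => [|nr]; last exact: i3.
  rewrite /= !inE => /or4P[]/eqP E; subst r => //.
    by have := rd d (leqnn _); rewrite eqxx.
  by have := rd d.+1 (leqnSn _); rewrite eqxx.
Qed.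

End Grid.

Lemma block_inj : injective block.
Proof. by move=> [|a] [|b] //=; lia. Qed.

Lemma block_spare a : block a != spare.
Proof. by case: a => //= a; rewrite /spare; lia. Qed.

Lemma compile_correct p d : exists2 B, poly B &
  forall n (m : store n) z s, fits m (fun=> z) s ->
  halts (compile p d) s (B n) (fun s' => fits (run z p m) (fun=> z) s' /\
     forall e, e < d -> reg s' (reg_tmp e) = reg s (reg_tmp e)).
Proof.
elim: p d => [a t|p IHp q IHq|p IHp] d.
- have [B pB h] := compile_term_correct t d.+4.
  exists (fun n => (n * ((n * ((B n + 1) + 3) + 7) + 3) + 7) +
                   (n * ((n * (1 + 3) + 7) + 3) + 7)) => [|n m z s f].
    by poly_bound.
  have [f1 f2 f3 f4] := f.
  have celli b k l i j : k < n -> l < n -> i < n -> j < n ->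
      cell n b k l = cell n b i j -> k = i /\ l = j.
    by move=> kn ln ln' jn /eqP; rewrite cell_inj // => /and3P[_ /eqP-> /eqP->].
  have far b c i j k l : b != c -> i < n -> j < n -> k < n -> l < n ->
      cell n b i j != cell n c k l.
    by move=> bc *; rewrite cell_inj // (negPf bc).
  pose nz (i : nat) (P : forall o : 'I_n, nat) := if insub i is Some o then P o else 0.
  pose g i j := nz i (fun i => nz j (fun j => value m (cells z i j) t)).
  have gE (i j : 'I_n) : g i j = value m (cells z i j) t.
    by rewrite /g /nz !valK.
  apply: halts_seq; apply: (@halts_grid n d _ _ (cell n spare) g) => //; first exact: celli.
    move=> i j s1 ltin ltjn base hp vi vj.
    have fe : fits m (cells z (Ordinal ltin) (Ordinal ltjn)) s1.
      split.
      + by rewrite base // => e _; apply: n_tmp.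
      + by rewrite base // => e _; apply: sq_tmp.
      + case=> [|[|x]] //=; have [w1 w2] := f3 x.+2.
        split; rewrite base //; try (by move=> e _; rewrite ?val_tmp ?row_tmp);
          by rewrite !inE /reg_row /reg_val; lia.
      + by move=> b k l; rewrite hp // => k' l' *; apply: far => //; apply: block_spare.
    apply: halts_seq; apply: (halts_weak (leqnn _)) (h _ _ _ _ fe).
    move=> s2 [v2 h2 r2]; apply: halts_store => //; split.
      move=> u /=; rewrite /update.
      have := @eval_addr n spare 0 1 i j s2.
      rewrite /= => -> //; first last.
      + by have [w1 w2] := vj; split; rewrite r2 // => e _; [apply: val_tmp|apply: row_tmp].
      + by have [w1 w2] := vi; split; rewrite r2 // => e _; [apply: val_tmp|apply: row_tmp].
      + by rewrite r2 ?base // => e _; apply: sq_tmp.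
      case: eqP => // _; rewrite v2; symmetry; rewrite -[i]/(val (Ordinal ltin)) -[j]/(val (Ordinal ltjn)); exact: gE.
    by move=> r rd; apply: r2.
  move=> s1 hout hin rin.
  apply: (@halts_grid n d _ _ (cell n (block a)) g) => //.
  + by rewrite rin // => e _; apply: n_tmp.
  + exact: celli.
  + move=> i j s2 ltin ltjn base hp vi vj.
    apply: halts_store => //; split=> // u.
    have sq2 : reg s2 reg_sq = n * n.
      by rewrite base ?rin // => e _; apply: sq_tmp.
    rewrite (eval_addr _ sq2 vi vj) /= /update; case: eqP => // _.
    have := eval_addr spare sq2 vi vj; rewrite /= => ->.
    by rewrite hp ?hin // => k l *; apply: far => //; rewrite eq_sym block_spare.
  + move=> s2 hout2 hin2 rin2; split; last first.
      by move=> e le_e; rewrite rin2 ?rin // => e'; rewrite /reg_tmp; lia.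
    split.
    * by rewrite rin2 ?rin // => e _; apply: n_tmp.
    * by rewrite rin2 ?rin // => e _; apply: sq_tmp.
    * move=> x; have [w1 w2] := f3 x.
      by split; rewrite rin2 ?rin // => e _; rewrite ?val_tmp ?row_tmp.
    * move=> b i j; rewrite /run /assign; case: eqP => [->|/eqP ba].
        by rewrite hin2 // gE.
      rewrite hout2 => [|k l *]; last first.
        by apply: far => //; apply: contra_neq ba => /block_inj.
      by rewrite hout ?f4 // => k l *; apply: far => //; apply: block_spare.
- have [B1 pB1 h1] := IHp d; have [B2 pB2 h2] := IHq d.
  exists (fun n => B1 n + B2 n) => [|n m z s f]; first by poly_bound.
  apply: halts_seq; apply: (halts_weak (leqnn _)) (h1 _ _ _ _ f) => s1 [f1 t1].
  apply: (halts_weak (leqnn _)) (h2 _ _ _ _ f1) => s2 [f2 t2]; split=> // e led.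
  by rewrite t2 ?t1.
have [B pB h] := IHp d.+1.
exists (fun n => 1 + (((n + 2) * (B n + 1 + 1)) + 1)) => [|n m z s f].
  by poly_bound.
apply: halts_seq; apply: halts_assign => //=.
have [f1 f2 f3 f4] := f; rewrite f1.
pose I k s1 := exists2 j, k + j = n.+2 &
  [/\ fits (iter j (run z p) m) (fun=> z) s1, reg s1 (reg_tmp d) = k
    & forall e, e < d -> reg s1 (reg_tmp e) = reg s (reg_tmp e)].
have keep m1 s1 v : fits m1 (fun=> z) s1 ->
    fits m1 (fun=> z) (State (update (reg s1) (reg_tmp d) v) (heap s1)).
  move=> [g1 g2 g3 g4]; split=> //=; rewrite /update ?(negPf (n_tmp _)) ?(negPf (sq_tmp _)) //.
  move=> x; have [w1 w2] := g3 x.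
  by split; rewrite /= ?(negPf (val_tmp _ _)) ?(negPf (row_tmp _ _)).
have low s1 v e : e < d ->
    reg (State (update (reg s1) (reg_tmp d) v) (heap s1)) (reg_tmp e) = reg s1 (reg_tmp e).
  by move=> led /=; rewrite /update; case: eqP => //; rewrite /reg_tmp; lia.
apply: (@halts_weak _ _ ((n + 2) * (B n + 1).+1 + 1) _ (I 0)).
- by rewrite !addn1.
- by move=> s1 [j /=]; rewrite add0n => -> [g1 g2 g3].
apply: halts_while.
- by move=> k s1 [j _ [_ /= -> _]].
- move=> k s1 [j kj [g1 g2 g3]]; apply: halts_seq.
  apply: (halts_weak (leqnn _)) (h _ _ _ _ g1) => s2 [e1 e2].
  apply: halts_assign => //; exists j.+1; first by rewrite addnS.
  split; first exact: keep.
    by rewrite /= /update eqxx e2 // g2 subn1.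
  by move=> e led; rewrite low // e2 ?g3 // ltnW.
- exists 0; first by rewrite addn0 addn2.
  split; first exact: keep.
    by rewrite /= /update eqxx.
  by move=> e led; rewrite low.
Qed.

(** * Reading the instance and writing the result *)

Definition copy_class a e :=
  For 0 0 (For 1 2 (Store (addr (block a) 0 1)
    (Get (Plus (Const 1) (Plus (Var reg_sq) (Plus e (Var (reg_val 0)))))))).

Definition output_array := 4.

(** Without vertices a vertex variable has no value, so that case is handled
    separately. *)
Definition executable (p : prog) :=
  Seq (Assign reg_n (Get (Const 0)))
    (If (Var reg_n)
      (Seq (For 0 0 (Assign reg_sq (Plus (Var reg_sq) (Var reg_n))))
      (Seq (copy_class 1 (Const 0))
      (Seq (copy_class 2 (Var reg_n))
      (Seq (copy_class 3 (Plus (Var reg_n) (Var reg_n)))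
      (Seq (compile p 0)
      (Seq (For 0 0 (For 1 2 (Store (place 0 1)
              (Get (addr (block output_array) 0 1)))))
           (Assign 0 (Var reg_sq))))))))
      (Assign 0 (Const 0))).

Lemma nth_allpairs (S T : Type) (f : S -> T -> nat) s t x0 y0 d i j :
  i < size s -> j < size t ->
  nth d [seq f x y | x <- s, y <- t] (size t * i + j) =
    f (nth x0 s i) (nth y0 t j).
Proof.
elim: s i => // x s IHs [|i] ltis ltjt; rewrite allpairs_cons nth_cat size_map.
  by rewrite muln0 ltjt (nth_map y0).
rewrite mulnS -addnA ltnNge leq_addr /= addKn.
by rewrite IHs.
Qed.

Lemma nth_encode_rel n (r : rel 'I_n) (i j : 'I_n) :
  nth 0 (encode_rel r) (n * i + j) = r i j.
Proof.
have := @nth_allpairs _ _ (fun u v => r u v : nat) (enum 'I_n) (enum 'I_n) i j 0 i j.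
by rewrite size_enum_ord !nth_ord_enum => ->.
Qed.

Lemma size_encode_rel n (r : rel 'I_n) : size (encode_rel r) = n * n.
Proof. by rewrite size_allpairs size_enum_ord. Qed.

Lemma nth_encode_set n (V : {set 'I_n}) (i : 'I_n) :
  nth 0 (encode_set V) i = (i \in V).
Proof. by rewrite (nth_map i) ?size_enum_ord // nth_ord_enum. Qed.

Lemma size_encode_set n (V : {set 'I_n}) : size (encode_set V) = n.
Proof. by rewrite size_map size_enum_ord. Qed.

Section Instance.
Variables (n : nat) (G : sgraph 'I_n) (V1 V2 V3 : {set 'I_n}).
Let w := encode_instance G V1 V2 V3.

Lemma nth_instance_graph (i j : 'I_n) : nth 0 w (1 + (n * i + j)) = G i j.
Proof.
have lt : n * i + j < n * n by apply: cell_small.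
by rewrite /w /= add0n nth_cat size_encode_rel lt nth_encode_rel.
Qed.

Lemma nth_instance_class (i : 'I_n) :
  [/\ nth 0 w (1 + (n * n + i)) = (i \in V1),
      nth 0 w (1 + (n * n + (n + i))) = (i \in V2)
    & nth 0 w (1 + (n * n + (n + n + i))) = (i \in V3)].
Proof.
split; rewrite /w /= add0n nth_cat size_encode_rel ltnNge leq_addr /= addKn.
- by rewrite nth_cat size_encode_set ltn_ord nth_encode_set.
- by rewrite !nth_cat !size_encode_set ltnNge leq_addr /= addKn ltn_ord nth_encode_set.
- rewrite -addnA nth_cat size_encode_set ltnNge leq_addr /= addKn.
  by rewrite nth_cat size_encode_set ltnNge leq_addr /= addKn nth_encode_set.
Qed.

Lemma size_instance : size w = (n * n + n * 3).+1.
Proof. by rewrite /w /= !size_cat size_encode_rel !size_encode_set; lia. Qed.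

End Instance.

Lemma executable_correct p : exists a b, forall n (G : sgraph 'I_n) V1 V2 V3,
  let w := encode_instance G V1 V2 V3 in
  exists t s, [/\ exec (executable p) (input_state w) t s, t <= a * (size w).+1 ^ b &
    if n is 0 then output s = [::] else
    exists (z : 'I_n) (m : store n),
     [/\ forall i j, m 0 i j = G i j,
         [/\ forall i j, m 1 i j = (i \in V1), forall i j, m 2 i j = (i \in V2)
           & forall i j, m 3 i j = (i \in V3)]
       & output s =
         [seq run z p m output_array i j | i <- enum 'I_n, j <- enum 'I_n]]].
Proof.
have [B pB hp] := compile_correct p 0.
pose C n := n * ((n * (1 + 3) + 7) + 3) + 7.
pose D n := 1 + ((n * (1 + 3) + 7) + (C n + (C n + (C n + (B n + (C n + 1))))) + 1).
have [a [b Dab]] : poly D by rewrite /D /C; poly_bound.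
exists a, b => n G V1 V2 V3 w.
suff [t [s [ex le_t out]]] : halts (executable p) (input_state w) (D n) (fun s =>
   if n is 0 then output s = [::] else
    exists (z : 'I_n) (m : store n),
     [/\ forall i j, m 0 i j = G i j,
         [/\ forall i j, m 1 i j = (i \in V1), forall i j, m 2 i j = (i \in V2)
           & forall i j, m 3 i j = (i \in V3)]
       & output s =
         [seq run z p m output_array i j | i <- enum 'I_n, j <- enum 'I_n]]).
  exists t, s; split=> //; apply: leq_trans le_t (leq_trans (Dab n) _).
  rewrite leq_mul2l; apply/orP; right.
  have [->|b0] := posnP b; first by rewrite !expn0.
  rewrite leq_exp2r //.
  by rewrite /w size_instance; lia.
apply: halts_seq; apply: halts_assign => //=.
rewrite addn1; apply: halts_if => /=; rewrite {1}/update /=.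
have [n0|n0] := posnP n.
  by subst n; rewrite /=; apply: halts_assign.
have dst_inj i j k l : i < n -> j < n -> k < n -> l < n ->
    n * i + j = n * k + l -> i = k /\ j = l.
  move=> ltin ltjn ltkn ltln e.
  have := @cell_inj n 0 0 i j k l ltin ltjn ltkn ltln.
  by rewrite /cell e eqxx => /esym/and3P[_ /eqP -> /eqP ->].
have by_n (X Y : Prop) : Y -> if n is 0 then X else Y by case: (n) n0.
pose z := Ordinal n0.
set s0 := State _ _.
apply: halts_seq; apply: (@halts_for n _ _ _ _
  (fun k s => [/\ reg s reg_sq = n * k, heap s =1 nth 0 w
     & forall x, x != 0 -> at_var n x z s])) => //.
- move=> k s s' us hs [i1 i2 i3]; split=> [|u|x x0].
  + by rewrite us.
  + by rewrite hs i2.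
  + by have [v1 v2] := i3 x x0; split; rewrite us //= !inE /reg_val /reg_row /reg_tmp; lia.
- split=> [|//|x x0]; rewrite ?muln0 //.
  have zero r : 2 < r -> reg s0 r = 0 by case: r => [|[|[|r]]].
  by split; rewrite ?muln0 zero // /reg_val /reg_row; lia.
- move=> k s ltkn sn vk [i1 i2 i3]; apply: halts_assign => //=; split=> //.
  split=> [|//|x x0]; first by rewrite /= i1 sn mulnS addnC.
  have [v1 v2] := i3 x x0; split; rewrite /= /update; case: eqP => //;
  by rewrite /reg_val /reg_row /reg_sq; lia.
move=> s1 [sq1 h1 v1] n1 e1 e2.
pose good (k : nat) s := [/\ reg s reg_n = n, reg s reg_sq = n * n, forall x, at_var n x z s,
   forall u, u < cell n 4 0 0 -> heap s u = nth 0 w u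
   & forall l (i j : 'I_n), 0 < l <= k -> heap s (cell n (block l) i j) =
        (i \in if l is 1 then V1 else if l is 2 then V2 else V3)].
have g1 : good 0 s1.
  split=> // [x|[|l]] //.
  case: (x =P 0) => [->|/eqP/v1 //].
  by split; rewrite ?e1 ?e2 // muln0.
have copy k e s K : good k s -> k < 3 ->
   (forall (i : 'I_n) s', at_var n 0 i s' -> reg s' reg_n = n -> reg s' reg_sq = n * n ->
      (forall u, u < cell n 4 0 0 -> heap s' u = nth 0 w u) ->
      eval s' (Get (Plus (Const 1) (Plus (Var reg_sq) (Plus e (Var (reg_val 0))))))
        = (i \in if k is 0 then V1 else if k is 1 then V2 else V3)) ->
   (forall s', good k.+1 s' -> K s') ->
   halts (copy_class k.+1 e) s (C n) K.
  move=> [q1 q2 q3 q4 q5] k3 he post.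
  pose f (i j : nat) : nat := if insub i is Some o then
     (o \in if k is 0 then V1 else if k is 1 then V2 else V3) else false.
  have far u i j : i < n -> j < n -> u < cell n 4 0 0 ->
     u != cell n (block k.+1) i j.
    move=> ltin ltjn; apply: contraTneq => ->; rewrite -leqNgt /cell /block /=.
    rewrite leq_add2l !muln0 !addn0; apply: leq_trans (leq_addr _ _).
    by rewrite leq_mul2r; apply/orP; right; lia.
  apply: (@halts_grid n _ _ _ (cell n (block k.+1)) f) => //.
  - by move=> i j i' j' ? ? ? ? /eqP; rewrite cell_inj // => /and3P[_ /eqP -> /eqP ->].
  - move=> i j s2 ltin ltjn base hs vi vj; apply: halts_store => //; split=> // u.
    have sq2 : reg s2 reg_sq = n * n by rewrite base // => e' _; apply: sq_tmp.
    have n2 : reg s2 reg_n = n by rewrite base // => e' _; apply: n_tmp.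
    have E : eval s2 (Get (Plus (Const 1)
        (Plus (Var reg_sq) (Plus e (Var (reg_val 0)))))) = f i j.
      rewrite (he (Ordinal ltin)) //; first by rewrite /f insubT.
      by move=> v lv; rewrite hs ?q4 // => *; apply: far.
    by rewrite -E -(eval_addr (block k.+1) sq2 vi vj).
  - move=> s2 ho hi hr; apply: post; split.
    + by rewrite hr // => e' _; apply: n_tmp.
    + by rewrite hr // => e' _; apply: sq_tmp.
    + by move=> x; have [w1 w2] := q3 x; split; rewrite hr // => e' _; [apply: val_tmp|apply: row_tmp].
    + by move=> u lu; rewrite ho ?q4 // => *; apply: far.
    + move=> l i j /andP[l0]; rewrite leq_eqVlt => /orP[/eqP->|lk].
        by rewrite hi // /f valK; case: (k) k3 => [|[|[]]].
      rewrite ho ?q5 ?l0 // => i' j' *; rewrite cell_inj //.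
      by apply/nandP; left; apply: contraTneq lk => /block_inj ->; rewrite ltnn.
have ltc (i : 'I_n) k : k < 3 -> 1 + (n * n + (n * k + i)) < cell n 4 0 0.
  move=> k3; rewrite /cell -addnS leq_add2l.
  have: n * k + i < n * 3 by move: (ltn_ord i); case: (k) k3 => [|[|[]]] // _; lia.
  have: n * 3 <= 3 * (n * n) by rewrite mulnC leq_mul2l leq_pmull.
  by lia.
apply: halts_seq; apply: (copy 0 (Const 0) _ _ g1) => //.
  move=> i s vi sn sq hs; have [<- _ _] := nth_instance_class G V1 V2 V3 i.
  have [vi1 _] := vi; rewrite /= vi1 sq hs //.
  by have := ltc i 0 isT; rewrite muln0.
move=> s2 g2; apply: halts_seq; apply: (copy 1 (Var reg_n) _ _ g2) => //.
  move=> i s vi sn sq hs; have [_ <- _] := nth_instance_class G V1 V2 V3 i.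
  have [vi1 _] := vi; rewrite /= vi1 sq hs sn //.
  by have := ltc i 1 isT; rewrite muln1.
move=> s3 g3; apply: halts_seq.
apply: (copy 2 (Plus (Var reg_n) (Var reg_n)) _ _ g3) => //.
  move=> i s vi sn sq hs; have [_ _ <-] := nth_instance_class G V1 V2 V3 i.
  have [vi1 _] := vi; rewrite /= vi1 sq hs sn //.
  by have := ltc i 2 isT; rewrite muln2 -addnn.
move=> s4 [g41 g42 g43 g44 g45].
pose m : store n := fun a i j => heap s4 (cell n (block a) i j).
have fm : fits m (fun=> z) s4 by split.
apply: halts_seq; apply: (halts_weak (leqnn _)) (hp _ _ _ _ fm).
move=> s5 [[f1 f2 f3 f4] _].
pose f i j := heap s5 (cell n (block output_array) i j).
apply: halts_seq.
apply: (@halts_grid n _ _ _ (fun i j => n * i + j) f) => //.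
  move=> i j s6 ltin ltjn base hs vi vj; apply: halts_store => //; split=> // u.
  have sq6 : reg s6 reg_sq = n * n by rewrite base // => e' _; apply: sq_tmp.
  have := eval_addr (block output_array) sq6 vi vj => /= ->.
  have [_ ->] := vi; have [-> _] := vj; rewrite /update; case: eqP => // _.
  rewrite hs // => k l ltkn ltln; rewrite /cell /=; apply/eqP.
  have : n * k + l < n * n by apply: cell_small.
  by lia.
move=> s6 ho hi hr; apply: halts_assign => //.
apply: by_n.
have sq6 : reg s6 reg_sq = n * n by rewrite hr // => e' _; apply: sq_tmp.
exists z, m; split.
- move=> i j; rewrite /m g44 ?nth_instance_graph //.
  rewrite /cell /= mul0n add0n !muln0 !addn0 ltn_add2l.
  have : n * i + j < n * n by apply: cell_small.
  by rewrite !mulSn; lia.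
- by split=> i j; rewrite /m g45.
rewrite /output /= {1}/update /= sq6.
apply: (@eq_from_nth _ 0); first by rewrite size_mkseq size_allpairs size_enum_ord.
rewrite size_mkseq => k ltk; rewrite nth_mkseq //.
have lti : k %/ n < n by rewrite ltn_divLR.
have ltj : k %% n < n by rewrite ltn_mod.
rewrite (divn_eq k n) mulnC hi // /f -[k %/ n]/(val (Ordinal lti)) -[k %% n]/(val (Ordinal ltj)).
rewrite f4; have := @nth_allpairs _ _ (fun i j => run z p m output_array i j)
  (enum 'I_n) (enum 'I_n) z z 0 (Ordinal lti) (Ordinal ltj).
by rewrite size_enum_ord !nth_ord_enum => ->.
Qed.

(** * Formulas and breadth-first search *)

(** A formula is a term, true when positive. *)
Definition Not c := Cond c (Lit 0) (Lit 1).
Definition And c d := Cond c (Cond d (Lit 1) (Lit 0)) (Lit 0).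
Definition Or c d := Cond c (Lit 1) (Cond d (Lit 1) (Lit 0)).
Definition Less t u := Diff u t.
Definition AtMost t u := Not (Diff t u).
Definition Exists x c := Sum x c.
Definition Count x c := Sum x (Cond c (Lit 1) (Lit 0)).
Definition Cell a := At a 0 1.
Definition Here a := At a 0 0.

Fixpoint writes p :=
  match p with
  | Let a _ => [:: a]
  | Then p q => writes p ++ writes q
  | Repeat p => writes p
  end.

Infix ";;" := Then (at level 61, right associativity).

Section Logic.
Variable n : nat.
Implicit Types (m : store n) (e : nat -> 'I_n).

Lemma test_not m e c : (0 < value m e (Not c)) = ~~ (0 < value m e c).
Proof. by rewrite /=; case: ifP. Qed.

Lemma test_and m e c d :
  (0 < value m e (And c d)) = (0 < value m e c) && (0 < value m e d).
Proof. by rewrite /=; case: ifP => //; case: ifP. Qed.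

Lemma test_or m e c d :
  (0 < value m e (Or c d)) = (0 < value m e c) || (0 < value m e d).
Proof. by rewrite /=; case: ifP => //; case: ifP. Qed.

Lemma test_less m e t u : (0 < value m e (Less t u)) = (value m e t < value m e u).
Proof. by rewrite /= subn_gt0. Qed.

Lemma test_atmost m e t u : (0 < value m e (AtMost t u)) = (value m e t <= value m e u).
Proof. by rewrite test_not /= subn_gt0 -leqNgt. Qed.

Lemma test_exists m e x c :
  (0 < value m e (Exists x c)) = [exists i, 0 < value m (bind e x i) c].
Proof.
apply/idP/existsP => [|[i ic]]; last by rewrite /= (bigD1 i) //= addn_gt0 ic.
rewrite lt0n sum_nat_eq0 negb_forall => /existsP[i].
by rewrite /= -lt0n; exists i.
Qed.

Lemma value_count m e x c :
  value m e (Count x c) = #|[set i | 0 < value m (bind e x i) c]|.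
Proof.
rewrite -sum1_card big_mkcond /=; apply: eq_bigr => i _; rewrite inE.
by case: ifP.
Qed.

Definition testE := (test_not, test_and, test_or, test_less, test_atmost, test_exists).

Lemma run_repeat z p m : run z (Repeat p) m = iter n.+2 (run z p) m.
Proof. by []. Qed.

Lemma run_then z p q m : run z (p ;; q) m = run z q (run z p m).
Proof. by []. Qed.

Lemma run_let z a t m i j : run z (Let a t) m a i j = value m (cells z i j) t.
Proof. by rewrite /= /assign eqxx. Qed.

Lemma value_cond m e c t u :
  value m e (Cond c t u) = if 0 < value m e c then value m e t else value m e u.
Proof. by []. Qed.

Lemma value_diff m e t u : value m e (Diff t u) = value m e t - value m e u.
Proof. by []. Qed.

Lemma run_repeats z p k m :
  iter k (run z (Repeat p)) m = iter (k * n.+2) (run z p) m.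
Proof. by elim: k => // k IHk; rewrite iterS run_repeat IHk -iterD mulSn. Qed.

Lemma run_frame z p m b : b \notin writes p -> run z p m b = m b.
Proof.
elim: p m => [a t|p IHp q IHq|p IHp] m.
- by rewrite /= inE /assign => /negPf->.
- by rewrite /= mem_cat negb_or => /andP[bp bq]; rewrite IHq ?IHp.
by move=> bp; rewrite run_repeat; elim: n.+2 => //= k IHk; rewrite IHp.
Qed.

Definition vset m a : {set 'I_n} := [set v | 0 < m a v v].
Definition mrel m a : rel 'I_n := fun u v => 0 < m a u v.

End Logic.

Global Opaque Not And Or Less AtMost Exists Count.
Arguments bind _ _ _ _ /.

(** The loop comes to rest before the measure is used up. *)
Lemma iter_until A (f : A -> A) (I done : A -> Prop) (mu : A -> nat) N x :
  I x -> mu x < N ->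
  (forall y, I y -> I (f y)) ->
  (forall y, I y -> done y -> done (f y)) ->
  (forall y, I y -> done y \/ mu (f y) < mu y) ->
  I (iter N f x) /\ done (iter N f x).
Proof.
move=> Ix ltN If df step.
have It k : I (iter k f x) by elim: k => //= k; apply: If.
split=> //; have: done (iter N f x) \/ mu (iter N f x) + N <= mu x.
  elim: (N) => [|k [dk|le_k]]; first by right; rewrite addn0.
    by left; apply: df (It k) dk.
  have [dk|lt_k] := step _ (It k); first by left; apply: df (It k) dk.
  by right; rewrite addnS -addSn; apply: leq_trans le_k; rewrite leq_add2r.
by case=> //; lia.
Qed.

Notation arr_graph := 0 (only parsing).
Notation arr_orient := 5 (only parsing).
Notation arr_flow := 6 (only parsing).
Notation arr_cap := 7 (only parsing).
Notation arr_stamp := 8 (only parsing).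
Notation arr_round := 9 (only parsing).
Notation arr_from := 10 (only parsing).
Notation arr_next := 11 (only parsing).
Notation arr_some := 12 (only parsing).

(** The order of the vertices decides. *)
Definition Choose b a :=
  Let b (And (Here a) (Not (Exists 2 (And (Lt 2 0) (At a 2 2))))).

Lemma choose_correct n z (m : store n) b a :
  let m' := run z (Choose b a) m in
  (vset m a = set0 /\ vset m' b = set0) \/
  exists2 v, v \in vset m a & vset m' b = [set v].
Proof.
move=> m'.
have E v : (v \in vset m' b) = (v \in vset m a) && ~~ [exists u : 'I_n, (u < v) && (u \in vset m a)].
  rewrite inE /m' /= /assign eqxx !testE /= inE; congr (_ && ~~ _).
  by apply: eq_existsb => u; rewrite !testE /= inE; case: (u < v).
have [a0|[v0 v0a]] := set_0Vmem (vset m a).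
  by left; split=> //; apply/setP=> v; rewrite E a0 inE.
right; case: (@arg_minnP _ v0 (fun v => v \in vset m a) (@nat_of_ord n) v0a) => v va minv.
exists v => //; apply/setP=> u; rewrite E in_set1.
apply/andP/eqP => [[ua nlt]|->].
  apply: val_inj; apply/eqP; rewrite eqn_leq minv // andbT leqNgt.
  by apply: contra nlt => lt; apply/existsP; exists v; rewrite lt.
split=> //; apply/existsP => -[w /andP[lt wa]].
by have := minv w wa; rewrite leqNgt lt.
Qed.

Definition Degree := Count 2 (At arr_flow 0 2).

(** Breadth-first search, backwards from the vertices with outdegree below
    their capacity, which get stamp 1. Later stamps are larger; 0 means that
    no vertex with room can be reached. *)
Definition Stamps :=
  Let arr_stamp (Cond (Less Degree (Here arr_cap)) (Lit 1) (Lit 0)) ;;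
  Let arr_round (Lit 1) ;;
  Repeat (Let arr_round (Add (Here arr_round) (Lit 1)) ;;
          Let arr_stamp (Cond (Here arr_stamp) (Here arr_stamp)
            (Cond (Exists 2 (And (At arr_flow 0 2) (At arr_stamp 2 2)))
               (Here arr_round) (Lit 0)))).

Record stamped (T : finType) (W : rel T) (cap st : T -> nat) : Prop := Stamped {
  stamp_slack : forall u, (st u == 1) = (out W u < cap u);
  stamp_next : forall u, 1 < st u -> exists2 v, W u v & 0 < st v < st u;
  stamp_zero : forall u v, W u v -> st u = 0 -> st v = 0
}.

Section Flow.
Variables (n : nat) (z : 'I_n).
Implicit Types m : store n.

Definition diag m a : 'I_n -> nat := fun v => m a v v.

Lemma value_degree m e : value m e Degree = out (mrel m arr_flow) (e 0).
Proof. by rewrite value_count; apply: eq_card => i; rewrite !inE. Qed.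

Lemma card_lt (A : {set 'I_n}) : #|A| < n.+2.
Proof. by have := max_card A; rewrite card_ord ltnS => /leqW. Qed.

(** Every round stamps a new vertex or is the last to change anything. *)
Lemma stamps_correct m :
  stamped (mrel m arr_flow) (diag m arr_cap) (diag (run z Stamps m) arr_stamp).
Proof.
rewrite /Stamps; set body := (X in Repeat X).
set W := mrel m arr_flow; set cap := diag m arr_cap.
set m1 := run z (Let arr_round (Lit 1))
  (run z (Let arr_stamp (Cond (Less Degree (Here arr_cap)) (Lit 1) (Lit 0))) m).
rewrite -[run z _ m]/(iter n.+2 (run z body) m1).
pose I m' := [/\ mrel m' arr_flow = W,
  forall u, (diag m' arr_stamp u == 1) = (out W u < cap u),
  forall u, 1 < diag m' arr_stamp u ->
     exists2 v, W u v & 0 < diag m' arr_stamp v < diag m' arr_stamp u,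
  forall u, diag m' arr_stamp u <= m' arr_round u u
  & exists2 r, 0 < r & forall u v, m' arr_round u v = r].
pose done m' := forall u v, W u v -> diag m' arr_stamp u = 0 -> diag m' arr_stamp v = 0.
pose mu m' := #|[set u | diag m' arr_stamp u == 0]|.
have bodyE m' : I m' -> let r := m' arr_round z z in
    forall u, diag (run z body m') arr_stamp u =
     if 0 < diag m' arr_stamp u then diag m' arr_stamp u else
     if [exists v, W u v && (0 < diag m' arr_stamp v)] then r.+1 else 0.
  move=> [Wm _ _ _ [r r0 rE]] r' u; rewrite /r' rE /diag /= /assign /= !testE /= rE.
  case: ifP => //= _; rewrite addn1.
  by congr (if _ then _ else _); apply: eq_existsb => v; rewrite !testE /= -Wm.
have [] := @iter_until _ (run z body) I done mu n.+2 m1.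
- split=> // [u|u||]; last by exists 1.
  + rewrite /diag /m1 /= /assign /= test_less value_degree /=.
    by case: ifP.
  + by rewrite /diag /m1 /= /assign /=; case: ifP.
  + by move=> u; rewrite /diag /m1 /= /assign /=; case: ifP.
- exact: card_lt.
- move=> m' Im; have E := bodyE _ Im.
  have [Wm one nxt le_r [r r0 rE]] := Im; rewrite /= rE in E.
  have rE' u v : run z body m' arr_round u v = r.+1.
    by rewrite /= /assign /= rE addn1.
  have pos u : 0 < diag m' arr_stamp u ->
      diag (run z body m') arr_stamp u = diag m' arr_stamp u.
    by move=> h; rewrite E h.
  split=> // [u|u|u|].
  + rewrite E; case: ifP => h; first exact: one.
    rewrite -one; move: h; case: (diag _ _ u) => // _.
    by case: ifP => //; move: r0; case: (r).
  + rewrite E; case: ifP => [h|_].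
      by case/nxt => v wv /andP[v0 lt]; exists v => //; rewrite pos ?v0.
    case: ifP => // /existsP[v /andP[wv v0]] _; exists v => //.
    by rewrite pos // v0 ltnS; have := le_r v; rewrite rE.
  + rewrite E rE'; case: ifP => _; first by have := le_r u; rewrite rE => /leqW.
    by case: ifP.
  + by exists r.+1.
- move=> m' Im dm u v wuv; have E := bodyE _ Im; rewrite !E.
  case: (posnP (diag m' arr_stamp u)) => [u0|upos] /=; last by move=> u0; rewrite u0 in upos.
  have v0 := dm _ _ wuv u0.
  rewrite v0 ltnn; case: ifP => // hu _; case: ifP => // /existsP[w /andP[wvw w0]].
  by rewrite (dm _ _ wvw v0) in w0.
- move=> m' Im; have E := bodyE _ Im.
  case: (boolP [exists u, (diag m' arr_stamp u == 0) &&
                 [exists v, W u v && (0 < diag m' arr_stamp v)]]) => [|none].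
    case/existsP=> u /andP[u0 ex]; right; apply: proper_card; apply/properP; split.
      apply/subsetP=> v; rewrite !inE E; case: ifP => //.
      by case: (diag m' _ v).
    by exists u; rewrite !inE ?u0 // E (eqP u0) ex.
  left=> u v wuv u0; apply/eqP; rewrite -leqn0 leqNgt; apply: contra none => v0.
  by apply/existsP; exists u; rewrite u0; apply/existsP; exists v; rewrite wuv.
set m2 := iter _ _ _ => -[_ one nxt _ _] dn.
by split=> //; apply: dn.
Qed.

End Flow.

(** * Reversing paths *)

Definition reverse (T : finType) (W : rel T) (c u : T) : rel T :=
  fun i j => (i == u) && (j == c) || W i j && ~~ ((i == c) && (j == u)).

Section Reverse.
Variables (T : finType) (W : rel T) (c u : T).
Hypotheses (Wcu : W c u) (nWuc : ~~ W u c).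

Lemma reverse_neq : c != u.
Proof. by apply: contraNneq nWuc => e; move: Wcu; rewrite e. Qed.

Lemma reverse_reorients : reorients W (reverse W c u).
Proof.
move=> i j; rewrite /reverse.
have h1 x : ~~ ((x == u) && (x == c)).
  by apply/negP=> /andP[/eqP-> /eqP e]; move: reverse_neq; rewrite e eqxx.
have h2 x y : (x == u) && (y == c) -> ~~ W x y && W y x.
  by case/andP=> /eqP-> /eqP->; rewrite Wcu nWuc.
move: (h1 i) (h1 j) (h2 i j) (h2 j i).
case: (i == u); case: (i == c); case: (j == u); case: (j == c);
by case: (W i j); case: (W j i) => //= _ _ H H'; first [have := H isT | have := H' isT].
Qed.

Lemma reverse_out v : out (reverse W c u) v + (v == c) = out W v + (v == u).
Proof.
have cu := reverse_neq.
rewrite !out_sum.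
have [->|vc] := eqVneq v c.
  rewrite (negPf cu) addn0 (bigD1 u) //= [RHS](bigD1 u) //= Wcu.
  rewrite /reverse !eqxx (negPf cu) andbF /= addnC; congr (_ + _).
  by apply: eq_bigr => j ju; rewrite (negPf ju) !andbT.
have [->|vu] := eqVneq v u; last first.
  by congr (_ + _); apply: eq_bigr => j _; rewrite /reverse (negPf vc) (negPf vu) andbT.
rewrite addn0 (bigD1 c) //= [in RHS](bigD1 c) //= (negPf nWuc).
rewrite /reverse !eqxx add0n addnC; congr (_ + _).
by apply: eq_bigr => j jc; rewrite (negPf jc) (eq_sym u) (negPf cu) andbT.
Qed.

Lemma reverse_other i j : (i != c) || (j != u) -> (i != u) || (j != c) ->
  reverse W c u i j = W i j.
Proof.
rewrite /reverse; case: (i == c); case: (j == u); case: (i == u); case: (j == c) => //= _ _;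
by rewrite ?andbT.
Qed.

End Reverse.

Lemma out_ext (T : finType) (W W' : rel T) v : W =2 W' -> out W v = out W' v.
Proof. by move=> e; apply: eq_card => u; rewrite !inE e. Qed.

(** The walk stands at the single member of [arr_from] and looks for an edge
    to a smaller stamp. *)
Definition Descents :=
  Let arr_some (Exists 2 (And (At arr_from 2 2) (And (At arr_flow 2 0)
    (And (Here arr_stamp) (Less (Here arr_stamp) (At arr_stamp 2 2)))))).

Definition Turn :=
  Let arr_flow (Or (And (At arr_next 0 0) (At arr_from 1 1))
    (And (Cell arr_flow) (Not (And (At arr_from 0 0) (At arr_next 1 1))))).

Definition Advance :=
  Let arr_from (Cond (Exists 2 (At arr_next 2 2)) (Here arr_next) (Here arr_from)).

Definition Step := Descents ;; Choose arr_next arr_some ;; Turn ;; Advance.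

Definition Sources := Let arr_some (And (Less (Here arr_cap) Degree) (Here arr_stamp)).

Definition Walk := Sources ;; Choose arr_from arr_some ;; Repeat Step.

(** A walk from a vertex in excess lowers the total excess, which is at most
    [n * n]. *)
Definition Route := Repeat (Repeat (Stamps ;; Walk)) ;; Stamps.

Section Walk.
Variables (n : nat) (z : 'I_n).
Implicit Types m : store n.

Lemma step_none m : vset m arr_from = set0 ->
  vset (run z Step m) arr_from = set0 /\ mrel (run z Step m) arr_flow =2 mrel m arr_flow.
Proof.
move=> f0; have f0' i : m arr_from i i = 0.
  by apply/eqP; have := in_set0 i; rewrite -f0 inE; case: (m _ i i).
set m1 := run z Descents m; set m2 := run z (Choose arr_next arr_some) m1.
have [from2 flow2] : m2 arr_from = m arr_from /\ m2 arr_flow = m arr_flow.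
  by rewrite /m2 /m1 !run_frame.
have s0 : vset m1 arr_some = set0.
  apply/setP=> i; rewrite !inE /m1 /= /assign /= testE; apply/existsP => -[j].
  by rewrite !testE /= f0'.
have n0 : vset m2 arr_next = set0.
  have := choose_correct z m1 arr_next arr_some; rewrite -/m2 s0.
  by case=> [[]|[v]] //; rewrite inE.
have n0' i : m2 arr_next i i = 0.
  by apply/eqP; have := in_set0 i; rewrite -n0 inE; case: (m2 _ i i).
rewrite -[run z Step m]/(run z Advance (run z Turn m2)); clearbody m2; split.
  apply/setP=> i; rewrite !inE /= /assign /= testE ifF ?from2 ?f0' //.
  by apply/existsP => -[j] /=; rewrite n0'.
move=> i j; rewrite /mrel /= /assign /= !testE /=.
by rewrite !n0' from2 !f0' flow2 /= ?andbT.
Qed.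

Lemma step_some m c : vset m arr_from = [set c] ->
  let m' := run z Step m in
  let W := mrel m arr_flow in let st := diag m arr_stamp in
  ([/\ vset m' arr_from = [set c], mrel m' arr_flow =2 W
     & forall u, W c u -> 0 < st u -> st c <= st u]) \/
  (exists u, [/\ vset m' arr_from = [set u], mrel m' arr_flow =2 reverse W c u,
     W c u & 0 < st u < st c]).
Proof.
move=> fc m' W st.
have fc' i : (0 < m arr_from i i) = (i == c).
  by have := in_set1 i c; rewrite -fc inE.
set m1 := run z Descents m; set m2 := run z (Choose arr_next arr_some) m1.
have [from2 flow2] : m2 arr_from = m arr_from /\ m2 arr_flow = m arr_flow.
  by rewrite /m2 /m1 !run_frame.
have m'E : m' = run z Advance (run z Turn m2) by [].
have someE u : (u \in vset m1 arr_some) = W c u && (0 < st u < st c).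
  rewrite inE /m1 /= /assign /= testE; apply/existsP/idP => [[j]|h].
    rewrite !testE /= fc' => /and4P[/eqP ej w1 w2 w3]; subst j.
    by apply/and3P; split.
  by exists c; rewrite !testE /= fc' eqxx /=; case/and3P: h => *; apply/and3P; split.
have := choose_correct z m1 arr_next arr_some; rewrite -/m2 => next2.
clearbody m2 m'.
have flowE i j : mrel m' arr_flow i j =
   (0 < m2 arr_next i i) && (j == c) || W i j && ~~ ((i == c) && (0 < m2 arr_next j j)).
  by rewrite m'E /mrel /= /assign /= !testE /= from2 flow2 !fc'.
have [[s0 n0]|[u us nu]] := next2.
  have n0' i : m2 arr_next i i = 0.
    by apply/eqP; have := in_set0 i; rewrite -n0 inE; case: (m2 _ i i).
  left; split.
  - apply/setP=> i; rewrite !inE m'E /= /assign /= testE ifF ?from2 ?fc' //.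
    by apply/existsP => -[j] /=; rewrite n0'.
  - by move=> i j; rewrite flowE !n0' andbF andbT.
  - move=> u wcu u0; rewrite leqNgt; apply/negP => lt.
    by have := in_set0 u; rewrite -s0 someE wcu u0 lt.
have nu' i : (0 < m2 arr_next i i) = (i == u).
  by have := in_set1 i u; rewrite -nu inE.
right; exists u; move: us; rewrite someE => /andP[wcu lt]; split=> //.
- apply/setP=> i; rewrite !inE m'E /= /assign /= testE ifT ?nu' //.
  by apply/existsP; exists u; rewrite /= nu'.
- by move=> i j; rewrite flowE !nu'.
Qed.

Definition asym (W : rel 'I_n) := forall i j, W i j -> ~~ W j i.

Lemma reorients_asym (W W' : rel 'I_n) : asym W -> reorients W W' -> asym W'.
Proof.
move=> aW re i j wij; apply/negP => wji; have := re i j; rewrite wij wji.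
case: (boolP (W i j)) => [/aW/negPf->|] //; by case: (W j i).
Qed.

Definition excess (W : rel 'I_n) (cap : 'I_n -> nat) := \sum_v (out W v - cap v).

(** The walk reverses edges from larger to smaller stamps only, and none of
    them below its current vertex. So the stamps still show the way down to
    a vertex with room. *)
Lemma walk_correct m : asym (mrel m arr_flow) ->
  stamped (mrel m arr_flow) (diag m arr_cap) (diag m arr_stamp) ->
  let m' := run z Walk m in let W := mrel m arr_flow in let cap := diag m arr_cap in
  let st := diag m arr_stamp in
  [/\ mrel m' arr_flow =2 W & forall v, 0 < st v -> out W v <= cap v] \/
  [/\ exists2 v, 0 < st v & cap v < out W v, reorients W (mrel m' arr_flow)
   & excess (mrel m' arr_flow) cap < excess W cap].
Proof.
move=> aW sW m' W cap st.
set m1 := run z Sources m.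
set m2 := run z (Choose arr_from arr_some) m1.
have m'E : m' = iter n.+2 (run z Step) m2 by [].
have someE u : (u \in vset m1 arr_some) = (cap u < out W u) && (0 < st u).
  by rewrite inE /m1 /= /assign /= !testE value_degree.
have Wm2 : m2 arr_flow = m arr_flow by rewrite /m2 /m1 !run_frame.
have sm2 : m2 arr_stamp = m arr_stamp by rewrite /m2 /m1 !run_frame.
have := choose_correct z m1 arr_from arr_some; rewrite -/m2 => start.
clearbody m' m1 m2.
have [[s0 f0]|[s ss fs]] := start.
  left; split.
    have still k : vset (iter k (run z Step) m2) arr_from = set0 /\
        mrel (iter k (run z Step) m2) arr_flow =2 W.
      elim: k => [|k [f w]]; first by split=> // i j; rewrite /= /mrel Wm2.
      by have [f1 w1] := step_none f; split=> // i j; rewrite w1 w.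
    by rewrite m'E; have [] := still n.+2.
  move=> v v0; rewrite leqNgt; apply/negP => lt.
  by have := in_set0 v; rewrite -s0 someE lt v0.
move: ss; rewrite someE => /andP[exs s0]; right.
pose I m3 := [/\ m3 arr_stamp = m arr_stamp & exists c, [/\ vset m3 arr_from = [set c], 0 < st c,
    reorients W (mrel m3 arr_flow),
    forall v, out (mrel m3 arr_flow) v + (v == s) = out W v + (v == c)
    & forall i j, (st j < st c) -> mrel m3 arr_flow i j = W i j /\ mrel m3 arr_flow j i = W j i]].
pose done m3 := forall c, vset m3 arr_from = [set c] -> st c = 1.
pose mu m3 := #|[set v | (0 < st v) && [exists c in vset m3 arr_from, st v < st c]]|.
have Ikeep m3 m4 c : vset m3 arr_from = [set c] -> vset m4 arr_from = [set c] ->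
    m4 arr_stamp = m3 arr_stamp -> mrel m4 arr_flow =2 mrel m3 arr_flow -> I m3 -> I m4.
  move=> f3 f4 es ew [e3 [c' [f3' c0 re o3 k3]]]; have {f3'} e : c' = c.
    by apply/set1P; rewrite -f3 f3' set11.
  subst c'; split; first by rewrite es.
  exists c; split=> // [i j|v|i j lt]; first by rewrite !ew.
    by rewrite (out_ext _ ew).
  by rewrite !ew; apply: k3.
have inv3 m3 : I m3 -> (exists c, vset (run z Step m3) arr_from = [set c] /\
    vset m3 arr_from = [set c] /\ st c = 1 /\ I (run z Step m3)) \/
    (exists c u, [/\ vset m3 arr_from = [set c], vset (run z Step m3) arr_from = [set u],
         0 < st u < st c & I (run z Step m3)]).
  move=> I3; have [e3 [c [f3 c0 re3 o3 k3]]] := I3.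
  have st3 : diag m3 arr_stamp = st by rewrite /diag e3.
  have es : run z Step m3 arr_stamp = m3 arr_stamp by rewrite run_frame.
  have := step_some f3; rewrite st3; case=> [[f4 w4 low]|[u [f4 w4 wcu lt]]].
    left; exists c; split=> //; split=> //; split; last exact: (Ikeep _ _ c f3 f4 es w4 I3).
    apply/eqP; rewrite eqn_leq c0 andbT leqNgt; apply/negP => c1.
    have [v wcv /andP[v0 lt]] := stamp_next sW c1.
    have wcv3 : mrel m3 arr_flow c v by rewrite (proj1 (k3 c v lt)).
    by have := low v wcv3 v0; rewrite leqNgt => /negP[].
  right; exists c, u; split=> //; split; first by rewrite es.
  have nwuc : ~~ mrel m3 arr_flow u c by apply: (reorients_asym aW re3).
  have [u0 ltu] := andP lt.
  exists u; split=> //.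
  - move=> i j; rewrite !w4 -re3; exact: reverse_reorients.
  - move=> v; have := reverse_out wcu nwuc v; rewrite -(out_ext v w4) => e4.
    by apply/eqP; rewrite -(eqn_add2r (v == c)) addnAC e4 addnAC o3 addnAC.
  - move=> i j ltj; have [ju jc] : j != u /\ j != c.
      by split; apply: contraTneq ltj => ->; rewrite -leqNgt // ltnW.
    by rewrite !w4 !reverse_other ?ju ?jc ?orbT //; apply: k3; apply: ltn_trans ltu.
have [] : I m' /\ done m'.
rewrite m'E; apply: (@iter_until _ (run z Step) I done mu n.+2 m2).
- split; first exact: sm2.
  have mW : mrel m2 arr_flow = W by rewrite /mrel Wm2.
  by exists s; rewrite mW; split.
- exact: card_lt.
- move=> m3 I3; case: (inv3 m3 I3) => [[c [_ [_ [_ h]]]]|[c [u [_ _ _ h]]]]; exact: h.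
- move=> m3 I3 d3; case: (inv3 _ I3) => [[c [f4 [_ [c1 _]]]]|[c [u [f3 f4 lt _]]]].
    by move=> c'; rewrite f4 => e; have -> : c' = c by apply/set1P; rewrite e set11.
  by move: lt; rewrite (d3 c f3); lia.
- move=> m3 I3; case: (inv3 _ I3) => [[c [_ [f3 [c1 _]]]]|[c [u [f3 f4 lt _]]]].
    by left=> c'; rewrite f3 => e; have -> : c' = c by apply/set1P; rewrite e set11.
  right; apply: proper_card; have [u0 ltu] := andP lt; apply/properP; split.
    apply/subsetP=> v; rewrite !inE => /andP[-> /exists_inP[w]].
    rewrite f4 => /set1P-> lt'; apply/exists_inP; exists c; first by rewrite f3 set11.
    exact: ltn_trans ltu.
  exists u; first by rewrite inE u0; apply/exists_inP; exists c; rewrite // f3 set11.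
  by rewrite inE negb_and; apply/orP; right; apply/exists_inP => -[w]; rewrite f4 => /set1P->; rewrite ltnn.
move=> [e' [c [f' c0 re' o' k']]] d'; split=> //; first by exists s.
have c1 := d' c f'; have slack : out W c < cap c by rewrite -(stamp_slack sW) -/st c1.
have sc : s != c by apply: contraTneq exs => ->; rewrite -leqNgt ltnW.
rewrite /excess (bigD1 s) // [X in _ < X](bigD1 s) //= -addSn; apply: leq_add.
  by have := o' s; rewrite eqxx (negPf sc); move: exs; lia.
apply: leq_sum => v vs; have := o' v; rewrite (negPf vs) addn0 => ->.
by case: eqP => [->|_]; rewrite ?addn0 //; move: slack; lia.
Qed.

Lemma stamped_ext (W W' : rel 'I_n) cap st : W =2 W' -> stamped W cap st -> stamped W' cap st.
Proof.
move=> e [s1 s2 s3]; split=> [u|u /s2[v wv lt]|u v].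
- by rewrite -(out_ext _ e).
- by exists v; rewrite // -e.
by rewrite -e; apply: s3.
Qed.

Lemma stamped_pos (W : rel 'I_n) cap st st' v : stamped W cap st -> stamped W cap st' ->
  0 < st v -> 0 < st' v.
Proof.
move=> s s'; have [k] := ubnP (st v); elim: k v => // k IHk v ltk v0.
have [v1|v1] := leqP (st v) 1.
  have : st v == 1 by rewrite eqn_leq v1.
  by rewrite (stamp_slack s) -(stamp_slack s') => /eqP->.
have [u wvu /andP[u0 lt]] := stamp_next s v1.
have : 0 < st' u by apply: IHk => //; apply: leq_trans lt _.
by apply: contraTltn; rewrite leqn0 => /eqP e; rewrite -leqNgt leqn0 (stamp_zero s' wvu).
Qed.

Lemma route_correct m : asym (mrel m arr_flow) ->
  let m' := run z Route m in let W := mrel m' arr_flow in let cap := diag m arr_cap in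
  let U := [set v | diag m' arr_stamp v == 0] in
  [/\ reorients (mrel m arr_flow) W, closed_in W U,
      forall v, v \in U -> cap v <= out W v & forall v, v \notin U -> out W v <= cap v].
Proof.
move=> aW m' W cap U.
set body := Stamps ;; Walk.
set m2 := iter (n.+2 * n.+2) (run z body) m.
have m'E : m' = run z Stamps m2.
  by rewrite /m' /Route run_then run_repeat run_repeats.
have m2E : m2 = iter (n.+2 * n.+2) (run z body) m := erefl.
rewrite {}/W {}/U; clearbody m' m2.
pose I m3 := m3 arr_cap = m arr_cap /\ reorients (mrel m arr_flow) (mrel m3 arr_flow).
pose done m3 := forall st, stamped (mrel m3 arr_flow) cap st ->
  forall v, 0 < st v -> out (mrel m3 arr_flow) v <= cap v.
pose mu m3 := excess (mrel m3 arr_flow) cap.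
have inv m3 : I m3 -> I (run z body m3) /\
   ((done m3 /\ mrel (run z body m3) arr_flow =2 mrel m3 arr_flow) \/
    (~ done m3 /\ mu (run z body m3) < mu m3)).
  move=> [ec re3]; have s3 := stamps_correct z m3.
  set m4 := run z Stamps m3 in s3.
  have e4 : m4 arr_flow = m3 arr_flow by rewrite /m4 run_frame.
  have c4 : m4 arr_cap = m3 arr_cap by rewrite /m4 run_frame.
  have w4 : mrel m4 arr_flow = mrel m3 arr_flow by rewrite /mrel e4.
  have d4 : diag m4 arr_cap = diag m3 arr_cap by rewrite /diag c4.
  have cap3 : diag m3 arr_cap = cap by rewrite /diag ec.
  have bE : run z body m3 = run z Walk m4 by rewrite /body run_then; reflexivity.
  have eb : run z Walk m4 arr_cap = m arr_cap.
    by rewrite run_frame; first exact: etrans c4 ec.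
  rewrite {}bE.
  have := @walk_correct m4; rewrite w4 d4 cap3.
  rewrite cap3 in s3; move=> /(_ (reorients_asym aW re3) s3).
  move: (run z Walk m4) eb => m5 eb.
  case=> [[wb small]|[[v v0 ltv] reb lt]].
    split; first by split=> // i j; rewrite !wb.
    left; split=> // st sst v v0; apply: small; exact: (stamped_pos sst s3 v0).
  split; first by split=> // i j; rewrite reb re3.
  right; split=> // dn.
  by have := dn _ s3 v v0; rewrite leqNgt ltv.
have [] : I m2 /\ done m2.
rewrite m2E; apply: (@iter_until _ (run z body) I done mu (n.+2 * n.+2) m).
- by split.
- rewrite /mu /excess; apply: (@leq_ltn_trans (\sum_(v < n) n)).
    apply: leq_sum => v _; apply: leq_trans (leq_subr _ _) _.
    by apply: leq_trans (max_card _) _; rewrite card_ord.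
  by rewrite sum_nat_const card_ord; nia.
- move=> m3 I3; exact: (proj1 (inv m3 I3)).
- move=> m3 /inv[_ [[dn e]|[ndn _]]] // dn3 st sst v v0.
  by rewrite (out_ext v e); apply: dn v0; apply: stamped_ext sst.
- by move=> m3 /inv[_ [[dn _]|[_ lt]]]; [left|right].
move=> [ec re] dn; have := stamps_correct z m2; rewrite -m'E.
have W' : mrel m' arr_flow = mrel m2 arr_flow.
  have F : m' arr_flow = m2 arr_flow by rewrite m'E run_frame.
  by rewrite /mrel F.
have -> : diag m2 arr_cap = cap by rewrite /diag ec.
rewrite W' => s2; split=> // [u v|v|v].
- by rewrite !inE => /eqP u0 wuv; apply/eqP; apply: (stamp_zero s2 wuv u0).
- by rewrite inE => /eqP v0; rewrite leqNgt -(stamp_slack s2) v0.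
by rewrite inE -lt0n; apply: (dn _ s2).
Qed.

End Walk.

(** * The starting orientation and the degree bound *)

Notation arr_k := 13 (only parsing).
Notation arr_d := 14 (only parsing).

(** [arr_k] is the current guess for [k]. *)
Definition Try :=
  Let arr_flow (And (Cell arr_graph) (Lt 0 1)) ;; Let arr_cap (Here arr_k) ;; Route.

Definition Raise :=
  Let arr_k (Add (Here arr_k) (Cond (Exists 3 (Less (At arr_cap 3 3)
    (Count 2 (At arr_flow 3 2)))) (Lit 1) (Lit 0))).

(** The density is not part of the input, so [k] is raised until all excess
    disappears. Capacities that are too small remain infeasible, by
    [settled_caps], and so are never taken for sufficient. *)
Definition Balance :=
  Let arr_k (Lit 0) ;; Repeat (Try ;; Raise) ;; Try ;; Let arr_orient (Cell arr_flow).

Definition Same x y :=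
  Or (And (At 1 x x) (At 1 y y)) (Or (And (At 2 x x) (At 2 y y)) (And (At 3 x x) (At 3 y y))).

Definition Own x := Count 2 (And (At arr_graph x 2) (Same x 2)).

Definition Widen :=
  Let arr_d (Add (Here arr_d) (Cond (Exists 3 (Less (At arr_d 3 3) (Own 3))) (Lit 1) (Lit 0))).

(** The degree bound is not part of the input either; the actual maximum is
    found by counting up. *)
Definition Spread := Let arr_d (Lit 0) ;; Repeat Widen.

Section Search.
Variables (n : nat) (z : 'I_n) (G : sgraph 'I_n).
Implicit Types m : store n.

Definition const m a x := forall i j, m a i j = x.

Definition upward : rel 'I_n := fun i j => G i j && (i < j).

Lemma upward_orients : orients G upward.
Proof.
move=> i j; rewrite /upward (edge_sym G j i); case gij: (G i j) => //=.
by case: ltngtP => // /val_inj e; rewrite e edge_irr in gij.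
Qed.

Lemma try_correct m k : mrel m arr_graph =2 G -> const m arr_k k ->
  let m' := run z Try m in
  exists U, [/\ reorients upward (mrel m' arr_flow), closed_in (mrel m' arr_flow) U,
    forall v, v \in U -> k <= out (mrel m' arr_flow) v,
    forall v, v \notin U -> out (mrel m' arr_flow) v <= k &
    const m' arr_cap k].
Proof.
move=> mG mk.
set m1 := run z (Let arr_cap (Here arr_k)) (run z (Let arr_flow (And (Cell arr_graph) (Lt 0 1))) m).
have W1 : mrel m1 arr_flow =2 upward.
  move=> i j; rewrite /mrel /m1 /= /assign /= testE /= /upward -mG.
  by rewrite lt0b.
have K1 : const m1 arr_cap k by move=> i j; rewrite /m1 /= /assign /= mk.
have -> : run z Try m = run z Route m1 by rewrite /Try !run_then; reflexivity.
have asym1 : asym (mrel m1 arr_flow).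
  by move=> i j; rewrite !W1 => h; exact: (orients_asym upward_orients h).
have cap' : run z Route m1 arr_cap = m1 arr_cap by rewrite run_frame.
have [] := route_correct z asym1; move: (run z Route m1) cap' => m2 cap2 re cl c1 c2.
have k1 v : diag m1 arr_cap v = k by rewrite /diag K1.
exists [set v | diag m2 arr_stamp v == 0]; split=> //.
- by move=> i j; rewrite re !W1.
- by move=> v /c1; rewrite k1.
- by move=> v /c2; rewrite k1.
by move=> i j; rewrite cap2 K1.
Qed.

Lemma balance_correct m : mrel m arr_graph =2 G -> let m' := run z Balance m in
  exists k, [/\ const m' arr_k k, orients G (mrel m' arr_orient),
    forall v, out (mrel m' arr_orient) v <= k, k <= n &
    forall k', (mad G <= (2 * k')%:R)%R -> k <= k'].
Proof.
move=> mG.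
set m1 := run z (Let arr_k (Lit 0)) m; set body := Try ;; Raise.
pose m2 := iter n.+2 (run z body) m1.
have -> : run z Balance m = run z (Let arr_orient (Cell arr_flow)) (run z Try m2).
  by rewrite /Balance !run_then run_repeat; reflexivity.
pose I m3 := m3 arr_graph = m arr_graph /\ exists2 k, const m3 arr_k k &
  k <= n /\ forall k', (mad G <= (2 * k')%:R)%R -> k <= k'.
pose done m3 := exists2 W, reorients upward W & forall v, out W v <= m3 arr_k z z.
pose mu m3 := n - m3 arr_k z z.
have inv m3 : I m3 -> I (run z body m3) /\
    ((done m3 /\ m3 arr_k z z = run z body m3 arr_k z z) \/
     (~ done m3 /\ mu (run z body m3) < mu m3)).
  move=> [gE [k kE [kn kmin]]].
  have mG3 : mrel m3 arr_graph =2 G by move=> i j; rewrite /mrel gE; apply: mG.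
  have bE : run z body m3 = run z Raise (run z Try m3) by rewrite /body run_then; reflexivity.
  have g4 : run z Try m3 arr_graph = m arr_graph by rewrite run_frame.
  have k4 : run z Try m3 arr_k = m3 arr_k by rewrite run_frame.
  have [U [re cl c1 c2 c3]] := try_correct mG3 kE.
  rewrite /mu /done /I {}bE; move: (run z Try m3) g4 k4 re cl c1 c2 c3 => m4 g4 k4 re cl c1 c2 c3.
  have kR i j : run z Raise m4 arr_k i j = k + [exists v, k < out (mrel m4 arr_flow) v].
    rewrite /= /assign /= testE k4 kE; congr (_ + _).
    have -> : [exists i0, 0 < value m4 (fun y => if y == 3 then i0 else cells z i j y)
        (Less (At arr_cap 3 3) (Count 2 (At arr_flow 3 2)))] =
        [exists v, k < out (mrel m4 arr_flow) v].
      apply: eq_existsb => v; rewrite testE value_count /= c3.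
      by congr (_ < _); apply: eq_card => u; rewrite !inE.
    by case: ifP.
  have gR : run z Raise m4 arr_graph = m4 arr_graph by rewrite run_frame.
  move: (run z Raise m4) kR gR => m5 kR gR; rewrite !kR kE.
  have [/existsP[v ltv]|nex] := boolP [exists v, k < out (mrel m4 arr_flow) v].
    have ltn : k < n.
      by apply: leq_trans ltv _; apply: leq_trans (max_card _) _; rewrite card_ord.
    have ndone : ~ exists2 W, reorients upward W & forall v, out W v <= k.
      case=> W reW outW; have := settled_caps (cap := fun=> k) reW outW re cl c1 c2 v.
      by rewrite leqNgt ltv.
    split; last by right; split=> //; rewrite addn1; lia.
    split; first exact: etrans gR g4.
    exists (k + 1); first by move=> i j; rewrite kR; congr (_ + _); apply/eqP; rewrite eqb1; apply/existsP; exists v.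
    split=> [|k' mk']; first by rewrite addn1.
    rewrite addn1 ltn_neqAle kmin // andbT; apply: contraTneq ltv => e; subst k'.
    rewrite -leqNgt; exact: (balanced_orientation mk' upward_orients re cl c1 c2).
  have okk v : out (mrel m4 arr_flow) v <= k.
    by rewrite leqNgt; apply: contra nex => ltv; apply/existsP; exists v.
  split; last by left; split; [exists (mrel m4 arr_flow)|rewrite addn0].
  split; first exact: etrans gR g4.
  by exists k => // i j; rewrite kR (negPf nex) addn0.
have [] : I m2 /\ done m2.
  rewrite /m2; apply: (@iter_until _ (run z body) I done mu).
  - split; first by rewrite /m1 run_frame.
    by exists 0 => // i j; rewrite /m1 /= /assign.
  - by rewrite /mu; lia.
  - by move=> m3 I3; exact: (proj1 (inv m3 I3)).
  - move=> m3 I3 d3; have [_ [[_ e]|[nd _]]] := inv m3 I3; last by [].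
    by have [W reW outW] := d3; exists W => // v; rewrite -e.
  - by move=> m3 I3; have [_ [[d _]|[_ lt]]] := inv m3 I3; [left|right].
clearbody m2; move=> [gE [k kE [kn kmin]]] [W reW]; rewrite kE => outW.
have mG2 : mrel m2 arr_graph =2 G by move=> i j; rewrite /mrel gE; apply: mG.
have k3 : run z Try m2 arr_k = m2 arr_k by rewrite run_frame.
have [U [re cl c1 c2 c3]] := try_correct mG2 kE.
move: (run z Try m2) k3 re cl c1 c2 c3 => m3 k3 re cl c1 c2 c3 m'.
have W' : mrel m' arr_orient = mrel m3 arr_flow by [].
exists k; rewrite W'; split=> //.
- by move=> i j; rewrite /m' /= /assign /= k3 kE.
- by move=> i j; rewrite re; apply: upward_orients.
by move=> v; apply: (settled_caps (cap := fun=> k) reW outW re cl c1 c2).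
Qed.

Variable cl : 'I_n -> 'I_3.
(** Array [c.+1] holds class [c]. *)
Definition classed m := forall (c : 'I_3) v, (0 < m c.+1 v v) = (cl v == c).

Lemma test_same m e x y : classed m -> (0 < value m e (Same x y)) = (cl (e x) == cl (e y)).
Proof.
move=> mc; rewrite /Same !testE /=.
have c0 := mc ord0; have c1 := mc (lift ord0 ord0); have c2 := mc ord_max.
rewrite /= /bump /= ?addn0 ?addn1 in c0 c1 c2; rewrite !c0 !c1 !c2.
by case: (cl (e x)) => [[|[|[|?]]] ?] //; case: (cl (e y)) => [[|[|[|?]]] ?].
Qed.

#[global] Opaque Same.

Lemma value_own m e x : mrel m arr_graph =2 G -> classed m -> x != 2 ->
  value m e (Own x) = nb G (e x) (own cl (e x)).
Proof.
move=> mG mc x2; rewrite value_count; apply: eq_card => u.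
rewrite inE test_and test_same //= (negPf x2) !inE eq_sym andbC.
by congr (_ && _); apply: mG.
Qed.

Lemma spread_correct m : mrel m arr_graph =2 G -> classed m -> let m' := run z Spread m in
  exists d, [/\ const m' arr_d d, forall v, nb G v (own cl v) <= d, d <= n
    & forall d', (forall v, nb G v (own cl v) <= d') -> d <= d'].
Proof.
move=> mG mc.
set m1 := run z (Let arr_d (Lit 0)) m.
pose m2 := iter n.+2 (run z Widen) m1.
have -> : run z Spread m = m2 by rewrite /Spread run_then run_repeat; reflexivity.
pose I m3 := (forall a, a != arr_d -> m3 a = m a) /\ exists2 d, const m3 arr_d d &
  d <= n /\ forall d', (forall v, nb G v (own cl v) <= d') -> d <= d'.
pose done m3 := forall v, nb G v (own cl v) <= m3 arr_d z z.
pose mu m3 := n - m3 arr_d z z.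
have inv m3 : I m3 -> I (run z Widen m3) /\
    ((done m3 /\ m3 arr_d z z = run z Widen m3 arr_d z z) \/
     (mu (run z Widen m3) < mu m3)).
  move=> [keep [d dE [dn dmin]]].
  have mG3 : mrel m3 arr_graph =2 G by move=> i j; rewrite /mrel keep //; apply: mG.
  have mc3 : classed m3.
    by move=> c v; rewrite keep ?mc //; case: c => [[|[|[]]]].
  have dW i j : run z Widen m3 arr_d i j = d + [exists v, d < nb G v (own cl v)].
    rewrite /= /assign /= testE dE; congr (_ + _).
    have -> : [exists i0, 0 < value m3 (fun y => if y == 3 then i0 else cells z i j y)
        (Less (At arr_d 3 3) (Own 3))] = [exists v, d < nb G v (own cl v)].
      by apply: eq_existsb => v; rewrite testE value_own //= dE.
    by case: ifP.
  have keepW a : a != arr_d -> run z Widen m3 a = m a.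
    by move=> ad; rewrite run_frame ?keep // inE.
  rewrite /mu /done /I; move: (run z Widen m3) dW keepW => m4 dW keepW.
  rewrite !dW dE; have [/existsP[v ltv]|nex] := boolP [exists v, d < nb G v (own cl v)].
    have ltn : d < n.
      by apply: leq_trans ltv _; apply: leq_trans (max_card _) _; rewrite card_ord.
    split; last by right; rewrite addn1; lia.
    split=> //; exists (d + 1).
      by move=> i j; rewrite dW; congr (_ + _); apply/eqP; rewrite eqb1; apply/existsP; exists v.
    by split=> [|d' hd']; rewrite addn1 // (leq_trans ltv).
  have okd v : nb G v (own cl v) <= d.
    by rewrite leqNgt; apply: contra nex => ltv; apply/existsP; exists v.
  split; last by left; rewrite addn0.
  by split=> //; exists d => // i j; rewrite dW (negPf nex) addn0.
have [] : I m2 /\ done m2.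
  rewrite /m2; apply: (@iter_until _ (run z Widen) I done mu).
  - split; first by move=> a ad; rewrite /m1 run_frame // inE.
    by exists 0 => // i j; rewrite /m1 /= /assign.
  - by rewrite /mu; lia.
  - by move=> m3 I3; exact: (proj1 (inv m3 I3)).
  - move=> m3 I3 d3; have [_ [[_ e]|lt]] := inv m3 I3; first by move=> v; rewrite -e.
    move: lt; rewrite /mu; have [keep [d dE [dn dmin]]] := I3.
    have [keep' [d' dE' [dn' dmin']]] := proj1 (inv m3 I3).
    have := dmin' _ d3; rewrite dE dE'; lia.
  - by move=> m3 I3; have [_ [[d _]|lt]] := inv m3 I3; [left|right].
clearbody m2; move=> [keep [d dE [dn dmin]]] dn2 m'.
by exists d; split=> //; move: dn2; rewrite /done dE.
Qed.

End Search.

(** * Local search *)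

Notation arr_R := 15 (only parsing).
Notation arr_Z := 16 (only parsing).
Notation arr_P := 17 (only parsing).
Notation arr_lead := 18 (only parsing).
Notation arr_Y := 19 (only parsing).
Notation arr_par := 20 (only parsing).
Notation arr_a := 21 (only parsing).
Notation arr_b := 22 (only parsing).
Notation arr_bad := 23 (only parsing).
Notation arr_S := 24 (only parsing).
Notation arr_I := 25 (only parsing).
Notation arr_cand := 26 (only parsing).
Notation arr_swap := 27 (only parsing).
Notation arr_pick := 28 (only parsing).
Notation arr_F := 29 (only parsing).

Definition Has a x := At a x x.

Definition Free :=
  And (Has arr_cand 0) (And (Not (Has arr_I 0))
    (Not (Exists 2 (And (Has arr_I 2) (At arr_graph 0 2))))).

Definition Grow :=
  Let arr_some Free ;; Choose arr_pick arr_some ;;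
  Let arr_I (Or (Has arr_I 0) (Has arr_pick 0)).

Definition Blocked :=
  Exists 2 (And (Has arr_P 2) (And (At arr_graph 0 2) (Same 0 2))).

Definition Firm := Count 2 (And (And (Has arr_P 2) (Not (Has arr_S 2))) (At arr_graph 0 2)).

Definition Candidate (c : nat) h :=
  And (Has arr_Z 0) (And (Not (Has arr_P 0))
    (And (Has c 0) (And (Not Blocked) (AtMost Firm h)))).

Definition Weigh A :=
  Sum 3 (Cond (Has A 3) (Cond (Has arr_lead 3) (At arr_a 3 3) (At arr_b 3 3)) (Lit 0)).

(** Swaps stop as soon as [P] is satisfactory, since a heavier set need not
    be. *)
Definition Accept :=
  Let arr_P (Cond (And (Has arr_bad 0) (Less (Weigh arr_P) (Weigh arr_swap)))
               (Has arr_swap 0) (Has arr_P 0)).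

(** The first growth provides [I0]. Outside the leading class the second one
    finds no free candidate. *)
Definition Improve c :=
  Let arr_I (Lit 0) ;;
  Let arr_cand (Candidate c (Lit 0)) ;; Repeat Grow ;;
  Let arr_cand (Candidate c (Cond (Has arr_lead 0) (Lit 1) (Lit 0))) ;; Repeat Grow ;;
  Let arr_swap (Or (Has arr_I 0)
    (And (Has arr_P 0) (Not (Exists 2 (And (Has arr_I 2) (At arr_graph 0 2)))))) ;;
  Accept.

Section Improve.
Variables (n : nat) (z : 'I_n) (G : sgraph 'I_n) (cl : 'I_n -> 'I_3).
Implicit Types m : store n.

Lemma stableU (A B : {set 'I_n}) : stable G A -> stable G B ->
  (forall u v, u \in A -> v \in B -> ~~ G u v) -> stable G (A :|: B).
Proof.
move=> sA sB sAB u v; rewrite !inE => /orP[uA|uB] /orP[vA|vB]; auto.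
by rewrite edge_sym; auto.
Qed.

Lemma grow_correct m : mrel m arr_graph =2 G -> stable G (vset m arr_I) ->
  let m' := iter n.+2 (run z Grow) m in
  [/\ forall a, a \notin writes Grow -> m' a = m a,
      vset m arr_I \subset vset m' arr_I,
      vset m' arr_I \subset vset m arr_I :|: vset m arr_cand, stable G (vset m' arr_I)
    & dominates G (vset m' arr_I) (vset m arr_cand)].
Proof.
move=> mG stm.
pose I m3 := [/\ forall a, a \notin writes Grow -> m3 a = m a,
   vset m arr_I \subset vset m3 arr_I,
   vset m3 arr_I \subset vset m arr_I :|: vset m arr_cand & stable G (vset m3 arr_I)].
pose done m3 := dominates G (vset m3 arr_I) (vset m arr_cand).
pose mu m3 := #|~: vset m3 arr_I|.
have inv m3 : I m3 -> I (run z Grow m3) /\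
    ((done m3 /\ vset (run z Grow m3) arr_I = vset m3 arr_I) \/
     mu (run z Grow m3) < mu m3 /\ vset m3 arr_I \subset vset (run z Grow m3) arr_I).
  move=> [keep sub1 sub2 st3].
  have keep' a : a \notin writes Grow -> run z Grow m3 a = m a.
    by move=> na; rewrite run_frame ?keep.
  set m4 := run z (Let arr_some Free) m3.
  have free v : (v \in vset m4 arr_some) = [&& v \in vset m arr_cand, v \notin vset m3 arr_I
     & ~~ [exists u, (u \in vset m3 arr_I) && G v u]].
    rewrite inE /m4 /= /assign /= !testE /= keep // !inE; congr [&& _, _ & ~~ _].
    apply: eq_existsb => u; rewrite !testE /= inE; congr (_ && _).
    by rewrite -mG /mrel keep.
  have := choose_correct z m4 arr_pick arr_some.
  have I5 : run z (Choose arr_pick arr_some) m4 arr_I = m3 arr_I by rewrite !run_frame.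
  have E : run z Grow m3 = run z (Let arr_I (Or (Has arr_I 0) (Has arr_pick 0)))
     (run z (Choose arr_pick arr_some) m4) by rewrite /Grow !run_then; reflexivity.
  move: keep'; rewrite /mu /I {}E; move: (run z (Choose _ _) m4) I5 => m5 I5 keep' pick.
  have I6 v : (v \in vset (run z (Let arr_I (Or (Has arr_I 0) (Has arr_pick 0))) m5) arr_I) =
     (v \in vset m3 arr_I) || (v \in vset m5 arr_pick).
    by rewrite inE /= /assign /= testE /= I5 !inE.
  move: (run z (Let arr_I _) m5) keep' I6 => m6 keep' I6.
  case: pick => [[s0 p0]|[v vs pv]].
    have e6 : vset m6 arr_I = vset m3 arr_I.
      by apply/setP=> v; rewrite I6 p0 in_set0 orbF.
    rewrite e6; split; first by split.
    left; split=> // v vc; have [vI|nvI] := boolP (v \in vset m3 arr_I); first by left.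
    right; have := in_set0 v; rewrite -s0 free vc nvI /= => /negbFE/existsP[u /andP[uI gvu]].
    by exists u; rewrite // edge_sym.
  move: vs; rewrite free => /and3P[vc nvI nex].
  have e6 : vset m6 arr_I = v |: vset m3 arr_I.
    by apply/setP=> u; rewrite I6 pv !in_set1 in_setU1 orbC.
  rewrite e6; split.
    split=> //.
    - by apply: subset_trans sub1 _; apply: subsetUr.
    - by rewrite subUset sub2 sub1set inE vc orbT.
    apply: stableU => // [u w|u w]; rewrite ?in_set1.
      by move=> /eqP-> /eqP->; rewrite edge_irr.
    move=> /eqP-> wI; apply: contra nex => gvw; apply/existsP; exists w.
    by rewrite wI.
  right; split; last exact: subsetUr.
  apply: proper_card; apply/properP; split; first by rewrite setCS subsetUr.
  by exists v; rewrite !in_setC ?nvI // in_setU1 eqxx.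
have [] : I (iter n.+2 (run z Grow) m) /\ done (iter n.+2 (run z Grow) m).
  apply: (@iter_until _ (run z Grow) I done mu).
  - by split=> //; rewrite subsetUl.
  - exact: card_lt.
  - by move=> m3 I3; exact: (proj1 (inv m3 I3)).
  - move=> m3 I3 d3; have [_ [[_ e]|[_ sub]]] := inv m3 I3; rewrite /done.
      by rewrite e.
    move=> v vc; case: (d3 v vc) => [vI|[u uI guv]]; first by left; apply: (subsetP sub).
    by right; exists u; first exact: (subsetP sub).
  - by move=> m3 I3; have [_ [[d _]|[lt _]]] := inv m3 I3; [left|right].
by move: (iter _ _ _) => m3 [keep s1 s2 s3] d3 m'; split.
Qed.

Definition weights m a b c := [/\ const m arr_a a, const m arr_b b
  & forall v, (0 < m arr_lead v v) = (cl v == c)].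

Lemma value_weigh m e A a b c : weights m a b c ->
  value m e (Weigh A) = weight cl c a b (vset m A).
Proof.
move=> [ma mb ml]; rewrite /weight -!sum1_card !big_distrr /=.
rewrite [X in _ = X + _]big_mkcond [X in _ = _ + X]big_mkcond -big_split /=.
apply: eq_bigr => v _; rewrite ma mb ml !inE.
by case: (0 < _); case: (cl v == c); rewrite ?muln1 ?addn0 ?add0n.
Qed.

Lemma test_blocked m e : mrel m arr_graph =2 G -> classed cl m ->
  (0 < value m e Blocked) = blocked G cl (vset m arr_P) (e 0).
Proof.
move=> mG mc; rewrite /Blocked test_exists; apply: eq_existsb => u.
rewrite !test_and (test_same _ _ _ mc) inE /= -mG eq_sym.
by [].
Qed.

Lemma value_firm m e : mrel m arr_graph =2 G ->
  value m e Firm = nb G (e 0) (vset m arr_P :\: vset m arr_S).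
Proof.
move=> mG; rewrite value_count; apply: eq_card => u.
by rewrite !inE !testE /= -mG andbC [(0 < m arr_P u u) && _]andbC andbC.
Qed.

Lemma in_candidate m e (c : 'I_3) h : mrel m arr_graph =2 G -> classed cl m ->
  (0 < value m e (Candidate c.+1 h)) =
  (e 0 \in candidates G cl (vset m arr_Z) (vset m arr_P) (vset m arr_S) c (value m e h)).
Proof.
move=> mG mc; rewrite /Candidate !test_and test_not test_not test_blocked //.
rewrite test_atmost value_firm // !inE /= mc.
by rewrite andbA [X in X && _]andbC.
Qed.

Lemma candidatesS Z P S cc h h' : h <= h' ->
  candidates G cl Z P S cc h \subset candidates G cl Z P S cc h'.
Proof.
move=> le_h; apply/subsetP=> v; rewrite !inE => /andP[-> /and3P[-> -> le]] /=.
exact: leq_trans le_h.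
Qed.

Lemma in_swap P I v : (v \in swap G P I) = (v \in I) || (v \in P) && (nb G v I == 0).
Proof. by rewrite !inE. Qed.

Lemma improve_correct m (cc c : 'I_3) a b bad : mrel m arr_graph =2 G -> classed cl m ->
  weights m a b c -> const m arr_bad bad ->
  vset m arr_P \subset vset m arr_Z -> stable G (vset m arr_P) ->
  let P := vset m arr_P in let P' := vset (run z (Improve cc.+1) m) arr_P in
  (P' = P /\ (0 < bad -> no_gain G cl (vset m arr_Z) P c a b (vset m arr_S) cc)) \/
  [/\ 0 < bad, weight cl c a b P < weight cl c a b P',
     P' \subset vset m arr_Z & stable G P'].
Proof.
move=> mG mc [ma mb ml] mbad PZ stP P P'.
set Z := vset m arr_Z; set S := vset m arr_S.
pose K0 := candidates G cl Z P S cc 0.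
pose K1 := candidates G cl Z P S cc (cc == c).
set Cand1 := Let arr_cand (Candidate cc.+1 (Lit 0)).
set Cand2 := Let arr_cand (Candidate cc.+1 (Cond (Has arr_lead 0) (Lit 1) (Lit 0))).
set Swap := Let arr_swap (Or (Has arr_I 0)
    (And (Has arr_P 0) (Not (Exists 2 (And (Has arr_I 2) (At arr_graph 0 2)))))).
pose inputs : seq nat := [:: 0; 1; 2; 3; arr_Z; arr_P; arr_S; arr_lead; arr_a; arr_b; arr_bad].
pose same m3 := forall x : nat, x \in inputs -> m3 x = m x.
have [m2 m2E] : {m2 | m2 = run z Cand1 (run z (Let arr_I (Lit 0)) m)} by eexists; reflexivity.
have [m3 m3E] : {m3 | m3 = iter n.+2 (run z Grow) m2} by eexists; reflexivity.
have [m4 m4E] : {m4 | m4 = run z Cand2 m3} by eexists; reflexivity.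
have [m5 m5E] : {m5 | m5 = iter n.+2 (run z Grow) m4} by eexists; reflexivity.
have [m6 m6E] : {m6 | m6 = run z Swap m5} by eexists; reflexivity.
have P'E : P' = vset (run z Accept m6) arr_P.
  rewrite m6E m5E m4E m3E m2E /P' /Improve !run_then !run_repeat; reflexivity.
clearbody P'.
have candE m7 h v : same m7 -> (0 < value m7 (cells z v v) (Candidate cc.+1 h)) =
    (v \in candidates G cl Z P S cc (value m7 (cells z v v) h)).
  move=> e7; rewrite in_candidate.
  - by rewrite /vset !e7.
  - by move=> i j; rewrite /mrel e7 //; apply: mG.
  - by move=> x v'; rewrite e7 ?mc //; case: x => [[|[|[|]]]].
have same1 : same (run z (Let arr_I (Lit 0)) m).
  by move=> x xin; rewrite run_frame // inE; apply: contraTneq xin => ->.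
have same2 : same m2.
  by move=> x xin; rewrite m2E run_frame; [exact: same1|rewrite inE; apply: contraTneq xin => ->].
have cand2 : vset m2 arr_cand = K0.
  by apply/setP=> v; rewrite inE m2E; apply: (candE _ (Lit 0)).
have I2 : vset m2 arr_I = set0 by apply/setP=> v; rewrite !inE m2E.
have G2 : mrel m2 arr_graph =2 G by move=> i j; rewrite /mrel same2 //; apply: mG.
have st2 : stable G (vset m2 arr_I) by rewrite I2 => u v; rewrite inE.
have notin x : x \in inputs -> x \notin writes Grow.
  by rewrite !inE => /or4P[/eqP->|/eqP->|/eqP->|]; rewrite //; do ![case/orP] => [] /eqP->.
have [keep3 _ sub3 st3 dom3] := grow_correct G2 st2.
rewrite -m3E I2 set0U cand2 in keep3 sub3 st3 dom3.
have same3 : same m3 by move=> x xin; rewrite keep3 ?same2 ?notin.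
have same4 : same m4.
  by move=> x xin; rewrite m4E run_frame; [exact: same3|rewrite inE; apply: contraTneq xin => ->].
have cand4 : vset m4 arr_cand = K1.
  apply/setP=> v; rewrite inE m4E run_let (candE _ _ _ same3).
  have -> : value m3 (cells z v v) (Cond (Has arr_lead 0) (Lit 1) (Lit 0)) = (cl v == c).
    by have := ml v; rewrite -same3 //= => ->; case: eqP.
  rewrite !inE; congr (_ && _).
  by case: (cl v =P cc) => //= ->.
have I4 : vset m4 arr_I = vset m3 arr_I by rewrite /vset m4E run_frame.
have G4 : mrel m4 arr_graph =2 G by move=> i j; rewrite /mrel same4 //; apply: mG.
have st4 : stable G (vset m4 arr_I) by rewrite I4.
have [keep5 sub5 sub5' st5 dom5] := grow_correct G4 st4.
rewrite -m5E I4 cand4 in keep5 sub5 sub5' st5 dom5.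
have same5 : same m5 by move=> x xin; rewrite keep5 ?same4 ?notin.
have same6 : same m6.
  by move=> x xin; rewrite m6E run_frame; [exact: same5|rewrite inE; apply: contraTneq xin => ->].
have swap6 : vset m6 arr_swap = swap G P (vset m5 arr_I).
  have G5 : mrel m5 arr_graph =2 G by move=> i j; rewrite /mrel same5 //; apply: mG.
  apply/setP=> v; rewrite !inE m6E /= /assign /= !testE /= (same5 arr_P) //.
  congr (_ || _ && _); rewrite -leqn0 leqNgt card_gt0; congr (~~ _).
  apply/existsP/set0Pn => [] [u].
    by rewrite testE /= => /andP[uI gvu]; exists u; rewrite !inE uI -G5.
  by rewrite !inE -G5 => h; exists u; rewrite testE.
have w6 : weights m6 a b c.
  by split=> [i j|i j|v]; rewrite same6 // ?ma ?mb ?ml.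
have PE v : (v \in P') = if (0 < bad) && (weight cl c a b P < weight cl c a b (swap G P (vset m5 arr_I)))
      then v \in swap G P (vset m5 arr_I) else v \in P.
  rewrite P'E inE -swap6 /= /assign /= !testE !(value_weigh _ _ w6) /= same6 // mbad.
  have -> : vset m6 arr_P = P by rewrite /vset same6.
  by case: ifP => _; [rewrite inE|rewrite same6 // inE].
have K01 : K0 \subset K1 by apply: candidatesS.
have I5K : vset m5 arr_I \subset K1.
  by apply: subset_trans sub5' _; rewrite subUset subxx andbT; apply: subset_trans K01.
move: PE; have [/andP[bad0 lt]|no_acc] := boolP (_ && _) => PE.
  right; have -> : P' = swap G P (vset m5 arr_I) by apply/setP=> v; rewrite PE.
  split=> //.
    apply/subsetP=> v; rewrite in_swap => /orP[vI|/andP[vP _]]; last exact: (subsetP PZ).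
    by have := subsetP I5K v vI; rewrite in_set in_setD => /andP[/andP[]].
  move=> u v; rewrite !in_swap => /orP[uI|/andP[uP /eqP u0]] /orP[vI|/andP[vP /eqP v0]].
  - exact: st5.
  - by rewrite edge_sym; apply: nb0 v0 uI.
  - exact: nb0 u0 vI.
  - exact: stP.
left; split; first by apply/setP=> v; rewrite PE.
move=> bad0; rewrite bad0 /= -leqNgt in no_acc.
exists (if cc == c then vset m3 arr_I else vset m5 arr_I), (vset m5 arr_I).
move: K01 sub5' I5K dom5; rewrite /K1; case: (cc == c) => K01 sub5' I5K dom5; split=> //.
Qed.

End Improve.

(** * Assigning the guards *)

Definition Improves := Improve 1 ;; Improve 2 ;; Improve 3.

Definition Level_index := Diff (Here arr_Y) (Lit 1).
Definition Outdegree x := Count 2 (At arr_orient x 2).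
Definition Ceiling x := Count 3 (And (At arr_graph x 3) (Or (Has arr_R 3) (At arr_orient x 3))).
Definition Demand := Cond (And (Has arr_lead 0) (Not Blocked)) (Lit 2) (Lit 1).
Definition Settled :=
  Count 2 (And (Has arr_P 2) (And (At arr_graph 0 2)
    (Or (AtMost (Ceiling 2) Level_index) (At arr_orient 2 0)))).

Definition Guard_edges :=
  Let arr_flow (And (Has arr_Z 0) (And (Not (Has arr_P 0)) (And (Has arr_P 1)
    (And (Cell arr_orient) (Less Level_index (Ceiling 1)))))).

Definition Guard_caps :=
  Let arr_cap (Cond (Has arr_P 0) (Diff Level_index (Outdegree 0))
                 (Diff Degree (Diff Demand Settled))).

Definition Guard := Guard_edges ;; Guard_caps ;; Route.

(** [P] is unsatisfactory if the guards could not be assigned, or if some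
    vertex has too few neighbours in [P]. *)
Definition Bad :=
  Let arr_some (Or (Less (Here arr_cap) Degree)
    (And (And (Has arr_Z 0) (Not (Has arr_P 0)))
         (Less (Count 2 (And (Has arr_P 2) (At arr_graph 0 2))) Demand))) ;;
  Let arr_bad (Cond (Exists 2 (Has arr_some 2)) (Lit 1) (Lit 0)).

Definition Stuck :=
  Let arr_S (And (Has arr_P 0) (And (Not (Has arr_stamp 0)) (Less Level_index (Ceiling 0)))).

(** The empty [S] deals with vertices that have too few neighbours in [P],
    the stuck set with a failed assignment of guards. *)
Definition Body :=
  Guard ;; Bad ;; Let arr_S (Lit 0) ;; Improves ;; Stuck ;; Improves.

Section Body.
Variables (n : nat) (z : 'I_n) (G : sgraph 'I_n) (cl : 'I_n -> 'I_3).
Implicit Types m : store n.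

Lemma improves_correct m (c : 'I_3) a b bad : mrel m arr_graph =2 G -> classed cl m ->
  weights cl m a b c -> const m arr_bad bad ->
  vset m arr_P \subset vset m arr_Z -> stable G (vset m arr_P) ->
  let P := vset m arr_P in let P' := vset (run z Improves m) arr_P in
  (P' = P /\ (0 < bad -> forall cc, no_gain G cl (vset m arr_Z) P c a b (vset m arr_S) cc)) \/
  [/\ 0 < bad, weight cl c a b P < weight cl c a b P',
     P' \subset vset m arr_Z & stable G P'].
Proof.
move=> mG mc mw mbad PZ stP P P'.
have [m1 m1E] : {m1 | m1 = run z (Improve 1) m} by eexists; reflexivity.
have [m2 m2E] : {m2 | m2 = run z (Improve 2) m1} by eexists; reflexivity.
have P'E : P' = vset (run z (Improve 3) m2) arr_P.
  by rewrite m2E m1E /P' /Improves !run_then; reflexivity.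
clearbody P'.
pose inputs : seq nat := [:: 0; 1; 2; 3; arr_Z; arr_S; arr_lead; arr_a; arr_b; arr_bad].
pose same m3 := forall x : nat, x \in inputs -> m3 x = m x.
have hyps m3 : same m3 -> [/\ mrel m3 arr_graph =2 G, classed cl m3, weights cl m3 a b c,
    const m3 arr_bad bad & vset m3 arr_Z = vset m arr_Z /\ vset m3 arr_S = vset m arr_S].
  move=> e; have [wa wb wl] := mw; split.
  - by move=> i j; rewrite /mrel e //; apply: mG.
  - by move=> x v; rewrite e ?mc //; case: x => [[|[|[|]]]].
  - by split=> [i j|i j|v]; rewrite e // ?wa ?wb ?wl.
  - by move=> i j; rewrite e.
  by rewrite /vset !e.
have same1 : same m1.
  move=> x xin; rewrite m1E run_frame; first reflexivity.
  by move: xin; rewrite !inE; do ![case/orP] => [] /eqP->.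
have same2 : same m2.
  move=> x xin; rewrite m2E run_frame; first exact: same1.
  by move: xin; rewrite !inE; do ![case/orP] => [] /eqP->.
have [G1 c1 w1 b1 [Z1 S1]] := hyps m1 same1.
have [G2 c2 w2 b2 [Z2 S2]] := hyps m2 same2.
have step1 := improve_correct z ord0 mG mc mw mbad PZ stP; rewrite -m1E in step1.
have [PZ1 stP1] : vset m1 arr_P \subset vset m1 arr_Z /\ stable G (vset m1 arr_P).
  by rewrite Z1; case: step1 => [[-> _]|[]].
have step2 := improve_correct z (lift ord0 ord0 : 'I_3) G1 c1 w1 b1 PZ1 stP1.
rewrite -m2E Z1 S1 in step2.
have [PZ2 stP2] : vset m2 arr_P \subset vset m2 arr_Z /\ stable G (vset m2 arr_P).
  by rewrite Z2; case: step2 => [[-> _]|[]]; first by rewrite -Z1.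
have step3 := improve_correct z (ord_max : 'I_3) G2 c2 w2 b2 PZ2 stP2.
rewrite -P'E Z2 S2 in step3.
rewrite -/P in step1.
have [PZ' stP'] : P' \subset vset m arr_Z /\ stable G P'.
  by case: step3 => [[-> _]|[]]; first by rewrite -Z2.
have q1 : weight cl c a b P <= weight cl c a b (vset m1 arr_P).
  by case: step1 => [[-> _]|[_ /ltnW]].
have q2 : weight cl c a b (vset m1 arr_P) <= weight cl c a b (vset m2 arr_P).
  by case: step2 => [[-> _]|[_ /ltnW]].
have q3 : weight cl c a b (vset m2 arr_P) <= weight cl c a b P'.
  by case: step3 => [[-> _]|[_ /ltnW]].
case: step1 => [[e1 n1]|[bd l1 _ _]]; last first.
  by right; split=> //; apply: leq_trans l1 (leq_trans q2 q3).
case: step2 => [[e2 n2]|[bd l2 _ _]]; last first.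
  by right; split=> //; apply: leq_ltn_trans q1 (leq_trans l2 q3).
case: step3 => [[e3 n3]|[bd l3 _ _]]; last first.
  by right; split=> //; apply: leq_ltn_trans q1 (leq_ltn_trans q2 l3).
left; split; first by rewrite e3 e2 e1.
move=> bd; have {}n1 := n1 bd; have := n2 bd; have := n3 bd; rewrite e2 e1 => {}n3 {}n2.
move=> cc; have : [|| cc == ord0, cc == lift ord0 ord0 | cc == ord_max].
  by case: cc => [[|[|[|]]]].
by case/or3P => /eqP->.
Qed.

Section Setting.
Variables (m0 : store n) (Y : nat) (c : 'I_3) (a b : nat).
Hypotheses (mG : mrel m0 arr_graph =2 G) (mc : classed cl m0) (mw : weights cl m0 a b c).
Hypothesis mY : const m0 arr_Y Y.+1.
Let o := mrel m0 arr_orient.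
Let R := vset m0 arr_R.
Let Z := vset m0 arr_Z.
Hypothesis oG : orients G o.

Definition inputs : seq nat :=
  [:: 0; 1; 2; 3; arr_orient; arr_R; arr_Z; arr_lead; arr_Y; arr_a; arr_b].
Definition same m := forall x : nat, x \in inputs -> m x = m0 x.

Lemma same_run p m : same m -> all (fun x => x \notin writes p) inputs -> same (run z p m).
Proof.
move=> e /allP nw x xin; rewrite run_frame; first exact: e.
exact: nw.
Qed.

Lemma same_hyps m : same m -> [/\ mrel m arr_graph =2 G, classed cl m, weights cl m a b c,
  const m arr_Y Y.+1 & [/\ mrel m arr_orient = o, vset m arr_R = R & vset m arr_Z = Z]].
Proof.
move=> e; have [wa wb wl] := mw; split.
- by move=> i j; rewrite /mrel e //; apply: mG.
- by move=> x v; rewrite e ?mc //; case: x => [[|[|[|]]]].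
- by split=> [i j|i j|v]; rewrite e // ?wa ?wb ?wl.
- by move=> i j; rewrite e.
by rewrite /mrel /vset !e.
Qed.

Lemma value_level m e : const m arr_Y Y.+1 -> value m e Level_index = Y.
Proof. by move=> mY'; rewrite /= mY' subn1. Qed.

Lemma value_outdegree m e x : x != 2 ->
  value m e (Outdegree x) = out (mrel m arr_orient) (e x).
Proof.
by move=> x2; rewrite value_count; apply: eq_card => i; rewrite !inE /= (negPf x2).
Qed.

Lemma value_ceiling m e x : mrel m arr_graph =2 G -> x != 3 ->
  value m e (Ceiling x) = ceiling G (mrel m arr_orient) (vset m arr_R) (e x).
Proof.
move=> G' x3; rewrite value_count; apply: eq_card => i.
by rewrite !inE !testE /= (negPf x3) -G'.
Qed.

Lemma value_demand m e : mrel m arr_graph =2 G -> classed cl m ->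
  (forall v, (0 < m arr_lead v v) = (cl v == c)) ->
  value m e Demand = demand G cl (vset m arr_P) c (e 0).
Proof.
move=> G' c' ml; by rewrite value_cond test_and test_not (test_blocked _ G' c') /= ml.
Qed.

Lemma value_settled m e : mrel m arr_graph =2 G -> const m arr_Y Y.+1 ->
  value m e Settled = settled G (mrel m arr_orient) (vset m arr_R) (vset m arr_P) Y (e 0).
Proof.
move=> G' Y'; rewrite value_count; apply: eq_card => i.
rewrite !inE !test_and test_or test_atmost (value_ceiling _ G') // value_level //=.
by rewrite -G' andbA.
Qed.

Let dem P := demand G cl P c.
Let caps P := guard_cap G o R Z P Y (dem P).
Let edges P := guard_edges G o R Z P Y.

Lemma guard_correct m : same m -> let P := vset m arr_P in let m' := run z Guard m in
  let U := [set v | diag m' arr_stamp v == 0] in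
  [/\ reorients (edges P) (mrel m' arr_flow), closed_in (mrel m' arr_flow) U,
     forall v, v \in U -> caps P v <= out (mrel m' arr_flow) v,
     forall v, v \notin U -> out (mrel m' arr_flow) v <= caps P v
   & forall v, m' arr_cap v v = caps P v].
Proof.
move=> e P; have [G' c' [wa wb wl] Y' [oE RE ZE]] := same_hyps e.
have [m1 m1E] : {m1 | m1 = run z Guard_edges m} by eexists; reflexivity.
have [m2 m2E] : {m2 | m2 = run z Guard_caps m1} by eexists; reflexivity.
have -> : run z Guard m = run z Route m2 by rewrite m2E m1E /Guard !run_then; reflexivity.
have e1 : same m1 by rewrite m1E; apply: same_run.
have [G1 c1 [_ _ wl1] Y1 [o1 R1 Z1]] := same_hyps e1.
have P1 : vset m1 arr_P = P by rewrite /vset m1E run_frame.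
have flow1 i j : mrel m1 arr_flow i j = edges P i j.
  rewrite /mrel m1E run_let !test_and test_not test_less value_level // (value_ceiling _ G') //= oE RE.
  rewrite -[0 < m arr_orient i j]/(mrel m arr_orient i j) oE.
  rewrite /edges /guard_edges in_setD -ZE !inE.
  by case: (0 < m arr_Z i i); case: (0 < m arr_P i i).
have cap2 v : diag m2 arr_cap v = caps P v.
  rewrite /diag m2E run_let value_cond (value_diff _ _ Level_index) (value_diff _ _ Degree)
    (value_diff _ _ Demand) value_level // value_outdegree // value_degree (value_demand _ G1 c1 wl1) (value_settled _ G1 Y1).
  rewrite /caps /guard_cap o1 R1 P1 -P1 inE; congr (if _ then _ else _ - _).
  by apply: out_ext => i j; rewrite flow1 P1.
have flow2 : mrel m2 arr_flow =2 edges P.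
  by move=> i j; rewrite -flow1 /mrel m2E run_frame.
have asym2 : asym (mrel m2 arr_flow).
  move=> i j; rewrite !flow2 => /and4P[_ _ oij _]; apply/negP => /and4P[_ _ oji _].
  by move: (orients_asym oG oij); rewrite oji.
have cap3 : run z Route m2 arr_cap = m2 arr_cap by rewrite run_frame.
have := route_correct z asym2; move: (run z Route m2) cap3 => m3 cap3 [re cl' cU cN].
split=> // [i j|v /cU|v /cN|v]; rewrite ?cap2 //; first by rewrite re !flow2.
by rewrite cap3 -cap2.
Qed.

Variables k D : nat.
Hypothesis small : forall v, nb G v (own cl v) <= D.
Hypotheses (Yt : Y < k + 9 * D.+1 - 1) (gYR : game G cl k D Y.+1 o R).
Hypothesis cE : c = lead k D Y.+1 :> nat.
Hypothesis ZE : Z = [set v in R | (restricted k D Y.+1 ==> (cl v == c)) && (Y <= ceiling G o R v)].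
Hypothesis abE : (a, b) = if mixed k D Y.+1 then (3, 2) else (#|'I_n|.+2, #|'I_n|.+1).

(** A property of [P] alone. By [settled_caps] it does not matter which
    orientation of the guard edges the program arrives at. *)
Definition good P := (forall v, v \in Z :\: P -> dem P v <= nb G v P) /\
  exists2 W1, reorients (edges P) W1 & forall v, out W1 v <= caps P v.

(** If [P] is not good and no swap is accepted, then [no_gain] holds for
    both sets [S], which contradicts the bounds on missing guards. *)
Lemma body_correct m : same m -> vset m arr_P \subset Z -> stable G (vset m arr_P) ->
  let P := vset m arr_P in let m' := run z Body m in let P' := vset m' arr_P in
  [/\ same m', P' \subset Z, stable G P' &
    (good P /\ P' = P) \/ (~ good P /\ weight cl c a b P < weight cl c a b P')].
Proof.
move=> e PZ stP P m' P'.
have em' : same m' by rewrite /m'; apply: same_run.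
have [m1 m1E] : {m1 | m1 = run z Guard m} by eexists; reflexivity.
have [m2 m2E] : {m2 | m2 = run z Bad m1} by eexists; reflexivity.
have [m3 m3E] : {m3 | m3 = run z (Let arr_S (Lit 0)) m2} by eexists; reflexivity.
have [m4 m4E] : {m4 | m4 = run z Improves m3} by eexists; reflexivity.
have [m5 m5E] : {m5 | m5 = run z Stuck m4} by eexists; reflexivity.
have P'E : P' = vset (run z Improves m5) arr_P.
  by rewrite m5E m4E m3E m2E m1E /P' /m' /Body !run_then; reflexivity.
move: m' P' em' P'E => m' P' em' P'E.
have [G1 c1 w1 Y1 [o1 R1 Z1]] := same_hyps e.
have := guard_correct e; cbv zeta; rewrite -m1E -/P.
set W := mrel m1 arr_flow; set U := [set v | diag m1 arr_stamp v == 0]; case=> reW clU capU slackU cap1.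
have e1 : same m1 by rewrite m1E; apply: same_run.
have P1 : vset m1 arr_P = P by rewrite /vset m1E run_frame.
pose bad := [exists v, (caps P v < out W v) ||
   (v \in Z :\: P) && (nb G v P < dem P v)].
have e2 : same m2 by rewrite m2E; apply: same_run.
have P2 : vset m2 arr_P = P by rewrite -P1 /vset m2E run_frame.
have bad2 : const m2 arr_bad bad.
  have [G1' c1' [_ _ wl1] Y1' [o1' R1' Z1']] := same_hyps e1.
  set some := Or (Less (Here arr_cap) Degree)
    (And (And (Has arr_Z 0) (Not (Has arr_P 0)))
         (Less (Count 2 (And (Has arr_P 2) (At arr_graph 0 2))) Demand)).
  move=> i j; rewrite m2E -[run _ _ _ _ _ _]/(if 0 < value (assign m1 arr_some
     (fun i j => value m1 (cells z i j) some)) (cells z i j) (Exists 2 (Has arr_some 2)) then 1 else 0).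
  rewrite test_exists; have -> : [exists i0, 0 < value (assign m1 arr_some
     (fun i j => value m1 (cells z i j) some)) (bind (cells z i j) 2 i0) (Has arr_some 2)] = bad.
    apply: eq_existsb => v; rewrite [value _ _ _]/=  /assign /= test_or test_less value_degree.
    rewrite -[value m1 _ (Here arr_cap)]/(m1 arr_cap v v) cap1; congr (_ || _).
    rewrite !test_and test_not test_less (value_demand _ G1' c1' wl1) P1 in_setD.
    rewrite -Z1' -P1 !inE value_count; congr (_ && (_ < _)); first exact: andbC.
    by apply: eq_card => u; rewrite !inE test_and /= -G1'.
  by case: bad.
have e3 : same m3 by rewrite m3E; apply: same_run.
have P3 : vset m3 arr_P = P by rewrite -P2 /vset m3E run_frame.
have S3 : vset m3 arr_S = set0 by apply/setP=> v; rewrite !inE m3E.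
have bad3 : const m3 arr_bad bad by move=> i j; rewrite m3E run_frame.
have [G3 c3 w3 Y3 [o3 R3 Z3]] := same_hyps e3.
have := improves_correct G3 c3 w3 bad3; rewrite P3 Z3 S3 -m4E => /(_ PZ stP) first.
have e4 : same m4 by rewrite m4E; apply: same_run.
have [PZ4 stP4] : vset m4 arr_P \subset Z /\ stable G (vset m4 arr_P).
  by case: first => [[-> _]|[]].
have e5 : same m5 by rewrite m5E; apply: same_run.
have [G4 c4 [_ _ wl4] Y4 [o4 R4 Z4]] := same_hyps e4.
have [G5 c5 w5 Y5 [o5 R5 Z5]] := same_hyps e5.
have bad5 : const m5 arr_bad bad.
  by move=> i j; rewrite m5E run_frame // m4E run_frame.
have P5 : vset m5 arr_P = vset m4 arr_P by rewrite /vset m5E run_frame.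
have S5 : vset m5 arr_S = [set w in vset m4 arr_P | (w \in U) && (Y < ceiling G o R w)].
  have st4 : m4 arr_stamp = m1 arr_stamp.
    by rewrite m4E run_frame // m3E run_frame // m2E run_frame.
  apply/setP=> w; rewrite [RHS]in_set [LHS]in_set /U [w \in [set v | _]]in_set /diag -st4.
  rewrite m5E run_let !test_and test_not test_less value_level // (value_ceiling _ G4) //= o4 R4 inE.
  by rewrite -eqn0Ngt.
have := improves_correct G5 c5 w5 bad5; rewrite P5 Z5 S5 -P'E => /(_ PZ4 stP4) second.
have [PZ' stP'] : P' \subset Z /\ stable G P'.
  by case: second => [[-> _]|[]].
split=> //.
have [bd|nbd] := boolP bad; last first.
  left; split; last first.
    case: second => [[-> _]|[bd _ _ _]]; last by rewrite (negPf nbd) in bd.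
    by case: first => [[-> _]|[bd _ _ _]]; last by rewrite (negPf nbd) in bd.
  have ok v : ~~ ((caps P v < out W v) || (v \in Z :\: P) && (nb G v P < dem P v)).
    by apply: contra nbd => h; apply/existsP; exists v.
  split=> [v vZ|]; first by have := ok v; rewrite vZ negb_or -!leqNgt => /andP[].
  by exists W => // v; have := ok v; rewrite negb_or -leqNgt => /andP[].
right; split.
  case=> demP [W1 re1 out1]; move: bd => /existsP[v /orP[|/andP[vZ]]].
    by rewrite ltnNge (settled_caps re1 out1 reW clU capU slackU).
  by rewrite ltnNge demP.
have q1 : weight cl c a b P <= weight cl c a b (vset m4 arr_P).
  by case: first => [[-> _]|[_ /ltnW]].
have q2 : weight cl c a b (vset m4 arr_P) <= weight cl c a b P'.
  by case: second => [[-> _]|[_ /ltnW]].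
case: first => [[eP g1]|[_ lt _ _]]; last by apply: leq_trans lt q2.
case: second => [[eP' g2]|[_ lt _ _]]; last by apply: leq_ltn_trans q1 lt.
(* Neither swap was accepted. *)
exfalso; have b0 : 0 < bad by rewrite bd.
move: (g1 b0) (g2 b0); rewrite eP => {}g1 {}g2.
have demP : forall v, v \in Z :\: P -> dem P v <= nb G v P.
  by move: PZ stP g1; rewrite /dem ZE => PZ'' stP'' g1; apply: (level_demand small Yt gYR cE PZ'' abE g1).
have capsP : forall v, out W v <= caps P v.
  move: PZ demP reW capU slackU g2; rewrite /caps /edges /dem ZE => PZ'' demP' reW' capU' slackU' g2'.
  exact: (level_caps small Yt gYR cE PZ'' abE demP' reW' clU capU' slackU' g2').
move: bd => /existsP[v /orP[|/andP[vZ]]]; first by rewrite ltnNge capsP.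
by rewrite ltnNge demP.
Qed.

Lemma weight_bound P : weight cl c a b P < n.+2 * n.+2.
Proof.
have le3 A : #|A : {set 'I_n}| <= n by have := max_card (mem A); rewrite card_ord.
have := cardsID (class cl c) P; have := le3 P; rewrite /weight.
move: abE; rewrite card_ord; set x := #|_ :&: _|; set y := #|_ :\: _|.
move: #|P| => s ab sn xys; have {xys} xyn : x + y <= n by rewrite xys.
have ba : b <= a by move: ab; case: ifP => _ [-> ->].
apply: (@leq_ltn_trans (a * n)).
  apply: leq_trans (_ : a * (x + y) <= _); last by rewrite leq_mul2l xyn orbT.
  by rewrite mulnDr leq_add2l leq_mul2r ba orbT.
have -> : n.+2 * n.+2 = n * n + 4 * n + 4 by lia.
by move: ab; case: ifP => _ [-> _]; rewrite ?mulSn; lia.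
Qed.

Lemma search_correct m : same m -> vset m arr_P = set0 ->
  let m' := run z (Repeat (Repeat Body)) m in
  [/\ same m', vset m' arr_P \subset Z, stable G (vset m' arr_P) & good (vset m' arr_P)].
Proof.
move=> e P0.
pose I m3 := [/\ same m3, vset m3 arr_P \subset Z & stable G (vset m3 arr_P)].
pose done m3 := good (vset m3 arr_P).
pose mu m3 := n.+2 * n.+2 - (weight cl c a b (vset m3 arr_P)).+1.
have -> : run z (Repeat (Repeat Body)) m = iter (n.+2 * n.+2) (run z Body) m.
  by rewrite run_repeat run_repeats; reflexivity.
suff [[e' PZ' st'] g'] : I (iter (n.+2 * n.+2) (run z Body) m) /\
   done (iter (n.+2 * n.+2) (run z Body) m) by split.
have step m3 : I m3 -> I (run z Body m3) /\
   (done m3 /\ vset (run z Body m3) arr_P = vset m3 arr_P \/ ~ done m3 /\ mu (run z Body m3) < mu m3).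
  move=> [e3 PZ3 st3]; have [e4 PZ4 st4 alt] := body_correct e3 PZ3 st3.
  split; first by split.
  case: alt => [[g eP]|[ng lt]]; [by left|right; split; first exact: ng].
  rewrite /mu; move: (weight_bound (vset (run z Body m3) arr_P)) lt; lia.
apply: (@iter_until _ (run z Body) I done mu).
- split; [exact: e|by rewrite P0 sub0set|by rewrite P0 => u v; rewrite inE].
- by rewrite /mu; move: (weight_bound (vset m arr_P)); lia.
- by move=> m3 I3; exact: (proj1 (step m3 I3)).
- move=> m3 I3 d3; have [_ [[_ eP]|[nd _]]] := step m3 I3; last by [].
  by rewrite /done eP.
- by move=> m3 I3; have [_ [[d3 _]|[_ lt]]] := step m3 I3; [left|right].
Qed.

End Setting.

End Body.

(** * One level *)

Definition Scale j t := iter j (Add t) (Lit 0).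
Definition Threshold j := Add (Here arr_k) (Scale j (Add (Here arr_d) (Lit 1))).
Definition Above j := AtMost (Threshold j) (Here arr_Y).

Definition Lead :=
  Let arr_lead (Cond (Above 7) (Cond (Here arr_par) (Has 2 0) (Has 3 0))
    (Cond (Above 6) (Has 1 0) (Cond (Above 4) (Has 3 0) (Has 2 0)))).

Definition Weight x y :=
  Cond (And (Above 4) (Not (Above 6))) (Lit x) (Add (Sum 2 (Lit 1)) (Lit y)).

Definition Eligible :=
  Let arr_Z (And (Has arr_R 0)
    (And (Or (Not (Above 6)) (Has arr_lead 0)) (AtMost Level_index (Ceiling 0)))).

Definition Prepare :=
  Lead ;; Let arr_a (Weight 3 2) ;; Let arr_b (Weight 2 1) ;; Eligible ;; Let arr_P (Lit 0).

Definition Flip :=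
  Let arr_orient (Or (At arr_F 1 0) (And (Cell arr_orient) (Not (Cell arr_F)))).

Definition Pullable x y :=
  And (Has arr_R x) (And (Not (Has arr_P x)) (At arr_orient x y)).

(** The factor [arr_Y] suppresses all reversals in the rounds after level 0. *)
Definition Guards := Let arr_F (And (Here arr_Y) (And (At arr_flow 1 0) (Cell arr_orient))).

Definition Pulls :=
  Let arr_F (And (Here arr_Y) (And (Has arr_P 1) (And (Pullable 0 1)
    (Less (Count 2 (And (Pullable 2 1) (Lt 2 0))) (Diff Level_index (Outdegree 1)))))).

Definition Retire := Let arr_R (And (Has arr_R 0) (Not (Has arr_P 0))).

Definition Next := Let arr_Y Level_index ;; Let arr_par (Diff (Lit 1) (Here arr_par)).

Definition Level :=
  Prepare ;; Repeat (Repeat Body) ;; Guard ;; Guards ;; Flip ;; Pulls ;; Flip ;; Retire ;; Next.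

Section Level.
Variables (n : nat) (z : 'I_n) (G : sgraph 'I_n) (cl : 'I_n -> 'I_3) (k D : nat).
Hypothesis small : forall v, nb G v (own cl v) <= D.
Implicit Types m : store n.

Record ready m Y : Prop := Ready {
  ready_graph : mrel m arr_graph =2 G;
  ready_class : classed cl m;
  ready_k : const m arr_k k;
  ready_d : const m arr_d D;
  ready_Y : const m arr_Y Y;
  ready_par : 0 < Y -> const m arr_par (odd (depth k D Y));
  ready_game : game G cl k D Y (mrel m arr_orient) (vset m arr_R)
}.

Lemma value_scale m e j t : value m e (Scale j t) = j * value m e t.
Proof. by elim: j => //= j IHj; rewrite -/(Scale j t) IHj mulSn. Qed.

Lemma test_above m e j Y : const m arr_k k -> const m arr_d D -> const m arr_Y Y ->
  (0 < value m e (Above j)) = (k + j * D.+1 <= Y).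
Proof.
move=> mk md mY; rewrite test_atmost -[value m e (Threshold j)]/(m arr_k (e 0) (e 0) +
  value m e (Scale j (Add (Here arr_d) (Lit 1)))) value_scale.
by rewrite -[value m e (Here arr_Y)]/(m arr_Y (e 0) (e 0))
  -[value m e (Add _ _)]/(m arr_d (e 0) (e 0) + 1) mk md mY addn1.
Qed.

Lemma flip_run m : mrel (run z Flip m) arr_orient =2 flip (mrel m arr_orient) (mrel m arr_F).
Proof.
by move=> i j; rewrite /mrel run_let test_or test_and test_not.
Qed.

Lemma prepare_correct m Y (c : 'I_3) : ready m Y -> c = lead k D Y :> nat -> 0 < Y ->
  let m' := run z Prepare m in
  let ab := if mixed k D Y then (3, 2) else (#|'I_n|.+2, #|'I_n|.+1) in
  [/\ weights cl m' ab.1 ab.2 c, vset m' arr_P = set0,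
      vset m' arr_Z = [set v in vset m arr_R | (restricted k D Y ==> (cl v == c)) &&
         (Y.-1 <= ceiling G (mrel m arr_orient) (vset m arr_R) v)]
   & forall x, x \notin writes Prepare -> m' x = m x].
Proof.
move=> [mG mc mk md mY mpar _] cE Y0; move: (mpar Y0) => {}mpar.
have [m1 m1E] : {m1 | m1 = run z Lead m} by eexists; reflexivity.
have [m2 m2E] : {m2 | m2 = run z (Let arr_a (Weight 3 2)) m1} by eexists; reflexivity.
have [m3 m3E] : {m3 | m3 = run z (Let arr_b (Weight 2 1)) m2} by eexists; reflexivity.
have [m4 m4E] : {m4 | m4 = run z Eligible m3} by eexists; reflexivity.
move=> m'; have m'E : m' = run z (Let arr_P (Lit 0)) m4.
  by rewrite m4E m3E m2E m1E /m' /Prepare !run_then; reflexivity.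
have keep x : x \notin writes Prepare -> m' x = m x.
  by move=> nx; rewrite /m' run_frame.
clearbody m'; move=> ab.
have sum1 m5 e : value m5 e (Sum 2 (Lit 1)) = #|'I_n|.
  by rewrite /= sum1_card.
have lead1 v : (0 < m1 arr_lead v v) = (cl v == c).
  rewrite m1E run_let /= !(test_above _ _ mk md mY) mpar lt0b.
  have c0 := mc ord0 v; have c1 := mc (lift ord0 ord0) v; have c2 := mc ord_max v.
  rewrite /= /bump /= ?addn0 ?addn1 in c0 c1 c2.
  move: cE; rewrite /lead; do 4?case: ifP => _ //; move=> cE.
  - by rewrite c1; congr (_ == _); apply: val_inj.
  - by rewrite c2; congr (_ == _); apply: val_inj.
  - by rewrite c0; congr (_ == _); apply: val_inj.
  - by rewrite c2; congr (_ == _); apply: val_inj.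
  - by rewrite c1; congr (_ == _); apply: val_inj.
have weightE m5 e x y : const m5 arr_k k -> const m5 arr_d D -> const m5 arr_Y Y ->
    value m5 e (Weight x y) = if mixed k D Y then x else #|'I_n| + y.
  move=> k5 d5 Y5; rewrite -[LHS]/(if 0 < value m5 e (And (Above 4) (Not (Above 6))) then x
    else value m5 e (Sum 2 (Lit 1)) + y).
  by rewrite test_and test_not !(test_above _ _ k5 d5 Y5) sum1 -ltnNge.
have old (ma : store n) x p mb : ma = run z p mb -> x \notin writes p -> ma x = mb x.
  by move=> -> nx; rewrite run_frame.
have k1 : const m1 arr_k k by move=> i j; rewrite (old _ _ _ _ m1E).
have d1 : const m1 arr_d D by move=> i j; rewrite (old _ _ _ _ m1E).
have Y1 : const m1 arr_Y Y by move=> i j; rewrite (old _ _ _ _ m1E).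
have k2 : const m2 arr_k k by move=> i j; rewrite (old _ _ _ _ m2E).
have d2 : const m2 arr_d D by move=> i j; rewrite (old _ _ _ _ m2E).
have Y2 : const m2 arr_Y Y by move=> i j; rewrite (old _ _ _ _ m2E).
have k3 : const m3 arr_k k by move=> i j; rewrite (old _ _ _ _ m3E).
have d3 : const m3 arr_d D by move=> i j; rewrite (old _ _ _ _ m3E).
have Y3 : const m3 arr_Y Y by move=> i j; rewrite (old _ _ _ _ m3E).
have m3x x : x \notin [:: arr_lead; arr_a; arr_b] -> m3 x = m x.
  rewrite !inE !negb_or => /and3P[x1 x2 x3].
  by rewrite (old _ _ _ _ m3E) ?inE // (old _ _ _ _ m2E) ?inE // (old _ _ _ _ m1E) ?inE.
have lead3 v : (0 < m3 arr_lead v v) = (cl v == c).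
  by rewrite (old _ _ _ _ m3E) // (old _ _ _ _ m2E).
split=> //.
- split=> [i j|i j|v].
  + rewrite (old _ _ _ _ m'E) // (old _ _ _ _ m4E) // (old _ _ _ _ m3E) // m2E.
    rewrite run_let weightE // /ab.
    by case: ifP => //; rewrite addn2.
  + rewrite (old _ _ _ _ m'E) // (old _ _ _ _ m4E) // m3E.
    rewrite run_let weightE // /ab.
    by case: ifP => //; rewrite addn1.
  + by rewrite (old _ _ _ _ m'E) // (old _ _ _ _ m4E).
- by apply/setP=> v; rewrite in_set m'E in_set0.
apply/setP=> v; rewrite [RHS]in_set [LHS]in_set (old _ _ _ _ m'E) // m4E.
rewrite run_let.
have G3 : mrel m3 arr_graph =2 G by move=> i j; rewrite /mrel m3x //; apply: mG.
rewrite !test_and test_or test_not test_atmost (test_above _ _ k3 d3 Y3) (value_ceiling _ G3) //.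
rewrite -[value _ _ Level_index]/(m3 arr_Y v v - 1) Y3 subn1 /=.
rewrite lead3 /restricted /mrel /vset !m3x // in_set; congr (_ && (_ && _)).
by rewrite implybE.
Qed.

Lemma flip_ext (o o' F F' : rel 'I_n) : o =2 o' -> F =2 F' -> flip o F =2 flip o' F'.
Proof. by move=> e e' i j; rewrite /flip e !e'. Qed.

Lemma level_correct m Y : ready m Y -> Y <= k + 9 * D.+1 - 1 -> ready (run z Level m) Y.-1.
Proof.
move=> rm le_Y; have [mG mc mk md mY mpar mgame] := rm.
have [m1 m1E] : {m1 | m1 = run z Prepare m} by eexists; reflexivity.
have [m2 m2E] : {m2 | m2 = run z (Repeat (Repeat Body)) m1} by eexists; reflexivity.
have [m3 m3E] : {m3 | m3 = run z Guard m2} by eexists; reflexivity.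
have [m4 m4E] : {m4 | m4 = run z Guards m3} by eexists; reflexivity.
have [m5 m5E] : {m5 | m5 = run z Flip m4} by eexists; reflexivity.
have [m6 m6E] : {m6 | m6 = run z Pulls m5} by eexists; reflexivity.
have [m7 m7E] : {m7 | m7 = run z Flip m6} by eexists; reflexivity.
have [m8 m8E] : {m8 | m8 = run z Retire m7} by eexists; reflexivity.
have E : run z Level m = run z Next m8.
  by rewrite m8E m7E m6E m5E m4E m3E m2E m1E /Level !run_then; reflexivity.
have frame x : x \notin writes Level -> run z Level m x = m x.
  by move=> nx; rewrite run_frame.
move: (run z Level m) E frame => m' m'E frame.
have old (ma : store n) x p mb : ma = run z p mb -> x \notin writes p -> ma x = mb x.
  by move=> -> nx; rewrite run_frame.
have to3 x : x \in [:: 0; 1; 2; 3; arr_k; arr_d; arr_Y; arr_orient; arr_R; arr_par] -> m3 x = m x.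
  move=> xin; rewrite (old _ _ _ _ m3E) 1?(old _ _ _ _ m2E) 1?(old _ _ _ _ m1E);
  try reflexivity; by move: xin; rewrite !inE; do ![case/orP] => [] /eqP->.
have Y8 : m8 arr_Y = m arr_Y.
  rewrite (old _ _ _ _ m8E) // (old _ _ _ _ m7E) // (old _ _ _ _ m6E) //.
  by rewrite (old _ _ _ _ m5E) // (old _ _ _ _ m4E) // to3.
have par8 : m8 arr_par = m arr_par.
  rewrite (old _ _ _ _ m8E) // (old _ _ _ _ m7E) // (old _ _ _ _ m6E) //.
  by rewrite (old _ _ _ _ m5E) // (old _ _ _ _ m4E) // to3.
have Y' : const m' arr_Y Y.-1.
  by move=> i j; rewrite m'E /= /assign /= Y8 mY subn1.
have par' : 0 < Y.-1 -> const m' arr_par (odd (depth k D Y.-1)).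
  move=> Y1 i j; rewrite m'E -[run _ _ _ _ _ _]/(1 - m8 arr_par i i) par8 mpar; last by lia.
  have -> : depth k D Y.-1 = (depth k D Y).+1.
    by move: le_Y Y1; rewrite /depth; lia.
  by rewrite /=; case: (odd _).
have orient' : mrel m' arr_orient = mrel m7 arr_orient.
  by rewrite /mrel (old _ _ _ _ m'E) // (old _ _ _ _ m8E).
have R' : vset m' arr_R = vset m arr_R :\: vset m3 arr_P.
  have R7 : m7 arr_R = m arr_R.
    rewrite (old _ _ _ _ m7E) // (old _ _ _ _ m6E) // (old _ _ _ _ m5E) //.
    by rewrite (old _ _ _ _ m4E) // to3.
  have P7 : m7 arr_P = m3 arr_P.
    by rewrite (old _ _ _ _ m7E) // (old _ _ _ _ m6E) // (old _ _ _ _ m5E) // (old _ _ _ _ m4E).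
  apply/setP=> v; rewrite in_setD !in_set (old _ _ _ _ m'E) // m8E.
  by rewrite run_let test_and test_not /= R7 P7 andbC.
have F4 i j : mrel m4 arr_F i j = [&& 0 < Y, mrel m3 arr_flow j i & mrel m arr_orient i j].
  by rewrite /mrel m4E run_let !test_and /= (to3 arr_Y) // (to3 arr_orient) // mY.
have o5 : mrel m5 arr_orient =2 flip (mrel m arr_orient) (mrel m4 arr_F).
  move=> i j; rewrite m5E flip_run; apply: flip_ext => // u v.
  by rewrite /mrel (old _ _ _ _ m4E) // to3.
have Y5 : m5 arr_Y = m arr_Y by rewrite (old _ _ _ _ m5E) // (old _ _ _ _ m4E) // to3.
have R5 : m5 arr_R = m arr_R by rewrite (old _ _ _ _ m5E) // (old _ _ _ _ m4E) // to3.
have P5 : m5 arr_P = m3 arr_P by rewrite (old _ _ _ _ m5E) // (old _ _ _ _ m4E).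
have F6 i j : mrel m6 arr_F i j = (0 < Y) && [&& j \in vset m3 arr_P,
    [&& i \in vset m arr_R, i \notin vset m3 arr_P & mrel m5 arr_orient i j] &
    #|[set u | [&& u \in vset m arr_R, u \notin vset m3 arr_P & mrel m5 arr_orient u j] &&
       (u < i)]| < Y - 1 - out (mrel m5 arr_orient) j].
  rewrite /mrel m6E run_let !test_and test_not test_less value_count /= (_ : m5 arr_Y i i = Y); last by rewrite Y5.
  rewrite value_outdegree //= P5 R5 !in_set; congr [&& _, _, _ & _ < _].
  apply: eq_card => u; rewrite !in_set !test_and test_not /= P5 R5 lt0b.
  by [].
have o7 : mrel m7 arr_orient =2 flip (mrel m5 arr_orient) (mrel m6 arr_F).
  move=> i j; rewrite m7E flip_run; apply: flip_ext => // u v.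
  by rewrite /mrel (old _ _ _ _ m6E).
split.
- by move=> i j; rewrite /mrel frame //; apply: mG.
- by move=> x v; rewrite frame ?mc //; case: x => [[|[|[|]]]].
- by move=> i j; rewrite frame.
- by move=> i j; rewrite frame.
- exact: Y'.
- exact: par'.
rewrite orient' R'; clear Y' par'.
case: Y rm le_Y mY mpar mgame F4 F6 => [|Y] rm le_Y mY mpar mgame F4 F6.
  have R0 : vset m arr_R = set0.
    apply/setP=> v; rewrite in_set0; apply/negP => /(game_track mgame).
    by apply/negP/on_track_end.
  rewrite R0 set0D; rewrite R0 in mgame; apply: game_ext mgame => i j.
  by rewrite o7 /flip !F6 /= !andbT o5 /flip !F4 /= !andbT.
have lt3 : lead k D Y.+1 < 3.
  by rewrite /lead; do ?case: ifP.
pose c := Ordinal lt3; have cE : c = lead k D Y.+1 :> nat by [].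
have [mw P1 Z1 keep1] := prepare_correct rm cE (ltn0Sn Y).
rewrite -m1E in mw P1 Z1 keep1.
set ab := (if _ then _ else _) in mw; have abE : (ab.1, ab.2) = ab by case: (ab).
have G1 : mrel m1 arr_graph =2 G by move=> i j; rewrite /mrel keep1 //; apply: mG.
have c1 : classed cl m1 by move=> x v; rewrite keep1 ?mc //; case: x => [[|[|[|]]]].
have Y1 : const m1 arr_Y Y.+1 by move=> i j; rewrite keep1.
have o1 : mrel m1 arr_orient = mrel m arr_orient by rewrite /mrel keep1.
have R1 : vset m1 arr_R = vset m arr_R by rewrite /vset keep1.
have game1 : game G cl k D Y.+1 (mrel m1 arr_orient) (vset m1 arr_R) by rewrite o1 R1.
have Yt : Y < k + 9 * D.+1 - 1 by [].
rewrite -o1 -R1 in Z1; rewrite -R1.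
have self : same m1 m1 by [].
have := search_correct z G1 c1 mw Y1 (game_orients game1) small Yt game1 cE Z1 abE self P1.
rewrite -m2E => -[e2 PZ st [demP [W1 re1 out1]]].
have := guard_correct z G1 c1 mw Y1 (game_orients game1) e2; cbv zeta; rewrite -m3E.
case=> re cU capU slackU _.
have capW := settled_caps re1 out1 re cU capU slackU.
have P3 : vset m3 arr_P = vset m2 arr_P by rewrite /vset (old _ _ _ _ m3E).
rewrite P3; move: PZ st demP re capW; rewrite Z1 => PZ st demP re capW.
have := level_step small Yt game1 cE PZ st (@val_inj _ _ _) demP re capW.
apply: game_ext => i j; symmetry; rewrite o7; apply: flip_ext => {}i {}j.
  rewrite o5; apply: flip_ext => {}i {}j; first by rewrite o1.
  by rewrite F4 o1.
have o5' : mrel m5 arr_orient =2 flip (mrel m1 arr_orient) (guards (mrel m1 arr_orient) (mrel m3 arr_flow)).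
  by move=> u v; rewrite o5; apply: flip_ext => a b; rewrite ?F4 o1.
have pullE u : (u \in pullable (mrel m1 arr_orient) (vset m1 arr_R) (vset m2 arr_P)
     (mrel m3 arr_flow) j) =
   [&& u \in vset m1 arr_R, u \notin vset m2 arr_P & mrel m5 arr_orient u j].
  by rewrite [LHS]in_set in_setD o5'; case: (u \in vset m1 _); case: (u \in vset m2 _).
rewrite F6 /pulls P3 -R1 subn1 /= (out_ext _ o5') pullE; congr [&& _, _ & _ < _].
by apply: eq_card => u; rewrite [LHS]in_set [RHS]in_set pullE.
Qed.

End Level.

(** * The whole algorithm *)

Definition Start :=
  Let arr_Y (Diff (Threshold 9) (Lit 1)) ;; Let arr_par (Lit 0) ;; Let arr_R (Lit 1).

(** There are up to [10 * n + 8] levels, and [n + 2] cubed rounds. *)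
Definition Levels := Repeat (Repeat (Repeat Level)).

Definition Orient :=
  Balance ;; Spread ;; Start ;; Levels ;;
  Let output_array (Cond (Cell arr_orient) (Lit 1) (Lit 0)).

Section Orient.
Variables (n : nat) (z : 'I_n) (G : sgraph 'I_n) (cl : 'I_n -> 'I_3).
Implicit Types m : store n.

Lemma levels_correct m k D Y : (forall v, nb G v (own cl v) <= D) ->
  ready G cl k D m Y -> Y <= k + 9 * D.+1 - 1 -> Y <= n.+2 * n.+2 * n.+2 ->
  ready G cl k D (run z Levels m) 0.
Proof.
move=> small rm le_Y many.
have -> : run z Levels m = iter (n.+2 * n.+2 * n.+2) (run z Level) m.
  by rewrite /Levels run_repeat run_repeats run_repeats; reflexivity.
have step i : ready G cl k D (iter i (run z Level) m) (Y - i).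
  elim: i => [|i IHi]; first by rewrite subn0.
  by rewrite iterS subnS; apply: level_correct => //; lia.
by have := step (n.+2 * n.+2 * n.+2); rewrite (eqP (many : _ - _ == 0)).
Qed.

Lemma orient_correct m k D : mrel m arr_graph =2 G -> classed cl m ->
  (mad G <= (2 * k)%:R)%R -> (forall v, nb G v (own cl v) <= D) ->
  exists o : rel 'I_n, [/\ orients G o, forall v, out o v <= k + 9 * D + 7,
    forall u v, G u v -> out o u != out o v
  & forall i j, run z Orient m output_array i j = o i j].
Proof.
move=> mG mc madG smallD.
have [m1 m1E] : {m1 | m1 = run z Balance m} by eexists; reflexivity.
have [m2 m2E] : {m2 | m2 = run z Spread m1} by eexists; reflexivity.
have [m3 m3E] : {m3 | m3 = run z Start m2} by eexists; reflexivity.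
have [m4 m4E] : {m4 | m4 = run z Levels m3} by eexists; reflexivity.
have outE i j : run z Orient m output_array i j = mrel m4 arr_orient i j.
  have -> : run z Orient m = run z (Let output_array (Cond (Cell arr_orient) (Lit 1) (Lit 0))) m4.
    by rewrite m4E m3E m2E m1E /Orient !run_then; reflexivity.
  by rewrite /= /assign /= /mrel; case: (0 < _).
have old (ma : store n) x p mb : ma = run z p mb -> x \notin writes p -> ma x = mb x.
  by move=> -> nx; rewrite run_frame.
have [k0 [k1 o1 out1 kn kmin]] : exists k, [/\ const m1 arr_k k, orients G (mrel m1 arr_orient),
    forall v, out (mrel m1 arr_orient) v <= k, k <= n &
    forall k', (mad G <= (2 * k')%:R)%R -> k <= k'].
  by rewrite m1E; apply: balance_correct.
have G1 : mrel m1 arr_graph =2 G.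
  by move=> i j; rewrite /mrel (old _ _ _ _ m1E) //; apply: mG.
have c1 : classed cl m1.
  by move=> x v; rewrite (old _ _ _ _ m1E) ?mc //; case: x => [[|[|[|]]]].
have [d [d2 small dn dmin]] : exists d, [/\ const m2 arr_d d,
    forall v, nb G v (own cl v) <= d, d <= n
  & forall d', (forall v, nb G v (own cl v) <= d') -> d <= d'].
  by rewrite m2E; apply: spread_correct.
have k2 : const m2 arr_k k0 by move=> i j; rewrite (old _ _ _ _ m2E).
have Y3 : const m3 arr_Y (k0 + 9 * d.+1 - 1).
  move=> i j; rewrite m3E -[run _ _ _ _ _ _]/(m2 arr_k i i +
    value m2 (cells z i j) (Scale 9 (Add (Here arr_d) (Lit 1))) - 1).
  by rewrite value_scale k2 -[value _ _ (Add _ _)]/(m2 arr_d i i + 1) d2 addn1.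
have R3 : vset m3 arr_R = [set: 'I_n].
  by apply/setP=> v; rewrite in_setT in_set m3E.
have o3 : mrel m3 arr_orient = mrel m1 arr_orient.
  by rewrite /mrel (old _ _ _ _ m3E) // (old _ _ _ _ m2E).
have ready3 : ready G cl k0 d m3 (k0 + 9 * d.+1 - 1).
  split.
  - by move=> i j; rewrite /mrel (old _ _ _ _ m3E) // (old _ _ _ _ m2E) //; apply: G1.
  - move=> x v; rewrite (old _ _ _ _ m3E) ?(old _ _ _ _ m2E) ?c1 //;
    by case: x => [[|[|[|]]]].
  - by move=> i j; rewrite (old _ _ _ _ m3E).
  - by move=> i j; rewrite (old _ _ _ _ m3E).
  - exact: Y3.
  - by move=> _ i j; rewrite m3E /depth subnn.
  - by rewrite R3 o3; apply: game_start.
have cube : n.+2 * n.+2 * n.+2 = n * n * n + 6 * (n * n) + 12 * n + 8 by lia.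
have := levels_correct small ready3 (leqnn _); rewrite -m4E cube => ready4.
have {}ready4 : ready G cl k0 d m4 0 by apply: ready4; lia.
have [o4 out4 proper4] := game_over (ready_game ready4).
exists (mrel m4 arr_orient); split=> // v; apply: leq_trans (out4 v) _.
(* The values found are minimal, hence at most the given [k] and [D]. *)
by have := kmin k madG; have := dmin D smallD; lia.
Qed.

End Orient.

Section Relabel.
Variables (T : finType) (G : sgraph T).

(** Programs deal with the vertex set ['I_n]; an arbitrary vertex set is
    numbered first. *)
Definition relabel_rel : rel 'I_#|T| := fun i j => G (enum_val i) (enum_val j).

Fact relabel_sym : symmetric relabel_rel.
Proof. by move=> i j; apply: edge_sym. Qed.

Fact relabel_irr : irreflexive relabel_rel.
Proof. by move=> i; apply: edge_irr. Qed.

Definition relabel := SGraph relabel_sym relabel_irr.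

Lemma mad_relabel : (mad relabel <= mad G)%R.
Proof.
pose f : 'I_#|T| -> T := enum_val.
have f_inj : injective f := @enum_val_inj _ _.
apply/Order.TotalTheory.bigmax_leP; split; first exact: Order.TotalTheory.bigmax_ge_id.
move=> [V E] /andP[/andP[/= /subsetP subE /subsetP covE] V0].
apply: (Order.TotalTheory.bigmax_sup (f @: V, [set f @: e | e : {set 'I_#|T|} in E])).
  apply/andP; split; last first.
    by apply: contra V0 => /= /eqP e; rewrite -(imset_eq0 f) e.
  apply/andP; split; apply/subsetP.
    move=> e /imsetP[e' /subE/imsetP[[i j] gij ->] ->].
    apply/imsetP; exists (f i, f j); first by move: gij; rewrite !inE.
    by rewrite /= imsetU !imset_set1.
  move=> x /bigcupP[e /imsetP[e' e'E ->] /imsetP[i ie ->]].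
  by apply/imset_f/covE/bigcupP; exists e'.
by rewrite /= (card_imset _ f_inj) (card_imset _ (imset_inj f_inj)).
Qed.

Lemma nb_relabel i (A : {set T}) : nb relabel i (enum_val @^-1: A) = nb G (enum_val i) A.
Proof.
rewrite /nb -(card_imset _ (@enum_val_inj _ _)); apply: eq_card => u; rewrite inE.
apply/imsetP/andP => [[j]|[uA gu]]; first by rewrite !inE => /andP[jA gj] ->.
by exists (enum_rank u); rewrite ?inE /= /relabel_rel !enum_rankK ?uA.
Qed.

End Relabel.

Lemma orientation_exists (T : finType) (G : sgraph T) (cl : T -> 'I_3) k D :
  (mad G <= (2 * k)%:R)%R -> (forall v, nb G v (own cl v) <= D) ->
  exists o : rel T, [/\ orients G o, forall v, out o v <= k + 9 * D + 7
    & forall u v, G u v -> out o u != out o v].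
Proof.
move=> madG small; have [T0|T_gt0] := posnP #|T|.
  by exists (fun _ _ => false); split=> u; case: (fintype0 u T0).
pose cl' (i : 'I_#|T|) := cl (enum_val i : T).
pose m : store #|T| := fun x i j => if x is c.+1 then cl' i == c :> nat else relabel G i j.
have mG : mrel m 0 =2 relabel G by move=> i j; rewrite /mrel /= lt0b.
have mc : classed cl' m by move=> c i; rewrite /= lt0b.
have madG' : (mad (relabel G) <= (2 * k)%:R)%R.
  exact: Order.POrderTheory.le_trans (mad_relabel G) madG.
have small' i : nb (relabel G) i (own cl' i) <= D.
  apply: leq_trans (small (enum_val i)); rewrite -nb_relabel; apply: nbS.
  by apply/subsetP=> j; rewrite !inE.
have [o [oG outo propo _]] := orient_correct (Ordinal T_gt0) mG mc madG' small'.
pose o' : rel T := fun u v => o (enum_rank u) (enum_rank v).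
have outE v : out o' v = out o (enum_rank v).
  rewrite /out -[RHS](card_imset _ (@enum_val_inj _ _)); apply: eq_card => u; rewrite inE.
  apply/idP/imsetP => [ou|[j]]; first by exists (enum_rank u); rewrite ?inE ?enum_rankK.
  by rewrite inE => oj ->; rewrite /o' enum_valK.
have edgeE u v : relabel G (enum_rank u) (enum_rank v) = G u v.
  by rewrite /= /relabel_rel !enum_rankK.
exists o'; split=> [u v|v|u v guv]; rewrite ?outE //; last by apply: propo; rewrite edgeE.
by rewrite /o' oG edgeE.
Qed.

Section Conclusion.
Variables (T : finType) (G : sgraph T) (V1 V2 V3 : {set T}).

Lemma orientation_set (o : rel T) B : orients G o -> (forall v, out o v <= B) ->
  (forall u v, G u v -> out o u != out o v) ->
  let Q := [set p | o p.1 p.2] in proper_orientation G Q /\ max_outdegree Q <= B.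
Proof.
move=> oG outB proper Q.
have outE v : outdegree Q v = out o v by apply: eq_card => u; rewrite !inE.
split; last by apply/bigmax_leqP => v _; rewrite outE.
apply/andP; split; apply/forallP=> u; apply/forallP=> v; last first.
  by apply/implyP => guv; rewrite !outE proper.
rewrite !inE /=; have := oG u v.
by case: (o u v); case: (o v u); case: (G u v).
Qed.

Definition class_of v : 'I_3 :=
  if v \in V1 then ord0 else if v \in V2 then lift ord0 ord0 else ord_max.

Hypothesis tri : tripartition V1 V2 V3.

Lemma class_ofE v : [/\ (v \in V1) = (class_of v == 0 :> nat),
  (v \in V2) = (class_of v == 1 :> nat) & (v \in V3) = (class_of v == 2 :> nat)].
Proof.
have /and4P[/eqP cover d12 d13 d23] := tri.
have := in_setT v; rewrite -cover !inE /class_of.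
case v1: (v \in V1); case v2: (v \in V2); case v3: (v \in V3) => //= _.
- by rewrite (disjointFr d12 v1) in v2.
- by rewrite (disjointFr d12 v1) in v2.
- by rewrite (disjointFr d13 v1) in v3.
- by rewrite (disjointFr d23 v2) in v3.
Qed.

Lemma degree_induced (V : {set T}) x : degree (induced G V) x = nb G (val x) V.
Proof.
rewrite /degree /nb -(card_imset _ val_inj); apply: eq_card => u; rewrite [RHS]inE.
apply/imsetP/andP => [[y]|[uV gu]]; first by rewrite inE => gy ->; split=> //; apply: valP.
by exists (Sub u uV); rewrite ?inE /= /induced_rel ?SubK.
Qed.

Lemma own_degree D : max_degree (induced G V1) <= D -> max_degree (induced G V2) <= D ->
  max_degree (induced G V3) <= D -> forall v, nb G v (own class_of v) <= D.
Proof.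
have part (V : {set T}) v : v \in V -> own class_of v = V -> max_degree (induced G V) <= D ->
    nb G v (own class_of v) <= D.
  move=> vV -> /(leq_trans _); apply.
  by have := @leq_bigmax _ (degree (induced G V)) (Sub v vV); rewrite degree_induced SubK.
move=> d1 d2 d3 v; have [e1 e2 e3] := class_ofE v.
have ownE (V : {set T}) i : (forall u, (u \in V) = (class_of u == i :> nat)) -> class_of v = i :> nat ->
    own class_of v = V.
  by move=> VE ci; apply/setP=> u; rewrite inE VE -ci.
have : [|| class_of v == 0 :> nat, class_of v == 1 :> nat | class_of v == 2 :> nat].
  by case: (class_of v) => [[|[|[|]]]].
case/or3P => ci.
- apply: part d1; [by rewrite e1|apply: ownE (eqP ci) => u; by case: (class_ofE u)].
- apply: part d2; [by rewrite e2|apply: ownE (eqP ci) => u; by case: (class_ofE u)].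
apply: part d3; [by rewrite e3|apply: ownE (eqP ci) => u; by case: (class_ofE u)].
Qed.

End Conclusion.

Lemma bound_F k D : k + 9 * D + 7 <= k + F D.
Proof. by rewrite /F /ceil_div; lia. Qed.

Theorem theorem1p1 :
  (forall (k D : nat) (T : finType) (G : sgraph T) (V1 V2 V3 : {set T}),
     (mad G <= (2 * k)%:R)%R ->
     tripartition V1 V2 V3 ->
     max_degree (induced G V1) <= D ->
     max_degree (induced G V2) <= D ->
     max_degree (induced G V3) <= D ->
     proper_orientation_number G <= k + F D /\
     k + F D <= k + (48 * D) %/ 5 + 8)
  /\
  (exists (prog : cmd) (a b : nat),
     forall (k D n : nat) (G : sgraph 'I_n) (V1 V2 V3 : {set 'I_n}),
       (mad G <= (2 * k)%:R)%R ->
       tripartition V1 V2 V3 ->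
       max_degree (induced G V1) <= D ->
       max_degree (induced G V2) <= D ->
       max_degree (induced G V3) <= D ->
       let w := encode_instance G V1 V2 V3 in
       exists (t : nat) (s : state) (Q : {set 'I_n * 'I_n}),
         [/\ exec prog (input_state w) t s,
             t <= a * (size w).+1 ^ b,
             output s = encode_orientation Q,
             proper_orientation G Q &
             max_outdegree Q <= k + F D]).
Proof.
split.
  move=> k D T G V1 V2 V3 madG tri d1 d2 d3; split; last first.
    by rewrite /F /ceil_div; lia.
  have [o [oG outo propo]] := orientation_exists madG (own_degree tri d1 d2 d3).
  have [Q_proper Q_max] := orientation_set oG outo propo.
  apply: leq_trans (leq_trans Q_max (bound_F k D)).
  rewrite /proper_orientation_number; case: ex_minnP => m _; apply.
  by apply/existsP; exists [set p | o p.1 p.2]; rewrite Q_proper eqxx.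
have [a [b correct]] := executable_correct Orient.
exists (executable Orient), a, b => k D n G V1 V2 V3 madG tri d1 d2 d3 w.
have [t [s [ex le_t]]] := correct n G V1 V2 V3.
case: n G V1 V2 V3 madG tri d1 d2 d3 @w ex le_t => [|n] G V1 V2 V3 madG tri d1 d2 d3 w ex le_t.
  move=> out; exists t, s, set0; split=> //.
  - rewrite out; apply/esym/nilP; rewrite /nilp size_encode_rel //.
  - apply/andP; split; apply/forallP; case=> //.
  - by apply/bigmax_leqP; case.
move=> [z [m [m0 [m1 m2 m3] out]]].
have mG : mrel m arr_graph =2 G by move=> i j; rewrite /mrel m0 lt0b.
have mc : classed (class_of V1 V2) m.
  move=> c v; have [e1 e2 e3] := class_ofE tri v.
  by case: c => [[|[|[|]]] ?]; rewrite ?m1 ?m2 ?m3 // lt0b ?e1 ?e2 ?e3.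
have [o [oG outo propo outE]] := orient_correct z mG mc madG (own_degree tri d1 d2 d3).
have [Q_proper Q_max] := orientation_set oG outo propo.
exists t, s, [set p | o p.1 p.2]; split=> //.
  rewrite out; congr (flatten _); apply: eq_map => i; apply: eq_map => j.
  by rewrite outE inE.
exact: leq_trans Q_max (bound_F k D).
Qed.
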